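(* Let $r\in(0,1)$ and let $$\kappa(s,x)=\mathbb{E}\Big(\frac1{M_1}e^{(\frac x2-b-1)\ln\frac{T_1}{M_1}-\frac s4\left(\ln\frac{T_1}{M_1}\right)^2}\Big),$$ where $T_1$ is an exponential random variable with parameter $1$ independent of $M_1$. Then $$Q_r(x)=C(r)e^{-a(r)x^2+bx}\,\kappa(4a(r),4a(r)x),\qquad x>\frac{b}{2a(r)}.$$ Moreover, $\kappa$ is a solution of the backward heat equation $$\frac{\partial\kappa(s,z)}{\partial s}=-\frac{\partial^2\kappa(s,z)}{\partial z^2},\qquad s>0,\ z>2b,$$ and it belongs to the class of non-negative functions such that: 1. $\kappa$ is convex and decreasing to $0$ in the variable $s$; 2. $\kappa$ is convex in the variable $z$; 3. $\frac{\partial\kappa}{\partial s}+\frac{\partial\kappa}{\partial z}\le\frac14\kappa$ for $s>0$, $z>2b$; 4. if $c_0>0$ is such that (for some constants $C_0,t_0>0$) $Q_1(x)\le C_0e^{-c_0x^2}$ for all $x\ge t_0$, then for any $p>1$ there exists a constant $L_p>1$ such that for every $s\ge0$ and $x\ge 2b+2$ $$\kappa(s,x)\le L_p^{x}\,e^{\frac{x^2p}{4(ps+4c_0)}}.$$ Furthermore, for every $p>1$ and every $c_0$ as in point 4, there exist $C_1(p,r)>0$ and $x_0(r)>0$ such that for $x>x_0(r)$ $$-a(r)x^2-C_1(p,r)x\ \le\ \ln Q_r(x)\ \le\ -\frac{a(r)c_0}{pa(r)+c_0}x^2+C_1(p,r)x.$$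
   Context: Let $d\ge 1$ be an integer, $B(0,r)$ the Euclidean ball of radius $r$ centered at $0$ in $\mathbb{R}^d$. Set $T(1)=\frac12$, $T(2)=1$, $T(d)=\exp\big(\sum_{k=1}^{d/2-1}\frac1{d-2k}\big)$ for even $d>2$, and $T(d)=\frac12\exp\big(\sum_{k=1}^{(d-1)/2}\frac1{d-2k}\big)$ for odd $d>2$. Assume $T\ge T(d)$. (By a theorem of Fuglede, $C(x,y)=\ln\frac{T}{|x-y|}$ is positive definite on $B(0,1)$ if and only if $T\ge T(d)$.) $Z$ is the centered generalized Gaussian random field on $B(0,1)$ with covariance $C$: it is indexed by signed measures $\mu=\mu_+-\mu_-$ with $\mu_\pm$ non-negative and $\int\int|C(x,y)|\mu_\pm(dx)\mu_\pm(dy)<\infty$, and $\int Z(x)\mu(dx)$ is centered Gaussian with variance $\int\int C(x,y)\mu(dx)\mu(dy)$. Fix $0<\gamma<\sqrt{2d}$. The Gaussian multiplicative chaos (GMC) $M_\gamma(\cdot)$ is the random measure on $B(0,1)$ formally given by $M_\gamma(A)=\int_A e^{\gamma Z(x)-\frac{\gamma^2}{2}\mathbb{E}Z(x)^2}dx$ and rigorously defined as the limit, in probability and in $L^1(\mathbb{P})$ as $\epsilon\to0$, of $M_\gamma^{(\epsilon)}(A)=\int_A e^{\gamma Z_\epsilon(x)-\frac{\gamma^2}{2}\mathbb{E}Z_\epsilon(x)^2}dx$, where $Z_\epsilon$ is the convolution of $Z$ with $\theta_\epsilon(\cdot)=\theta(\cdot/\epsilon)$, $\theta$ being a non-negative Radon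 measure supported in the unit ball with $\theta(\mathbb{R}^d)=1$ and $\int|\ln|x-y||\theta(dy)<\infty$ (e.g. a smooth mollifier); the limit exists. Write $M_1=M_\gamma(B(0,1))$. Notation: for $r\in(0,1)$, $a(r)=\frac{1}{2\gamma^2\ln\frac1r}$, $b=\frac12+\frac{d}{\gamma^2}$, $C(r)=\frac{r^{\frac{\gamma^2}{8}+\frac d2+\frac{d^2}{2\gamma^2}}}{\sqrt{2\pi\gamma^2\ln\frac1r}}$; and $Q_r(x)=\mathbb{E}e^{-e^xM_\gamma(B(0,r))}$ for $r\in(0,1]$, $x\in\mathbb{R}$. The function $\kappa(s,x)$ is considered for $x>2b$ and $s\ge 0$ (at $s=0$ it is given by the same formula with $s=0$). *)

(* Defs.v *)
From HB Require Import structures.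
From mathcomp Require Import all_boot all_order all_algebra.
From mathcomp Require Import all_classical all_reals all_analysis.
From mathcomp Require Import measurable_realfun.
Set Implicit Arguments.
Unset Strict Implicit.
Unset Printing Implicit Defensive.
Import Order.TTheory GRing.Theory Num.Theory.
Import numFieldNormedType.Exports.
Local Open Scope classical_set_scope.
Local Open Scope ring_scope.

(* R^d; [measurableTypeR R] is R with the measurable structure that carries
   [lebesgue_measure], and tuples over it get the product (Borel)
   sigma-algebra. *)
Notation Rd R d := (d.-tuple (measurableTypeR R)).

Definition tcons {R : realType} n (p : measurableTypeR R * Rd R n) : Rd R n.+1 :=
  [tuple of p.1 :: p.2].

Definition tuncons {R : realType} n (t : Rd R n.+1) : measurableTypeR R * Rd R n :=
  (thead t, [tuple of behead t]).

Lemma tconsK {R : realType} n : cancel (@tcons R n) (@tuncons R n).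
Proof. by case=> x t; rewrite /tuncons /= theadE; congr pair; exact: val_inj. Qed.

Lemma measurable_tcons {R : realType} n : measurable_fun setT (@tcons R n).
Proof. exact: measurable_cons. Qed.

Lemma measurable_tuncons {R : realType} n : measurable_fun setT (@tuncons R n).
Proof.
apply: measurable_fun_pair; first exact: measurable_tnth.
exact: measurable_behead.
Qed.

Section lebesgue_step.
Context {R : realType} (n : nat).
Variable mu : {sigma_finite_measure set (Rd R n) -> \bar R}.
Local Open Scope ereal_scope.

Local Notation prod := ((@lebesgue_measure R) \x mu).

Definition lebesgue_step : set (Rd R n.+1) -> \bar R :=
  pushforward prod (@tcons R n).

Let mpre (A : set (Rd R n.+1)) : measurable A -> measurable (@tcons R n @^-1` A).
Proof. by move=> mA; rewrite -[X in measurable X]setTI; exact: measurable_tcons. Qed.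

Let step0 : lebesgue_step set0 = 0.
Proof. by rewrite /lebesgue_step /pushforward preimage_set0 measure0. Qed.

Let step_ge0 A : 0 <= lebesgue_step A.
Proof. by rewrite /lebesgue_step /pushforward; apply: measure_ge0. Qed.

Let step_sigma_additive : semi_sigma_additive lebesgue_step.
Proof.
move=> F mF tF mUF; rewrite /lebesgue_step /pushforward preimage_bigcup.
apply: measure_semi_sigma_additive.
- by move=> k; exact: mpre.
- apply/trivIsetP => /= i j _ _ ij; rewrite -preimage_setI.
  by move/trivIsetP : tF => /(_ _ _ _ _ ij) ->//; rewrite preimage_set0.
- by rewrite -preimage_bigcup; exact: mpre.
Qed.

HB.instance Definition _ := isMeasure.Build _ _ _ lebesgue_step
  step0 step_ge0 step_sigma_additive.

Let step_sigma_finite : sigma_finite setT lebesgue_step.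
Proof.
have /sigma_finiteP[F [TF ndF Foo]] := sigma_finiteT (@lebesgue_measure R).
have /sigma_finiteP[G [TG ndG Goo]] := sigma_finiteT mu.
exists (fun k => @tuncons R n @^-1` (F k `*` G k)) => [|k].
  rewrite -preimage_bigcup (_ : \bigcup_i _ = setT) ?preimage_setT//.
  apply/seteqP; split => // -[x y] _.
  have [i _ Fix] : (\bigcup_i F i) x by rewrite -TF.
  have [j _ Gjy] : (\bigcup_i G i) y by rewrite -TG.
  exists (maxn i j) => //; split => /=.
  - by move: x Fix; exact/subsetPset/ndF/leq_maxl.
  - by move: y Gjy; exact/subsetPset/ndG/leq_maxr.
have [mF Fk] := Foo k; have [mG Gk] := Goo k; split.
  rewrite -[X in measurable X]setTI.
  by apply: measurable_tuncons => //; exact: measurableX.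
rewrite /lebesgue_step /pushforward -comp_preimage.
rewrite (_ : _ \o _ = id); last by apply/funext => p /=; rewrite tconsK.
by rewrite preimage_id product_measure1E// lte_mul_pinfty// ge0_fin_numE.
Qed.

HB.instance Definition _ := @Measure_isSigmaFinite.Build _ _ _ lebesgue_step
  step_sigma_finite.

End lebesgue_step.

Fixpoint lebesgue_measureT (R : realType) (n : nat) :
    {sigma_finite_measure set (Rd R n) -> \bar R} :=
  if n is m.+1 then lebesgue_step (lebesgue_measureT R m)
  else \d_([tuple] : Rd R 0).

Lemma measurable_box (R : realType) (n : nat)
    (A : 'I_n -> set (measurableTypeR R)) :
  (forall i, measurable (A i)) ->
  measurable [set x : Rd R n | forall i, A i (tnth x i)].
Proof.
move=> mA; rewrite (_ : mkset _ =
    \bigcap_(i in [set: 'I_n]) ((fun x : Rd R n => tnth x i) @^-1` A i)).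
  apply: fin_bigcap_measurable => [|i _]; first exact: finite_finset.
  by rewrite -[X in measurable X]setTI; exact: measurable_tnth.
by apply/seteqP; split => x Ax i; [move=> _|]; exact: Ax.
Qed.

Lemma lebesgue_measureT_box (R : realType) (n : nat)
    (A : 'I_n -> set (measurableTypeR R)) :
  (forall i, measurable (A i)) ->
  lebesgue_measureT R n [set x | forall i, A i (tnth x i)] =
  (\prod_(i < n) lebesgue_measure (A i))%E.
Proof.
elim: n A => [|n IHn] A mA.
  by rewrite big_ord0 /= diracE mem_set// => -[].
rewrite big_ord_recl -IHn; last by move=> i; exact: mA.
have mB := measurable_box (fun i => mA (lift ord0 i)).
rewrite -(product_measure1E lebesgue_measure (lebesgue_measureT R n) (mA ord0) mB).
rewrite /= /lebesgue_step /pushforward; congr (_ _).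
apply/seteqP; split => -[x t] /=.
- move=> At; split; first by have := At ord0; rewrite tnth0.
  by move=> i; have := At (lift ord0 i); rewrite tnthS.
- move=> [Ax At] i; case: (unliftP ord0 i) => [j|] ->.
  + by rewrite tnthS; exact: At.
  + by rewrite tnth0.
Qed.

Section euclidean.
Context {R : realType} {d : nat}.
Implicit Types x y : Rd R d.

Definition edist x y : R :=
  Num.sqrt (\sum_(i < d) ((tnth x i : R) - (tnth y i : R)) ^+ 2).

Definition origin : Rd R d := [tuple (0 : R) | i < d].

Definition eball (r : R) : set (Rd R d) := [set x | edist x origin < r].

Lemma measurable_coord (i : 'I_d) :
  measurable_fun setT (fun x => tnth x i : R).
Proof. exact: measurable_tnth. Qed.

Lemma measurable_edist x : measurable_fun setT (edist ^~ x).
Proof.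
pose g y := \sum_(i < d) ((tnth y i : R) - (tnth x i : R)) ^+ 2.
apply: (@measurableT_comp _ _ _ _ _ _ (@Num.sqrt R) _ g).
  by apply: continuous_measurable_fun; exact: sqrt_continuous.
apply: measurable_sum => i; apply: measurable_funX.
by apply: measurable_funB => //; exact: measurable_coord.
Qed.

Lemma measurable_eball r : measurable (eball r).
Proof.
rewrite /eball -[X in measurable X]setTI.
rewrite (_ : mkset _ = (edist ^~ origin) @^-1` `]-oo, r[%classic); last first.
  by apply/seteqP; split => x /=; rewrite in_itv.
by apply: measurable_edist => //; exact: measurable_itv.
Qed.

Definition reflect_scale (e : R) x y : Rd R d :=
  [tuple (tnth x i : R) - e * (tnth y i : R) | i < d].

Lemma measurable_reflect_scale e x : measurable_fun setT (reflect_scale e x).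
Proof.
apply/measurable_fun_tnthP => i.
rewrite (_ : _ \o _ = fun y => (tnth x i : R) - e * (tnth y i : R)); last first.
  by apply/funext => y /=; rewrite tnth_mktuple.
apply: measurable_funB => //; apply: measurable_funM => //.
exact: measurable_coord.
Qed.

HB.instance Definition _ e x := isMeasurableFun.Build _ _ _ _
  (reflect_scale e x) (measurable_reflect_scale e x).

End euclidean.

Section log_correlated_field.
Context {R : realType} {d : nat}.
Local Open Scope ereal_scope.

Definition log_kernel (T : R) (x y : Rd R d) : \bar R :=
  if edist x y == 0%R then +oo else (ln (T / edist x y))%:E.

(* mu = mpos - mneg; two pairs with the same difference represent the same
   signed measure, and the covariance below does not distinguish them. *)
Record signed_measure := SignedMeasure {
  mpos : {finite_measure set (Rd R d) -> \bar R} ;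
  mneg : {finite_measure set (Rd R d) -> \bar R} }.

Definition finite_energy (T : R) (mu : {measure set (Rd R d) -> \bar R}) :=
  mu (~` eball 1) = 0 /\
  \int[mu]_x \int[mu]_y `|log_kernel T x y| < +oo.

Definition admissible (T : R) (mu : signed_measure) :=
  finite_energy T (mpos mu) /\ finite_energy T (mneg mu).

Definition energy (T : R) (mu nu : {measure set (Rd R d) -> \bar R}) : R :=
  fine (\int[mu]_x \int[nu]_y log_kernel T x y).

Definition log_cov (T : R) (mu nu : signed_measure) : R :=
  (energy T (mpos mu) (mpos nu) - energy T (mpos mu) (mneg nu)
   - energy T (mneg mu) (mpos nu) + energy T (mneg mu) (mneg nu))%R.

Context {dO : measure_display} {Omega : measurableType dO}.
Variable P : probability Omega R.

Definition centered_gaussian (X : Omega -> R) (v : R) :=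
  (0 <= v)%R /\ forall A : set (measurableTypeR R), measurable A ->
    P (X @^-1` A) = if v == 0%R then \d_(0%R : measurableTypeR R) A
                    else normal_prob 0%R (Num.sqrt v) A.

(* All finite linear combinations are centered Gaussian with the prescribed
   variance: Z is a centered Gaussian process with covariance [log_cov T]; in
   particular Z is almost surely linear. *)
Definition log_field (T : R) (Z : signed_measure -> {RV P >-> R}) :=
  forall (n : nat) (mu : 'I_n -> signed_measure) (c : 'I_n -> R),
  (forall i, admissible T (mu i)) ->
  centered_gaussian (fun w => \sum_(i < n) c i * Z (mu i) w)%R
    (\sum_(i < n) \sum_(j < n) c i * c j * log_cov T (mu i) (mu j))%R.

End log_correlated_field.
Arguments signed_measure : clear implicits.

(* Fuglede's threshold T(d); both sums are empty for d <= 2. *)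
Definition fuglede_T (R : realType) (d : nat) : R :=
  if odd d then
    2^-1 * expR (\sum_(1 <= k < (d.-1)./2.+1) ((d - 2 * k)%N%:R)^-1)
  else expR (\sum_(1 <= k < d./2) ((d - 2 * k)%N%:R)^-1).

Section chaos.
Context {R : realType} {d : nat}.
Local Open Scope ereal_scope.

Definition abs_log (x y : Rd R d) : \bar R :=
  if edist x y == 0%R then +oo else `|(ln (edist x y))%:E|.

(* The last clause makes the translates of the rescaled theta finite-energy
   measures, so that they can be paired with the field. *)
Definition mollifier (theta : probability (Rd R d) R) :=
  [/\ theta [set x | (1 < edist x origin)%R] = 0,
      forall x, \int[theta]_y abs_log x y < +oo &
      \int[theta]_x \int[theta]_y abs_log x y < +oo].

Definition theta_eps (theta : probability (Rd R d) R) (e : R) (x : Rd R d) :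
    {finite_measure set (Rd R d) -> \bar R} :=
  mrestr (distribution theta (reflect_scale e x)) (measurable_eball 1).

(* The measure whose pairing with the field is (Z * theta_e)(x), the field
   being extended by 0 outside the unit ball. *)
Definition mollifier_at (theta : probability (Rd R d) R) (e : R) (x : Rd R d) :
    signed_measure R d :=
  SignedMeasure (theta_eps theta e x) mzero.

Context {dO : measure_display} {Omega : measurableType dO}.
Variable P : probability Omega R.

(* Y e is a jointly measurable version of the field x |-> (Z * theta_e)(x). *)
Definition regularization (Z : signed_measure R d -> {RV P >-> R})
    (theta : probability (Rd R d) R) (Y : R -> Rd R d * Omega -> R) :=
  forall e : R, (0 < e)%R ->
    measurable_fun setT (Y e) /\
    forall x, eball 1 x ->
      {ae P, forall w, Y e (x, w) = Z (mollifier_at theta e x) w}.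

Definition chaos_approx (gamma : R) (Y : R -> Rd R d * Omega -> R)
    (e : R) (A : set (Rd R d)) (w : Omega) : \bar R :=
  \int[lebesgue_measureT R d]_(x in A)
    (expR (gamma * Y e (x, w)
           - gamma ^+ 2 / 2 * fine 'E_P[fun w' => (Y e (x, w') ^+ 2)%R]))%:E.

(* M is the Gaussian multiplicative chaos of Z. Convergence in L^1(P) contains
   convergence in probability; only the restriction of M to the unit ball
   matters. *)
Definition is_gmc (gamma : R) (Z : signed_measure R d -> {RV P >-> R})
    (theta : probability (Rd R d) R) (M : R.-ker Omega ~> Rd R d) :=
  exists Y, regularization Z theta Y /\
    forall A : set (Rd R d), measurable A -> A `<=` eball 1 ->
      \int[P]_w `|chaos_approx gamma Y e A w - M w A| @[e --> 0^'+] --> 0.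

Definition ball_mass (M : R.-ker Omega ~> Rd R d) (r : R) (w : Omega) : R :=
  fine (M w (eball r)).

Definition laplace (M : R.-ker Omega ~> Rd R d) (r x : R) : R :=
  fine 'E_P[fun w => expR (- (expR x * ball_mass M r w))].

Definition independent_RV (X Y : Omega -> R) :=
  forall A B : set (measurableTypeR R), measurable A -> measurable B ->
    P (X @^-1` A `&` Y @^-1` B) = P (X @^-1` A) * P (Y @^-1` B).

Definition exponential_RV (rate : R) (X : Omega -> R) :=
  forall A : set (measurableTypeR R), measurable A ->
    P (X @^-1` A) = exponential_prob rate A.

(* Extended-valued: for s = 0 the expectation is, up to a Gamma factor, a
   negative moment of M1. *)
Definition kappa (b : R) (T1 M1 : Omega -> R) (s x : R) : \bar R :=
  'E_P[fun w => ((M1 w)^-1 *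
    expR ((x / 2 - b - 1) * ln (T1 w / M1 w)
          - s / 4 * ln (T1 w / M1 w) ^+ 2))%R].

End chaos.

Section coefficients.
Context {R : realType}.

Definition coef_a (gamma r : R) : R := (2 * gamma ^+ 2 * ln r^-1)^-1.

Definition coef_b (d : nat) (gamma : R) : R := 2^-1 + d%:R / gamma ^+ 2.

Definition coef_C (d : nat) (gamma r : R) : R :=
  r `^ (gamma ^+ 2 / 8 + d%:R / 2 + d%:R ^+ 2 / (2 * gamma ^+ 2))
  / Num.sqrt (2 * pi * gamma ^+ 2 * ln r^-1).

Definition gaussian_tail (Q : R -> R) (c0 : R) : Prop :=
  0 < c0 /\ exists C0 t0 : R, [/\ 0 < C0, 0 < t0 &
    forall x : R, t0 <= x -> Q x <= C0 * expR (- (c0 * x ^+ 2))].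

End coefficients.

Section convexity.
Context {R : realType}.
Local Open Scope ereal_scope.

Definition econvex_on (D : set R) (f : R -> \bar R) :=
  forall x y t : R, D x -> D y -> (0 <= t <= 1)%R ->
    f (t * x + (1 - t) * y)%R <= t%:E * f x + (1 - t)%:E * f y.

End convexity.

(* Main.v *)
Require Import Defs.
From HB Require Import structures.
From mathcomp Require Import all_boot all_order all_algebra.
From mathcomp Require Import all_classical all_reals all_analysis.
From mathcomp Require Import measurable_realfun.
From mathcomp Require Import ring lra.
Set Implicit Arguments.
Unset Strict Implicit.
Unset Printing Implicit Defensive.
Import Order.TTheory GRing.Theory Num.Theory.
Import numFieldNormedType.Exports.
Local Open Scope classical_set_scope.
Local Open Scope ring_scope.

(** The covariance [ln (T / |x - y|)] is exactly additive under dilations: if [Z]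
    is mollified at scale [r e] and read at [r x], its covariance is that of [Z]
    mollified at scale [e] and read at [x], plus the constant [l = ln (1 / r)].
    So on the ball of radius [r] the field is a rescaled copy of itself plus an
    independent Gaussian constant of variance [l], and the mass that the chaos
    gives to that ball has the law of
    [r ^ d * exp (gamma N - gamma^2 l / 2) * M_1], with [N] independent of [M_1]
    ([gmc_scaling]). In terms of [Q_r (x) = E exp (- e^x M_r)] this says that
    [Q_r] is [Q_1] convolved with a Gaussian density of variance
    [gamma^2 l = 1 / (2 a)], centred at [x - b / (2 a)]. Expanding the square in
    the exponent gives the prefactor [C(r) exp (- a x^2 + b x)] times
    [F (4 a, 4 a x)], where
    [F (s, z) = \int Q_1 (y) exp ((z / 2 - b) y - s y^2 / 4) dy]
    ([laplace_scaling]).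

    The function [kappa] is this same [F]: conditionally on [M_1 = m], put
    [t = m e^y] in the integral against the exponential density, and exchange
    the integrals over [y] and over [M_1] ([kappa_integral]). Every property of
    [kappa] is then read off a mixture of exponentials. Each derivative in [z]
    brings down [y / 2] and each derivative in [s] brings down [- y^2 / 4], hence
    the backward heat equation; convexity is that of the exponential; and
    [d_s + d_z - 1/4] brings down [- (y - 1)^2 / 4], hence the differential
    inequality. The growth bound splits the integral at the point [t_0] after
    which [Q_1] has its Gaussian bound, and completes the square beyond it; the
    two-sided estimate of [ln Q_r] is this bound together with a lower bound
    of [F (4 a, .)] by a positive constant.

    Two points need an argument of their own. The first is how the covariance
    determines the chaos. Only linear combinations of the regularized field are
    known to be Gaussian, so equality of laws has to be passed on from the
    characteristic functions of linear combinations to a Laplace transform of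
    the nonlinear functional [\int b(x) exp (gamma Y(x)) dx]. This is done by
    [eq_char_eq_laplace]. A function [exp (- q (y - m)^2)] is a Gaussian average
    of cosines, so that expectations of products of such bumps at finitely many
    points are determined; integrating over the points determines all moments
    of [\int b(x) exp (- q (Y(x) - m)^2) dx], a bounded variable, hence its
    Laplace transform; and since
    [exp (g y - q y^2)] is a multiple of such a gauss_bump, letting [q] tend to [0]
    reaches the exponential. No continuity of the field in [x] is involved.

    The second is that [M_1 > 0] almost surely, without which [kappa] could not
    be the integral above ([ball_mass_gt0_ae]). Let [p] be the probability that
    [M_1 = 0]. Self-similarity gives the same probability to [M_r = 0], so
    up to a null set both events agree with one event [N]. By tilting the
    probability by [exp (gamma Y(x) - gamma^2 / 2 E Y(x)^2)] with [x] at a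
    distance from a small ball, the chaos of that ball is multiplied by a
    bounded density, so that [N] keeps probability at least [p] under the tilted
    law. Integrated over [x] in an annulus [A], this reads
    [|A| p <= E (1_N M^e(A))], and the right-hand side tends to
    [E (1_N M(A)) = 0]. *)

(** * Integrals *)

Section density.
Local Open Scope ereal_scope.
Import HBNNSimple.

(** Both sides agree on simple functions and pass to the limit by monotone
    convergence; the density is only known through the values of the
    measure on sets, as it is for the normal and exponential laws. *)
Lemma ge0_integral_density d (T : measurableType d) (R : realType)
    (mu nu : {measure set T -> \bar R}) (g : T -> R) (f : T -> \bar R) :
  measurable_fun setT g -> (forall x, (0 <= g x)%R) ->
  (forall A, measurable A -> nu A = \int[mu]_(x in A) (g x)%:E) ->
  measurable_fun setT f -> (forall x, 0 <= f x) ->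
  \int[nu]_x f x = \int[mu]_x (f x * (g x)%:E).
Proof.
move=> mg g0 nuE mf f0.
pose h := nnsfun_approx measurableT mf.
have hf x : (h n x)%:E @[n --> \oo] --> f x by exact: cvg_nnsfun_approx.
have h0 n x : 0 <= (h n x)%:E by rewrite lee_fin.
have hnd x : {homo (fun n => (h n x)%:E) : a b / (a <= b)%N >-> a <= b}.
  by move=> a b ab; rewrite lee_fin; exact/lefP/nd_nnsfun_approx.
have mh n : measurable_fun setT (fun x => (h n x)%:E).
  exact/measurable_EFinP.
have lim1 : \int[nu]_x (h n x)%:E @[n --> \oo] --> \int[nu]_x f x.
  rewrite [X in _ --> X](_ : _ = \int[nu]_x limn (fun n => (h n x)%:E)).
    by apply: cvg_monotone_convergence => // x _; exact: hnd.
  by apply: eq_integral => x _; apply/esym/cvg_lim.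
have lim2 : \int[mu]_x ((h n x)%:E * (g x)%:E) @[n --> \oo] -->
    \int[mu]_x (f x * (g x)%:E).
  rewrite [X in _ --> X](_ : _ =
      \int[mu]_x limn (fun n => (h n x)%:E * (g x)%:E)).
    apply: cvg_monotone_convergence => //.
    - by move=> n; apply: emeasurable_funM => //; exact/measurable_EFinP.
    - by move=> n x _; rewrite mule_ge0// lee_fin.
    - by move=> x _ a b ab; apply: lee_wpmul2r; [rewrite lee_fin|exact: hnd].
  apply: eq_integral => x _; apply/esym/cvg_lim => //.
  by apply: cvgeZr => //; exact: hf.
suff E n : \int[nu]_x (h n x)%:E = \int[mu]_x ((h n x)%:E * (g x)%:E).
  by move: lim1; rewrite (funext E) => lim1; exact: (cvg_unique _ lim1 lim2).
transitivity (\int[nu]_x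
   (\sum_(y \in range (h n)) (y * \1_(h n @^-1` [set y]) x)%:E)).
  by apply: eq_integral => t tE; rewrite /= fimfunE -fsumEFin.
rewrite ge0_integral_fsum//; last 2 first.
- by move=> y; apply/measurable_EFinP; exact: measurable_funM.
- by move=> m y _; exact: nnfun_muleindic_ge0.
transitivity (\int[mu]_x (\sum_(y \in range (h n))
    (y * \1_(h n @^-1` [set y]) x)%:E * (g x)%:E)); last first.
  apply: eq_integral => x xE.
  rewrite -ge0_mule_fsuml => [|y]; last exact: nnfun_muleindic_ge0.
  by rewrite fsumEFin // -(fimfunE _ x).
rewrite ge0_integral_fsum//; last 2 first.
- move=> y; apply: emeasurable_funM; last exact/measurable_EFinP.
  by apply/measurable_EFinP; exact: measurable_funM.
- by move=> m y Ey; rewrite mule_ge0 ?lee_fin// -lee_fin nnfun_muleindic_ge0.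
apply: eq_fsbigr => r /set_mem[x _ hx].
have r0 : (0 <= r)%R by rewrite -hx.
under eq_integral do rewrite EFinM.
rewrite ge0_integralZl//; last exact/measurable_EFinP.
rewrite integral_indic//= setIT nuE//.
under [RHS]eq_integral do rewrite EFinM -muleA.
rewrite ge0_integralZl//; last 2 first.
- by apply: emeasurable_funM; exact/measurable_EFinP.
- by move=> y _; rewrite mule_ge0// lee_fin.
congr (_ * _).
rewrite integral_mkcond; apply: eq_integral => y _.
rewrite patchE indicE; case: ifPn => [yA|yA].
  by rewrite mul1e.
by rewrite mul0e.
Qed.
End density.

Section dct.
Context d (T : measurableType d) (R : realType) (mu : {measure set T -> \bar R}).

Lemma Rintegral_dominated_cvg (f_ : nat -> T -> R) (f g : T -> R) :
  (forall n, measurable_fun setT (f_ n)) -> measurable_fun setT f ->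
  {ae mu, forall x, f_ n x @[n --> \oo] --> f x} ->
  mu.-integrable setT (EFin \o g) ->
  (forall n x, `|f_ n x| <= g x) ->
  \int[mu]_x f_ n x @[n --> \oo] --> \int[mu]_x f x.
Proof.
move=> mf_ mf cvgf intg f_g.
have H1 n : measurable_fun setT (EFin \o f_ n) by exact/measurable_EFinP.
have H2 : measurable_fun setT (EFin \o f) by exact/measurable_EFinP.
have H3 : {ae mu, forall x, setT x -> (EFin \o f_ n) x @[n --> \oo] --> (EFin \o f) x}.
  by apply: filterS cvgf => x cx _; apply: cvg_EFin => //; exact: nearW.
have H4 : {ae mu, forall x n, setT x -> (`|(EFin \o f_ n) x| <= (EFin \o g) x)%E}.
  by apply: aeW => x n _; rewrite /= lee_fin.
have [intf _ h] := dominated_convergence measurableT H1 H2 H3 intg H4.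
by apply: fine_cvg; rewrite fineK//; exact: integrable_fin_num.
Qed.

Lemma integrable_le (f g : T -> R) :
  measurable_fun setT f -> (forall x, `|f x| <= g x) ->
  mu.-integrable setT (EFin \o g) -> mu.-integrable setT (EFin \o f).
Proof.
move=> mf fg; apply: le_integrable => //; first exact/measurable_EFinP.
by move=> x _; rewrite /= lee_fin (le_trans (fg x))// ler_norm.
Qed.

End dct.

Lemma integrable_bounded d (T : measurableType d) (R : realType)
    (mu : {finite_measure set T -> \bar R}) (f : T -> R) (C : R) :
  measurable_fun setT f -> (forall x, `|f x| <= C) ->
  mu.-integrable setT (EFin \o f).
Proof.
move=> mf fC; apply: (integrable_le (g := fun=> C)) => //.
exact: finite_measure_integrable_cst.
Qed.

Section integrable_real.
Context d (T : measurableType d) (R : realType) (mu : {measure set T -> \bar R}).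
Implicit Types f g : T -> R.

Lemma integrable_addr f g : mu.-integrable setT (EFin \o f) ->
  mu.-integrable setT (EFin \o g) ->
  mu.-integrable setT (EFin \o (fun x => f x + g x)).
Proof. by move=> fi gi; apply: (integrableD measurableT fi gi). Qed.

Lemma integrable_subr f g : mu.-integrable setT (EFin \o f) ->
  mu.-integrable setT (EFin \o g) ->
  mu.-integrable setT (EFin \o (fun x => f x - g x)).
Proof. by move=> fi gi; apply: (integrableB measurableT fi gi). Qed.

Lemma integrable_scaler (k : R) f : mu.-integrable setT (EFin \o f) ->
  mu.-integrable setT (EFin \o (fun x => k * f x)).
Proof. by move=> fi; apply: (integrableZl measurableT k fi). Qed.

Lemma integrable_measurable f : mu.-integrable setT (EFin \o f) ->
  measurable_fun setT f.
Proof. by move=> /measurable_int/measurable_EFinP. Qed.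

End integrable_real.

Section Rintegral_finite_sum.
Context d (T : measurableType d) (R : realType) (mu : {measure set T -> \bar R}).
Variables (I : Type) (f : I -> T -> R).
Hypothesis intf : forall i, mu.-integrable setT (EFin \o f i).

Lemma integrable_sumr (s : seq I) :
  mu.-integrable setT (EFin \o (fun x => \sum_(i <- s) f i x)).
Proof.
elim: s => [|i s IH].
  rewrite (_ : _ \o _ = cst 0%E); first exact: integrable0.
  by apply/funext => x /=; rewrite big_nil.
rewrite (_ : _ \o _ = EFin \o (fun x => f i x + \sum_(j <- s) f j x)).
  exact: integrable_addr.
by apply/funext => x /=; rewrite big_cons.
Qed.

Lemma Rintegral_sumr (s : seq I) :
  \int[mu]_x (\sum_(i <- s) f i x) = \sum_(i <- s) \int[mu]_x f i x.
Proof.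
elim: s => [|i s IH].
  by rewrite big_nil; under eq_Rintegral do rewrite big_nil; rewrite /Rintegral integral0.
under eq_Rintegral do rewrite big_cons.
by rewrite big_cons RintegralD// ?IH//; exact: integrable_sumr.
Qed.
End Rintegral_finite_sum.

Section fubini_real.
Context d1 d2 (T1 : measurableType d1) (T2 : measurableType d2) (R : realType).
Variables (m1 : {sigma_finite_measure set T1 -> \bar R})
          (m2 : {sigma_finite_measure set T2 -> \bar R}).
Variables (f : T1 * T2 -> R) (g : T1 -> R) (h : T2 -> R).
Hypothesis mf : measurable_fun setT f.
Hypothesis fgh : forall w x, `|f (w, x)| <= g w * h x.
Hypothesis ig : m1.-integrable setT (EFin \o g).
Hypothesis ih : m2.-integrable setT (EFin \o h).

Lemma integrable_prod_dominated : (m1 \x m2)%E.-integrable setT (EFin \o f).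
Proof.
apply/integrable12ltyP; first exact/measurable_EFinP.
have mg := integrable_measurable ig.
have mh := integrable_measurable ih.
apply: (@le_lt_trans _ _ (\int[m1]_x \int[m2]_y (`|g x|%:E * `|h y|%:E))%E).
  apply: ge0_le_integral => //.
  - by move=> x _; exact: integral_ge0.
  - apply: (measurable_fun_fubini_tonelli_F (fun z => `|(f z)%:E|%E)) => //.
    by apply: measurableT_comp => //; exact/measurable_EFinP.
  - apply: (measurable_fun_fubini_tonelli_F (fun z : T1 * T2 => `|g z.1|%:E * `|h z.2|%:E)%E) => //.
    apply: emeasurable_funM; apply/measurable_EFinP; apply: measurableT_comp => //;
      exact: measurableT_comp.
  - move=> x _; apply: ge0_le_integral => //.
    + apply: measurableT_comp => //; apply/measurable_EFinP.
      exact: (measurableT_comp mf (pair1_measurable x)).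
    + by apply/measurable_EFinP; apply: measurable_funM => //; exact: measurableT_comp.
    + move=> y _; rewrite -EFinM lee_fin -normrM.
      exact: le_trans (fgh x y) (ler_norm _).
under eq_integral.
  move=> x _; rewrite ge0_integralZl//; last by apply/measurable_EFinP; exact: measurableT_comp.
  over.
rewrite ge0_integralZr//; last 2 first.
- by apply/measurable_EFinP; exact: measurableT_comp.
- by apply: integral_ge0 => y _; rewrite lee_fin.
by apply: lte_mul_pinfty; rewrite ?integral_ge0//; move/integrableP: ig ih => [_ +] /integrableP[_ +];
   rewrite ?ge0_fin_numE ?integral_ge0.
Qed.

Lemma integrable_section1 w : m2.-integrable setT (EFin \o (fun x => f (w, x))).
Proof.
apply: (@integrable_le _ _ _ m2 _ (fun x => g w * h x)).
- exact: (measurableT_comp mf (pair1_measurable w)).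
- by move=> x; exact: fgh.
- exact: integrable_scaler.
Qed.

Lemma integrable_section2 x : m1.-integrable setT (EFin \o (fun w => f (w, x))).
Proof.
apply: (@integrable_le _ _ _ m1 _ (fun w => h x * g w)).
- exact: (measurableT_comp mf (pair2_measurable x)).
- by move=> w; rewrite mulrC; exact: fgh.
- exact: integrable_scaler.
Qed.

Lemma Rintegral_fubini :
  \int[m1]_w \int[m2]_x f (w, x) = \int[m2]_x \int[m1]_w f (w, x).
Proof.
rewrite /Rintegral.
under eq_integral do rewrite fineK ?(integrable_fin_num measurableT (integrable_section1 _))//.
under [in RHS]eq_integral do rewrite fineK ?(integrable_fin_num measurableT (integrable_section2 _))//.
by rewrite (Fubini integrable_prod_dominated).
Qed.

Lemma measurable_Rintegral_fubini :
  measurable_fun setT (fun w => \int[m2]_x f (w, x)).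
Proof.
apply/measurable_EFinP.
have := measurable_fubini_F integrable_prod_dominated.
rewrite /fubini_F; congr (measurable_fun _ _); apply/funext => w /=.
by rewrite /Rintegral fineK// (integrable_fin_num measurableT (integrable_section1 _)).
Qed.

End fubini_real.

Definition affine {R : realType} (a c : R) (x : measurableTypeR R) :
  measurableTypeR R := a * x + c.

Lemma measurable_affine {R : realType} (a c : R) :
  measurable_fun setT (affine a c).
Proof. by apply: measurable_funD => //; exact: measurable_funM. Qed.

HB.instance Definition _ (R : realType) (a c : R) :=
  isMeasurableFun.Build _ _ _ _ (affine a c) (measurable_affine a c).

Section lebesgue_affine.
Context {R : realType}.
Local Notation mu := (@lebesgue_measure R).
Variables a c : R.
Hypothesis a0 : 0 < a.
Local Notation af := (affine a c).

Let k : {nonneg R} := NngNum (ltW a0).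

(** Both sides are measures that agree on intervals. *)
Lemma lebesgue_measure_affine (A : set (measurableTypeR R)) : measurable A ->
  mu A = (a%:E * mu (af @^-1` A))%E.
Proof.
move=> mA.
pose nu := mscale k (measure_function_pushforward__canonical__measure_function_Measure mu (measurable_affine a c)).
suff : mu A = nu A by [].
apply: lebesgue_measure_unique => // _ [[x y]] _ <-.
suff : mu `]x, y]%classic = (a%:E * mu (af @^-1` `]x, y]%classic))%E by [].
have -> : af @^-1` `]x, y]%classic = `](x - c) / a, (y - c) / a]%classic.
  apply/seteqP; split => z /=; rewrite !in_itv/= /affine ltr_pdivrMr// ler_pdivlMr//.
    by move=> /andP[h1 h2]; apply/andP; split; lra.
  by move=> /andP[h1 h2]; apply/andP; split; lra.
rewrite !lebesgue_measure_itv/= !lte_fin ltr_pM2r ?invr_gt0// ltrD2r.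
case: ifPn => _; last by rewrite mule0.
by rewrite -!EFinB -EFinM; congr EFin; field; rewrite gt_eqF.
Qed.

Lemma ge0_integral_affine (f : R -> \bar R) : measurable_fun setT f ->
  (forall x, 0 <= f x)%E ->
  (\int[mu]_x f x = a%:E * \int[mu]_x f (a * x + c)%R)%E.
Proof.
move=> mf f0.
rewrite (eq_measure_integral (mscale k
    (measure_function_pushforward__canonical__measure_function_Measure mu (measurable_affine a c)))); last first.
  by move=> A mA _; exact: lebesgue_measure_affine.
rewrite ge0_integral_mscale//; congr (_ * _)%E.
by rewrite ge0_integral_pushforward.
Qed.
End lebesgue_affine.

Lemma Rintegral_shift (R : realType) (c : R) (f : R -> R) : measurable_fun setT f ->
  \int[lebesgue_measure]_x f x = \int[lebesgue_measure]_x f (x + c).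
Proof.
move=> mf; rewrite /Rintegral [in LHS]integralE [in RHS]integralE.
have me : measurable_fun setT (EFin \o f) by exact/measurable_EFinP.
rewrite (@ge0_integral_affine _ 1 c ltr01 (EFin \o f)^\+%E) ?mul1e//; last first.
  exact: measurable_funepos.
rewrite (@ge0_integral_affine _ 1 c ltr01 (EFin \o f)^\-%E) ?mul1e//; last first.
  exact: measurable_funeneg.
congr (fine (_ - _)); apply: eq_integral => x _; rewrite mul1r.
  by rewrite !funeposE.
by rewrite !funenegE.
Qed.

(** Valid also when the integral is infinite, as [fine] sends both sides
    to zero. *)
Lemma ge0_RintegralZl d (U : measurableType d) (R : realType)
    (mu : {measure set U -> \bar R}) (f : U -> R) (k : R) :
  measurable_fun setT f -> (forall x, 0 <= f x) -> 0 <= k ->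
  \int[mu]_x (k * f x) = k * \int[mu]_x f x.
Proof.
move=> mf f0 k0; rewrite /Rintegral.
under eq_integral do rewrite EFinM.
rewrite ge0_integralZl//; last 2 first.
- exact/measurable_EFinP.
- by move=> x _; rewrite lee_fin.
have : (0 <= \int[mu]_x (f x)%:E)%E by apply: integral_ge0 => x _; rewrite lee_fin.
case: (integral _ _ _) => [s _| |]//.
by have [->|kn0] := eqVneq k 0; rewrite ?mul0e ?mul0r// gt0_muley ?mulr0// lte_fin lt_def kn0.
Qed.

Lemma ae_product_fst d1 d2 (U1 : measurableType d1) (U2 : measurableType d2) (R : realType)
    (m1 : {sigma_finite_measure set U1 -> \bar R})
    (m2 : {sigma_finite_measure set U2 -> \bar R}) (Q : U1 -> Prop) :
  {ae m1, forall w, Q w} -> {ae (m1 \x m2)%E, forall z, Q z.1}.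
Proof.
move=> [N [mN N0 QN]]; exists (N `*` setT); split.
- exact: measurableX.
- by rewrite product_measure1E// [X in (X * _)%E]N0 mul0e.
- by move=> z nQ; split=> //; exact: QN.
Qed.
Definition product_probability d1 d2 (U1 : measurableType d1) (U2 : measurableType d2)
    (R : realType) (P1 : probability U1 R) (P2 : probability U2 R) :
    probability (U1 * U2)%type R :=
  [the probability (U1 * U2)%type R of (P1 \x P2)%E].

Section product_integrals.
Context d1 d2 (T1 : measurableType d1) (T2 : measurableType d2) (R : realType).
Variables (m1 : {sigma_finite_measure set T1 -> \bar R})
          (m2 : {sigma_finite_measure set T2 -> \bar R}).

Lemma Rintegral_prod (f : T1 * T2 -> R) (g : T1 -> R) (h : T2 -> R) :
  measurable_fun setT f -> (forall w x, `|f (w, x)| <= g w * h x) ->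
  m1.-integrable setT (EFin \o g) -> m2.-integrable setT (EFin \o h) ->
  \int[(m1 \x m2)%E]_z f z = \int[m2]_x \int[m1]_w f (w, x).
Proof.
move=> mf fgh ig ih; have ip := integrable_prod_dominated mf fgh ig ih.
rewrite [LHS]/Rintegral -integral21_prod_meas1//=; congr fine.
apply: eq_integral => x _; rewrite /fubini_G /Rintegral fineK//.
exact: (integrable_fin_num measurableT (integrable_section2 mf fgh ig x)).
Qed.

End product_integrals.

(** * Gaussian laws on the line *)

Section gauss_line.
Context {R : realType}.
Implicit Types (s a c u x : R) (f : R -> \bar R).
Local Notation mu := (@lebesgue_measure R).

Lemma normal_pdfE0 s x : s != 0 ->
  normal_pdf 0 s x = normal_peak s * expR (- (x ^+ 2 / (s ^+ 2 *+ 2))).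
Proof. by move=> s0; rewrite normal_pdfE// /normal_fun subr0 mulNr. Qed.

Lemma ge0_integral_normal_prob m s f :
  measurable_fun setT f -> (forall x, 0 <= f x)%E ->
  (\int[normal_prob m s]_x f x = \int[mu]_x (f x * (normal_pdf m s x)%:E))%E.
Proof.
move=> mf f0; apply: ge0_integral_density => //.
- exact: measurable_normal_pdf.
- by move=> x; exact: normal_pdf_ge0.
Qed.

Lemma mgf_normal_prob s a : s != 0 ->
  (\int[normal_prob 0 s]_x (expR (a * x))%:E = (expR (a ^+ 2 * s ^+ 2 / 2))%:E)%E.
Proof.
move=> s0; rewrite ge0_integral_normal_prob//; last first.
  by apply/measurable_EFinP; apply: measurableT_comp => //; exact: measurable_funM.
transitivity (\int[mu]_x ((expR (a ^+ 2 * s ^+ 2 / 2))%:E *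
    (normal_pdf (a * s ^+ 2) s x)%:E))%E.
  apply: eq_integral => x _; rewrite -!EFinM; congr EFin.
  rewrite !normal_pdfE// !(mulrCA _ (normal_peak s)) /normal_fun.
  by congr (_ * _); rewrite -!expRD; congr expR; field.
rewrite integralZl//; last exact: integrable_normal_pdf.
by rewrite integral_normal_pdf mule1.
Qed.

Lemma integrable_expR_normal s a : s != 0 ->
  (normal_prob 0 s).-integrable setT (fun x => (expR (a * x))%:E).
Proof.
move=> s0; apply/integrableP; split.
  by apply/measurable_EFinP; apply: measurableT_comp => //; exact: measurable_funM.
under eq_integral do rewrite gee0_abs ?lee_fin ?expR_ge0//.
by rewrite mgf_normal_prob// ltry.
Qed.

Lemma is_derive_normal_pdf s x : s != 0 ->
  is_derive x 1 (normal_pdf 0 s) (- (x / s ^+ 2) * normal_pdf 0 s x).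
Proof.
move=> s0; rewrite normal_pdfE0//.
have -> : normal_pdf 0 s = fun x => normal_peak s * expR (- (x ^+ 2 / (s ^+ 2 *+ 2))).
  by apply/funext => y; exact: normal_pdfE0.
apply: is_derive_eq.
rewrite /GRing.scale/=; field.
done.
Qed.

End gauss_line.

Section gauss_parts.
Context {R : realType}.
Implicit Types (s a c u x : R).
Local Notation mu := (@lebesgue_measure R).

Lemma cvg_integral_nn (f : R -> R) : mu.-integrable setT (EFin \o f) ->
  \int[mu]_(x in `[- n%:R, n%:R]) f x @[n --> \oo] --> \int[mu]_x f x.
Proof.
move=> intf.
under eq_fun do rewrite Rintegral_mkcond.
have mf : measurable_fun setT f by apply/measurable_EFinP; exact: measurable_int _ intf.
apply: (@Rintegral_dominated_cvg _ _ _ mu (fun n => f \_ `[(- n%:R)%R, n%:R%R]) f (fun x => `|f x|)) => //.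
- by move=> n; apply/measurable_restrict => //; exact: measurable_funS mf.
- apply: aeW => x; apply: cvg_near_cst; near=> n.
  rewrite patchE ifT// inE/= in_itv/= -ler_norml.
  by near: n; exact: nbhs_infty_ger.
- exact: (integrable_abse intf).
- move=> n x; rewrite patchE; case: ifPn => // _.
  by rewrite normr0.
Unshelve. all: by end_near. Qed.

(** It suffices that [F] vanish along the two sequences [n] and [- n], by
    the fundamental theorem of calculus on the intervals between them. *)
Lemma integral_derive_eq0 (F f : R -> R) :
  (forall x, is_derive x 1 F (f x)) -> continuous f ->
  mu.-integrable setT (EFin \o f) ->
  F n%:R @[n --> \oo] --> 0 -> F (- n%:R) @[n --> \oo] --> 0 ->
  \int[mu]_x f x = 0.
Proof.
move=> dF cf intf Fy FNy.
have cF : continuous F.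
  move=> x; apply/differentiable_continuous/derivable1_diffP.
  exact: (@ex_derive _ _ _ _ _ _ _ (dF x)).
apply: (cvg_unique _ (cvg_integral_nn intf)) => //.
pose I n := \int[mu]_(x in `[(- n%:R)%R, n%:R%R]) f x.
pose D n := F n%:R - F (- n%:R).
have DI n : I n.+1 = D n.+1; last first.
  have D0 : D n @[n --> \oo] --> 0 by rewrite -(subrr 0); exact: cvgB.
  have : D n.+1 @[n --> \oo] --> 0 by rewrite cvg_shiftS.
  by rewrite -(funext DI) cvg_shiftS.
rewrite /I /Rintegral (@continuous_FTC2 _ f F (- n.+1%:R) n.+1%:R)//.
- by rewrite gtrN// ltr0n.
- exact: continuous_subspaceT.
- split.
  + by move=> x _; exact: (@ex_derive _ _ _ _ _ _ _ (dF x)).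
  + exact/cvg_at_right_filter/cF.
  + exact/cvg_at_left_filter/cF.
- by move=> x _; rewrite derive1E; exact: (@derive_val _ _ _ _ _ _ _ (dF x)).
Qed.
End gauss_parts.

Lemma integral_density d (T : measurableType d) (R : realType)
    (mu nu : {measure set T -> \bar R}) (g f : T -> R) :
  measurable_fun setT g -> (forall x, (0 <= g x)%R) ->
  (forall A, measurable A -> nu A = \int[mu]_(x in A) (g x)%:E)%E ->
  measurable_fun setT f ->
  (\int[nu]_x (f x)%:E = \int[mu]_x (f x * g x)%:E)%E.
Proof.
move=> mg g0 nuE mf.
rewrite [LHS]integralE [RHS]integralE; congr (_ - _)%E.
- rewrite (ge0_integral_density mg g0 nuE)//; last first.
    by apply: measurable_funepos; exact/measurable_EFinP.
  apply: eq_integral => x _; rewrite !funeposE -!EFin_max -EFinM; congr EFin.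
  by rewrite maxr_pMl// mul0r.
- rewrite (ge0_integral_density mg g0 nuE)//; last first.
    by apply: measurable_funeneg; exact/measurable_EFinP.
  apply: eq_integral => x _; rewrite !funenegE -!EFinN -!EFin_max -EFinM.
  by congr EFin; rewrite maxr_pMl// mul0r mulNr.
Qed.

(** From [1 + u <= exp u] at [u = x / k]; a crude constant is enough, as
    this only serves to dominate polynomial factors. *)
Lemma expR_ge_powr (R : realType) (k : nat) (x : R) :
  0 <= x -> x ^+ k <= k%:R ^+ k * expR x.
Proof.
move=> x0; have [->|k0] := eqVneq k 0%N; first by rewrite !expr0 mul1r -expR0 ler_expR.
have k0' : (0 : R) < k%:R by rewrite ltr0n lt0n.
have -> : expR x = expR (x / k%:R) ^+ k.
  by rewrite -expRM_natl -mulr_natl mulrCA divff ?gt_eqF// mulr1.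
rewrite -exprMn lerXn2r ?nnegrE ?mulr_ge0 ?expR_ge0 ?(ltW k0')//.
rewrite mulrC -ler_pdivrMr//.
apply: le_trans (expR_ge1Dx _); by rewrite lerDr.
Qed.

Lemma expR_normr_le (R : realType) (a x : R) :
  expR (a * `|x|) <= expR (a * x) + expR (- a * x).
Proof.
have [x0|x0] := leP 0 x; first by rewrite ger0_norm// lerDl expR_ge0.
by rewrite ltr0_norm// mulrN -mulNr lerDr expR_ge0.
Qed.

Section gauss_char.
Context {R : realType}.
Implicit Types (a c u x : R).
Local Notation mu := (@lebesgue_measure R).
Variable s : R.
Hypothesis s0 : s != 0.
Local Notation nu := (normal_prob 0 s).

Lemma integral_normal_prob (f : R -> R) : measurable_fun setT f ->
  \int[nu]_x f x = \int[mu]_x (f x * normal_pdf 0 s x).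
Proof.
move=> mf; rewrite /Rintegral (integral_density (mu := mu) (g := normal_pdf 0 s))//.
- exact: measurable_normal_pdf.
- by move=> x; exact: normal_pdf_ge0.
Qed.

Lemma integrable_normal_prob (f : R -> R) : measurable_fun setT f ->
  nu.-integrable setT (EFin \o f) ->
  mu.-integrable setT (EFin \o (fun x => f x * normal_pdf 0 s x)).
Proof.
move=> mf /integrableP[_ intf]; apply/integrableP; split.
  apply/measurable_EFinP; apply: measurable_funM => //.
  exact: measurable_normal_pdf.
move: intf; rewrite /= ge0_integral_normal_prob//; last first.
  by apply/measurable_EFinP; exact: measurableT_comp.
apply: le_lt_trans; rewrite le_eqVlt; apply/orP; left; apply/eqP.
apply: eq_integral => x _.
by rewrite normrM (ger0_norm (normal_pdf_ge0 _ _ _)) EFinM.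
Qed.

Lemma integrable_poly_normal (k : nat) :
  nu.-integrable setT (fun x => (`|x| ^+ k)%:E).
Proof.
apply: (@integrable_le _ _ _ nu _
  (fun x => k%:R ^+ k * (expR (1 * x) + expR (-1 * x)))).
- by apply: measurable_funX; apply: measurableT_comp => //; exact: normr_measurable.
- move=> x; rewrite normrX normr_id.
  apply: le_trans (expR_ge_powr _ (normr_ge0 x)) _.
  by rewrite ler_wpM2l// -[`|x|]mul1r expR_normr_le.
- by apply/integrable_scaler/integrable_addr; exact: integrable_expR_normal.
Qed.

Lemma cvg_normal_pdf_infty (phi : R -> R) (t : nat -> R) :
  (forall x, `|phi x| <= 1 + `|x|) -> (forall n, `|t n| = n%:R) ->
  phi (t n) * normal_pdf 0 s (t n) @[n --> \oo] --> 0.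
Proof.
move=> phi1 tn; pose C := normal_peak s * (2 * (s ^+ 2 *+ 2)).
suff : C * n.+1%:R^-1 @[n --> \oo] --> 0.
  move=> h; apply: norm_cvg0.
  rewrite -(cvg_shiftS (fun n => _)).
  apply: squeeze_cvgr (cvg_cst 0) h.
  apply: nearW => n; rewrite normr_ge0/= normrM.
  rewrite (ger0_norm (normal_pdf_ge0 _ _ _)) normal_pdfE0//.
  apply: (@le_trans _ _ ((1 + n.+1%:R) *
      (normal_peak s * expR (- (t n.+1 ^+ 2 / (s ^+ 2 *+ 2)))))).
    by rewrite ler_wpM2r ?mulr_ge0 ?normal_peak_ge0 ?expR_ge0// -tn.
  rewrite /C mulrCA -mulrA ler_wpM2l ?normal_peak_ge0//.
  have N0 : (0 : R) < n.+1%:R by rewrite ltr0n.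
  have S0 : 0 < s ^+ 2 *+ 2 by rewrite pmulrn_lgt0// exprn_even_gt0.
  rewrite expRN -real_normK ?num_real// tn ler_pdivrMr ?expR_gt0//.
  have : n.+1%:R ^+ 2 / (s ^+ 2 *+ 2) <= expR (n.+1%:R ^+ 2 / (s ^+ 2 *+ 2)).
    by apply: le_trans (expR_ge1Dx _); rewrite lerDr.
  set E := expR _ => hE.
  apply: (@le_trans _ _ (2 * (s ^+ 2 *+ 2) / n.+1%:R * (n.+1%:R ^+ 2 / (s ^+ 2 *+ 2)))).
    have alg (N S : R) : N != 0 -> S != 0 -> 2 * S / N * (N ^+ 2 / S) = 2 * N.
      by move=> *; field; apply/andP.
    rewrite alg ?gt_eqF//.
    by rewrite mulr2n mulrDl mul1r lerD2r ler1n.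
  by rewrite ler_wpM2l// divr_ge0// mulr_ge0// ltW.
rewrite -(mulr0 C); apply: cvgMl_tmp; exact: cvg_harmonic.
Qed.

(** Gaussian integration by parts: [x] times the density is, up to the
    factor [- s ^ 2], the derivative of the density. *)
Lemma gauss_parts (phi dphi : R -> R) (C : R) :
  (forall x, is_derive x 1 phi (dphi x)) -> continuous dphi ->
  (forall x, `|phi x| <= 1 + `|x|) -> (forall x, `|dphi x| <= C) ->
  s ^+ 2 * \int[nu]_x dphi x = \int[nu]_x (x * phi x).
Proof.
move=> dp cdp phi1 dC.
have cphi : continuous phi.
  move=> x; apply/differentiable_continuous/derivable1_diffP.
  exact: (@ex_derive _ _ _ _ _ _ _ (dp x)).
have mphi : measurable_fun setT phi by exact: continuous_measurable_fun.
have mdp : measurable_fun setT dphi by exact: continuous_measurable_fun.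
have mx : measurable_fun setT (fun x : R => x * phi x) by exact: measurable_funM.
have i1 : nu.-integrable setT (EFin \o dphi) by exact: (@integrable_bounded _ _ _ nu _ C mdp).
have i2 : nu.-integrable setT (EFin \o (fun x => x * phi x)).
  apply: (@integrable_le _ _ _ nu _ (fun x => `|x| ^+ 1 + `|x| ^+ 2)) => //.
    by move=> x; rewrite normrM expr1 -[X in X + _]mulr1 -mulrDr ler_wpM2l.
  by apply: integrable_addr; exact: integrable_poly_normal.
have i1' := integrable_normal_prob mdp i1.
have i2' := integrable_normal_prob mx i2.
pose f x := dphi x * normal_pdf 0 s x - (s ^- 2) * (x * phi x * normal_pdf 0 s x).
have if2 : mu.-integrable setT (EFin \o (fun x => (s ^- 2) * (x * phi x * normal_pdf 0 s x))).
  exact: integrable_scaler.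
have : \int[mu]_x f x = 0.
  apply: (@integral_derive_eq0 _ (fun x => phi x * normal_pdf 0 s x)).
  - move=> x; have := is_derive_normal_pdf x s0 => dn.
    apply: is_derive_eq; rewrite /f /GRing.scale /=; field; done.
  - move=> x; apply: cvgB; first by apply: cvgM; [exact: cdp|exact: continuous_normal_pdf].
    apply: cvgMl_tmp; apply: cvgM; last exact: continuous_normal_pdf.
    by apply: cvgM; [exact: cvg_id|exact: cphi].
  - exact: integrable_subr.
  - by apply: cvg_normal_pdf_infty => // n; rewrite ger0_norm.
  - by apply: (cvg_normal_pdf_infty (t := fun n => - n%:R)) => // n; rewrite normrN ger0_norm.
rewrite /f RintegralB// RintegralZl// -!integral_normal_prob// => /eqP.
rewrite subr_eq0 => /eqP ->; by rewrite mulrA divff ?mul1r// expf_neq0.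
Qed.

Lemma variance_normal_prob : \int[nu]_x (x ^+ 2) = s ^+ 2.
Proof.
have := @gauss_parts id (fun=> 1) 1 => <- //.
- by rewrite Rintegral_cst// mul1r [X in fine X]probability_setT mulr1.
- by move=> x; exact: cvg_cst.
- by move=> x; rewrite lerDr.
- by move=> x; rewrite normr1.
Qed.
End gauss_char.

Section gauss_char_fun.
Context {R : realType}.
Implicit Types (a c u x : R).
Variable s : R.
Hypothesis s0 : s != 0.
Local Notation nu := (normal_prob 0 s).

Lemma measurable_cos_affine u c : measurable_fun setT (fun x : R => cos (u * x + c)).
Proof.
apply: measurableT_comp; first exact: (continuous_measurable_fun (@continuous_cos R)).
by apply: measurable_funD => //; exact: measurable_funM.
Qed.

Lemma integrable_cos_affine u c :
  nu.-integrable setT (EFin \o (fun x : R => cos (u * x + c))).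
Proof.
apply: (@integrable_bounded _ _ _ nu _ 1); first exact: measurable_cos_affine.
by move=> x; rewrite ler_norml cos_geN1 cos_le1.
Qed.

(** As a function of [u] the left-hand side solves a first order linear
    equation, which integration by parts provides. *)
Lemma char_normal_prob u c :
  \int[nu]_x cos (u * x + c) = cos c * expR (- (u ^+ 2 * s ^+ 2 / 2)).
Proof.
pose f u (x : R) := cos (u * x + c).
pose F u := \int[nu]_x f u x.
have df (x v : R) : is_derive v 1 (f ^~ x) (- (x * sin (v * x + c))).
  rewrite /f; apply: is_derive_eq; rewrite /GRing.scale/=; ring.
have d1f v x : partial1of2 f v x = - (x * sin (v * x + c)).
  by rewrite partial1of2E; exact: (@derive_val _ _ _ _ _ _ _ (df x v)).
have dF (v : R) : is_derive v 1 F (- (s ^+ 2 * v * F v)).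
  have Iv : `]v - 1, v + 1[%classic v by rewrite /= in_itv/=; apply/andP; split; lra.
  have h1 x : `]v - 1, v + 1[%classic x -> nu.-integrable setT (EFin \o f x).
    by move=> _; exact: integrable_cos_affine.
  have h2 x y : `]v - 1, v + 1[%classic x -> setT y -> derivable (f ^~ y) x 1.
    by move=> _ _; exact: (@ex_derive _ _ _ _ _ _ _ (df y x)).
  have h3 x y : `]v - 1, v + 1[%classic x -> setT y -> `|partial1of2 f x y| <= `|y| ^+ 1.
    move=> _ _; rewrite d1f normrN normrM expr1 ler_piMr//.
    by rewrite ler_norml sin_geN1 sin_le1.
  have G0 (y : R) : 0 <= `|y| ^+ 1 by rewrite expr1.
  have iG := integrable_poly_normal s0 1.
  apply: DeriveDef.
    exact: (derivable_under_integral measurableT Iv h1 h2 G0 iG h3).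
  rewrite -derive1E (differentiation_under_integral measurableT Iv h1 h2 G0 iG h3).
  under eq_Rintegral do rewrite d1f.
  have <- : \int[nu]_x (x * sin (v * x + c)) = s ^+ 2 * v * F v.
    have ds (x : R) : is_derive x 1 (fun x => sin (v * x + c)) (v * cos (v * x + c)).
      by apply: is_derive_eq; rewrite /GRing.scale/=; ring.
    rewrite -(@gauss_parts _ s s0 (fun x => sin (v * x + c)) (fun x => v * cos (v * x + c)) `|v| ds).
    - rewrite -mulrA; congr (_ * _).
      by rewrite RintegralZl//; exact: integrable_cos_affine.
    - move=> x; apply: cvgMl_tmp; apply: continuous_comp; last exact: continuous_cos.
      by apply: cvgD; [apply: cvgMl_tmp; exact: cvg_id|exact: cvg_cst].
    - by move=> x; apply: (@le_trans _ _ 1); rewrite ?lerDl// ler_norml sin_geN1 sin_le1.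
    - by move=> x; rewrite normrM ler_piMr// ler_norml cos_geN1 cos_le1.
  rewrite -[RHS]mulN1r -RintegralZl//.
    by apply: eq_Rintegral => x _; rewrite mulN1r.
  apply: (@integrable_le _ _ _ nu _ (fun y => `|y| ^+ 1)) => //.
    apply: measurable_funM => //; apply: measurableT_comp.
      exact: (continuous_measurable_fun (@continuous_sin R)).
    by apply: measurable_funD => //; exact: measurable_funM.
  by move=> x; have := h3 v x Iv Logic.I; rewrite d1f normrN.
pose H u := F u * expR (u ^+ 2 * s ^+ 2 / 2).
have dH (v : R) : is_derive v 1 H 0.
  by apply: is_derive_eq; rewrite /GRing.scale/=; field.
have : H u = H 0 by exact: is_derive_0_is_cst.
rewrite /H expr0n/= !mul0r expR0 mulr1 /F /f.
under [in RHS]eq_Rintegral do rewrite mul0r add0r.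
rewrite Rintegral_cst// [X in fine X]probability_setT mulr1 => <-.
by rewrite expRN mulfK// gt_eqF ?expR_gt0.
Qed.

End gauss_char_fun.

(** * Centered Gaussian random variables *)

Section centered_gaussian_moments.
Context {R : realType} {dO : measure_display} {Omega : measurableType dO}.
Variable P : probability Omega R.
Variables (X : Omega -> R) (v : R).
Hypothesis mX : measurable_fun setT X.
Hypothesis gX : centered_gaussian P X v.
Local Notation sd := (Num.sqrt v).

Lemma sqr_sd : sd ^+ 2 = v.
Proof. by rewrite sqr_sqrtr//; case: gX. Qed.

Lemma sd_neq0 : v != 0 -> sd != 0.
Proof.
move=> v0; rewrite gt_eqF// sqrtr_gt0 lt_neqAle eq_sym v0/=.
by case: gX.
Qed.

(** The variance may vanish, and then the law is a Dirac mass rather than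
    a normal law. *)
Lemma gaussian_ge0_integral (f : R -> \bar R) : measurable_fun setT f ->
  (forall x, 0 <= f x)%E ->
  (\int[P]_w f (X w) = if v == 0%R then f 0%R else \int[normal_prob 0 sd]_x f x)%E.
Proof.
move=> mf f0.
pose X' : {RV P >-> measurableTypeR R} :=
  HB.pack X (isMeasurableFun.Build _ _ _ (measurableTypeR R) X mX).
rewrite -[LHS]/(\int[P]_w (f \o X') w)%E -ge0_integral_distribution//.
case: (eqVneq v 0) gX => v0 [_ law].
  rewrite (eq_measure_integral (\d_(0%R : measurableTypeR R))); last first.
    by move=> A mA _; rewrite [LHS](law A mA) v0 eqxx.
  by rewrite integral_dirac// diracT mul1e.
by apply: eq_measure_integral => A mA _; rewrite [LHS](law A mA) (negbTE v0).
Qed.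

Lemma gaussian_Rintegral (f : R -> R) : measurable_fun setT f ->
  \int[P]_w f (X w) = if v == 0%R then f 0%R else \int[normal_prob 0 sd]_x f x.
Proof.
move=> mf; pose p (x : R) := Num.max (f x) 0; pose n (x : R) := Num.max (- f x) 0.
have E d (T : measurableType d) (m : {measure set T -> \bar R}) (g : T -> R) :
    (\int[m]_x (f (g x))%:E = \int[m]_x (p (g x))%:E - \int[m]_x (n (g x))%:E)%E.
  rewrite integralE; congr (_ - _)%E; apply: eq_integral => x _.
    by rewrite funeposE EFin_max.
  by rewrite funenegE EFin_max.
rewrite /Rintegral E.
rewrite (gaussian_ge0_integral (f := fun x => (p x)%:E)); last 2 first.
- by apply/measurable_EFinP; exact: measurable_maxr.
- by move=> x; rewrite lee_fin le_max lexx orbT.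
rewrite (gaussian_ge0_integral (f := fun x => (n x)%:E)); last 2 first.
- by apply/measurable_EFinP; apply: measurable_maxr => //; exact: measurableT_comp.
- by move=> x; rewrite lee_fin le_max lexx orbT.
case: eqP => _; last by rewrite (E _ _ (normal_prob 0 sd) id).
rewrite /p /n -EFinB/=.
case: (leP (f 0) 0) => f0.
  by rewrite max_l ?oppr_ge0// sub0r opprK.
by rewrite max_r ?subr0// oppr_le0 ltW.
Qed.

Lemma gaussian_mgf a : (\int[P]_w (expR (a * X w))%:E = (expR (a ^+ 2 * v / 2))%:E)%E.
Proof.
rewrite (gaussian_ge0_integral (f := fun x => (expR (a * x))%:E)); last 2 first.
- by apply/measurable_EFinP; apply: measurableT_comp => //; exact: measurable_funM.
- by move=> x; rewrite lee_fin expR_ge0.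
case: eqVneq => [->|v0]; first by rewrite !mulr0 mul0r.
by rewrite mgf_normal_prob ?sd_neq0// sqr_sd.
Qed.

Lemma gaussian_integrable_expR a : P.-integrable setT (EFin \o (fun w => expR (a * X w))).
Proof.
apply/integrableP; split.
  apply/measurable_EFinP; apply: measurableT_comp => //; exact: measurable_funM.
under eq_integral do rewrite gee0_abs ?lee_fin ?expR_ge0//.
by rewrite gaussian_mgf ltry.
Qed.

Lemma gaussian_char c : \int[P]_w cos (X w + c) = cos c * expR (- (v / 2)).
Proof.
rewrite (gaussian_Rintegral (f := fun x => cos (x + c))); last first.
  apply: measurableT_comp; first exact: (continuous_measurable_fun (@continuous_cos R)).
  exact: measurable_funD.
case: eqVneq => [->|v0]; first by rewrite mul0r oppr0 expR0 mulr1 add0r.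
transitivity (\int[normal_prob 0 sd]_x cos (1 * x + c)).
  by apply: eq_Rintegral => x _; rewrite mul1r.
by rewrite char_normal_prob ?sd_neq0// sqr_sd expr1n mul1r.
Qed.

Lemma gaussian_variance : (\int[P]_w ((X w) ^+ 2)%:E = v%:E)%E.
Proof.
rewrite (gaussian_ge0_integral (f := fun x => (x ^+ 2)%:E)); last 2 first.
- by apply/measurable_EFinP; exact: measurable_funX.
- by move=> x; rewrite lee_fin sqr_ge0.
case: eqVneq => [->|v0]; first by rewrite expr0n.
rewrite -[in RHS]sqr_sd -(variance_normal_prob (sd_neq0 v0)) /Rintegral fineK//.
have := integrable_poly_normal (sd_neq0 v0) 2.
under eq_fun do rewrite real_normK ?num_real//.
exact: integrable_fin_num.
Qed.

End centered_gaussian_moments.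

(** * From characteristic functions to exponential functionals *)

Section bumps.
Context {R : realType} (I : Type).
Implicit Types (s : seq (R * I)) (l : seq I).

Definition lincomb T (X : I -> T -> R) s (w : T) : R := \sum_(p <- s) p.1 * X p.2 w.

(** A Gaussian bump rather than an indicator: it is an average of cosines,
    and [exp (g y - q y ^ 2)] is a multiple of it. *)
Definition gauss_bump (q m y : R) : R := expR (- (q * (y - m) ^+ 2)).

Lemma bump_ge0 q m y : 0 <= gauss_bump q m y. Proof. exact: expR_ge0. Qed.

Lemma bump_le1 q m y : 0 <= q -> gauss_bump q m y <= 1.
Proof. by move=> q0; rewrite -expR0 ler_expR oppr_le0 mulr_ge0// sqr_ge0. Qed.

Lemma measurable_bump q m : measurable_fun setT (gauss_bump q m).
Proof.
apply: measurableT_comp => //; apply: measurableT_comp => //.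
by apply: measurable_funM => //; apply: measurable_funX; exact: measurable_funB.
Qed.

Lemma measurable_cosR : measurable_fun setT (@cos R).
Proof. exact: continuous_measurable_fun (@continuous_cos R). Qed.

Section one_side.
Context d (T : measurableType d) (m1 : {sigma_finite_measure set T -> \bar R}).
Variables (W : T -> R) (X : I -> T -> R).
Hypothesis iW : m1.-integrable setT (EFin \o W).
Hypothesis mX : forall i, measurable_fun setT (X i).

Lemma measurable_lincomb s : measurable_fun setT (lincomb X s).
Proof. by apply: measurable_sum => p; exact: measurable_funM. Qed.

Variables (q m : R).
Hypothesis q0 : 0 < q.

Lemma prod_bump_norm l w : `|\prod_(j <- l) gauss_bump q m (X j w)| <= 1.
Proof.
rewrite ger0_norm ?prodr_ge0// => [|j _]; last exact: bump_ge0.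
elim: l => [|j l IH]; first by rewrite big_nil.
rewrite big_cons mulr_ile1 ?bump_ge0 ?bump_le1 ?(ltW q0)//.
by apply: prodr_ge0 => k _; exact: bump_ge0.
Qed.

Lemma measurable_prod_bump l : measurable_fun setT (fun w => \prod_(j <- l) gauss_bump q m (X j w)).
Proof.
elim: l => [|i l IH]; first by under eq_fun do rewrite big_nil; exact: measurable_cst.
under eq_fun do rewrite big_cons; apply: measurable_funM => //.
by apply: measurableT_comp => //; exact: measurable_bump.
Qed.

(** The bump is a Gaussian average of cosines, which turns a factor into
    one more coefficient of the linear combination inside the cosine. *)
Lemma bump_mix i l s c0 :
  \int[m1]_w (W w * \prod_(j <- i :: l) gauss_bump q m (X j w) * cos (lincomb X s w + c0)) =
  \int[normal_prob 0 (Num.sqrt (2 * q))]_t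
    \int[m1]_w (W w * \prod_(j <- l) gauss_bump q m (X j w) *
      cos (lincomb X ((t, i) :: s) w + (c0 - t * m))).
Proof.
have s0 : Num.sqrt (2 * q) != 0 by rewrite gt_eqF// sqrtr_gt0 mulr_gt0.
pose f (z : T * R) := W z.1 * \prod_(j <- l) gauss_bump q m (X j z.1) *
  cos (z.2 * X i z.1 + lincomb X s z.1 + (c0 - z.2 * m)).
transitivity (\int[m1]_w \int[normal_prob 0 (Num.sqrt (2 * q))]_t f (w, t)); last first.
  rewrite (@Rintegral_fubini _ _ _ _ _ m1 (normal_prob 0 (Num.sqrt (2 * q))) f
      (fun w => `|W w|) (fun=> 1)).
  - apply: eq_Rintegral => t _; apply: eq_Rintegral => w _.
    by rewrite /f /lincomb big_cons/=.
  - apply: measurable_funM.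
      apply: measurable_funM.
        by apply: measurableT_comp => //; exact: integrable_measurable iW.
      exact: (measurableT_comp (measurable_prod_bump l) measurable_fst).
    apply: (measurableT_comp measurable_cosR).
    apply: measurable_funD; last first.
      by apply: measurable_funB => //; apply: measurable_funM.
    apply: measurable_funD.
      by apply: measurable_funM => //; exact: (measurableT_comp (mX i) measurable_fst).
    exact: (measurableT_comp (measurable_lincomb s) measurable_fst).
  - move=> w t; rewrite /f !normrM mulr1/= -mulrA ler_piMr// mulr_ile1//.
      exact: prod_bump_norm.
    by rewrite ler_norml cos_geN1 cos_le1.
  - exact: integrable_norm.
  - exact: finite_measure_integrable_cst.
apply: eq_Rintegral => w _; rewrite big_cons.
have := char_normal_prob s0 (X i w - m) (lincomb X s w + c0).
rewrite sqr_sqrtr ?mulr_ge0 ?(ltW q0)// (_ : _ * (2 * q) / 2 = q * (X i w - m) ^+ 2); last by field.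
rewrite -/(gauss_bump q m (X i w)) => E.
rewrite (mulrC (gauss_bump _ _ _)) mulrA -mulrA (mulrC (gauss_bump _ _ _)) -E -RintegralZl//; last exact: integrable_cos_affine.
apply: eq_Rintegral => t _; rewrite /f/=; congr (_ * cos _); ring.
Qed.

End one_side.

(** Bumps are traded one by one for random coefficients of the linear
    combination, until only the characteristic functions remain. *)
Lemma eq_char_eq_bumps d1 d2 (T1 : measurableType d1) (T2 : measurableType d2)
    (m1 : {sigma_finite_measure set T1 -> \bar R})
    (m2 : {sigma_finite_measure set T2 -> \bar R})
    (W1 : T1 -> R) (W2 : T2 -> R) (X1 : I -> T1 -> R) (X2 : I -> T2 -> R)
    (A : set I) (q m : R) :
  m1.-integrable setT (EFin \o W1) -> m2.-integrable setT (EFin \o W2) ->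
  (forall i, measurable_fun setT (X1 i)) -> (forall i, measurable_fun setT (X2 i)) ->
  0 < q ->
  (forall s c0, List.Forall (fun p => A p.2) s ->
    \int[m1]_w (W1 w * cos (lincomb X1 s w + c0)) =
    \int[m2]_w (W2 w * cos (lincomb X2 s w + c0))) ->
  forall l s c0, List.Forall A l -> List.Forall (fun p => A p.2) s ->
    \int[m1]_w (W1 w * \prod_(j <- l) gauss_bump q m (X1 j w) * cos (lincomb X1 s w + c0)) =
    \int[m2]_w (W2 w * \prod_(j <- l) gauss_bump q m (X2 j w) * cos (lincomb X2 s w + c0)).
Proof.
move=> iW1 iW2 mX1 mX2 q0 E; elim => [|i l IH] s c0 Al As.
  transitivity (\int[m1]_w (W1 w * cos (lincomb X1 s w + c0))).
    by apply: eq_Rintegral => w _; rewrite big_nil mulr1.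
  by rewrite E//; apply: eq_Rintegral => w _; rewrite big_nil mulr1.
rewrite !bump_mix//; apply: eq_Rintegral => t _; apply: IH.
  by inversion Al.
by apply: List.Forall_cons => //; inversion Al.
Qed.

End bumps.

Section chaos_functional.
Context {R : realType} dI (I : measurableType dI).
Variable lam : {sigma_finite_measure set I -> \bar R}.
Implicit Types (l : seq I).

Section one_side.
Context d (T : measurableType d) (m1 : {sigma_finite_measure set T -> \bar R}).
Variables (W : T -> R) (X : I -> T -> R).
Hypothesis iW : m1.-integrable setT (EFin \o W).
Hypothesis mX : measurable_fun setT (fun z : I * T => X z.1 z.2).

Let mXi i : measurable_fun setT (X i).
Proof. exact: (measurableT_comp mX (pair1_measurable i)). Qed.

Let mXw w : measurable_fun setT (fun i => X i w).
Proof. exact: (measurableT_comp mX (pair2_measurable w)). Qed.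

Let mX' : measurable_fun setT (fun z : T * I => X z.2 z.1).
Proof. exact: (measurableT_comp mX (@measurable_swap _ _ T I)). Qed.

Variables (q m : R) (b : I -> R).
Hypothesis q0 : 0 < q.
Hypothesis b0 : forall i, 0 <= b i.
Hypothesis ib : lam.-integrable setT (EFin \o b).

(** A bounded surrogate of the exponential functional: its moments
    determine its Laplace transform by a power series. *)
Definition bump_mass (w : T) : R := \int[lam]_x (b x * gauss_bump q m (X x w)).

Let mb : measurable_fun setT b. Proof. exact: integrable_measurable ib. Qed.

Lemma integrable_bump_mass w : lam.-integrable setT (EFin \o (fun x => b x * gauss_bump q m (X x w))).
Proof.
apply: (@integrable_le _ _ _ lam _ b) => //.
  by apply: measurable_funM => //; apply: measurableT_comp => //; exact: measurable_bump.
by move=> x; rewrite ger0_norm ?mulr_ge0 ?bump_ge0// ler_piMr// bump_le1 ?(ltW q0).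
Qed.

Lemma bump_mass_ge0 w : 0 <= bump_mass w.
Proof. by apply: Rintegral_ge0 => x _; rewrite mulr_ge0 ?bump_ge0. Qed.

Lemma bump_mass_le w : bump_mass w <= \int[lam]_x b x.
Proof.
apply: le_Rintegral => //; first exact: integrable_bump_mass.
by move=> x _; rewrite ler_piMr// bump_le1 ?(ltW q0).
Qed.

Lemma measurable_bump_mass : measurable_fun setT bump_mass.
Proof.
have mf : measurable_fun setT (fun z : T * I => (b z.2 * gauss_bump q m (X z.2 z.1))%:E).
  apply/measurable_EFinP; apply: measurable_funM.
    exact: (measurableT_comp mb measurable_snd).
  by apply: measurableT_comp => //; exact: measurable_bump.
have := measurable_fun_fubini_tonelli_F _ mf.
rewrite /fubini_F /= => h; apply: measurableT_comp; [exact: fine_measurable|apply: h].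
by move=> z; rewrite lee_fin mulr_ge0 ?bump_ge0.
Qed.

(** One factor of the power is written as an integral over a new point
    [x], whose bump joins the product. *)
Lemma bump_mass_step l n :
  \int[m1]_w (W w * \prod_(j <- l) gauss_bump q m (X j w) * bump_mass w ^+ n.+1) =
  \int[lam]_x (b x *
    \int[m1]_w (W w * \prod_(j <- x :: l) gauss_bump q m (X j w) * bump_mass w ^+ n)).
Proof.
pose K := \int[lam]_x b x.
pose V w := W w * \prod_(j <- l) gauss_bump q m (X j w) * bump_mass w ^+ n.
have mW := integrable_measurable iW.
have mV : measurable_fun setT V.
  apply: measurable_funM; last by apply: measurable_funX; exact: measurable_bump_mass.
  by apply: measurable_funM => //; exact: measurable_prod_bump.
have VW w : `|V w| <= `|W w| * K ^+ n.
  rewrite /V !normrM normrX (ger0_norm (bump_mass_ge0 w)).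
  rewrite ler_pM ?exprn_ge0 ?bump_mass_ge0//.
    by rewrite ler_piMr//; exact: prod_bump_norm.
  by rewrite lerXn2r ?nnegrE ?bump_mass_ge0 ?bump_mass_le// (le_trans (bump_mass_ge0 w))// bump_mass_le.
pose f (z : T * I) := V z.1 * (b z.2 * gauss_bump q m (X z.2 z.1)).
have mf : measurable_fun setT f.
  apply: measurable_funM; first exact: (measurableT_comp mV measurable_fst).
  apply: measurable_funM; first exact: (measurableT_comp mb measurable_snd).
  by apply: measurableT_comp => //; exact: measurable_bump.
have fb w x : `|f (w, x)| <= `|W w| * K ^+ n * b x.
  rewrite /f normrM ler_pM//= ger0_norm ?mulr_ge0 ?bump_ge0//.
  by rewrite ler_piMr// bump_le1 ?(ltW q0).
have ig : m1.-integrable setT (EFin \o (fun w => `|W w| * K ^+ n)).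
  under eq_fun do rewrite mulrC.
  by apply: integrable_scaler; exact: integrable_norm.
transitivity (\int[m1]_w \int[lam]_x f (w, x)).
  apply: eq_Rintegral => w _; rewrite /f /= RintegralZl//; last exact: integrable_bump_mass.
  by rewrite exprSr mulrA.
rewrite (Rintegral_fubini mf fb ig ib); apply: eq_Rintegral => x _.
rewrite -RintegralZl//; last first.
  apply: (@integrable_le _ _ _ m1 _ (fun w => `|W w| * K ^+ n)) => //.
    apply: measurable_funM; last by apply: measurable_funX; exact: measurable_bump_mass.
    by apply: measurable_funM => //; exact: measurable_prod_bump.
  move=> w; apply: le_trans (VW w); rewrite /V big_cons mulrCA -!mulrA [X in X <= _]normrM.
  by rewrite ler_piMl// ger0_norm ?bump_ge0// bump_le1 ?(ltW q0).
apply: eq_Rintegral => w _; rewrite /f/= /V big_cons; ring.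
Qed.

(** The functional is bounded by the integral of [b], so that the
    exponential series may be integrated term by term. *)
Lemma bump_mass_laplace (t : R) : 0 <= t ->
  \sum_(0 <= i < N) ((- t) ^+ i / i`!%:R * \int[m1]_w (W w * bump_mass w ^+ i))
    @[N --> \oo] --> \int[m1]_w (W w * expR (- (t * bump_mass w))).
Proof.
move=> t0; pose K := \int[lam]_x b x.
have mW := integrable_measurable iW.
have mG := measurable_bump_mass.
have iWG i : m1.-integrable setT (EFin \o (fun w => W w * bump_mass w ^+ i)).
  apply: (@integrable_le _ _ _ m1 _ (fun w => K ^+ i * `|W w|)).
  - by apply: measurable_funM => //; exact: measurable_funX.
  - move=> w; rewrite normrM mulrC ler_wpM2r// normrX ger0_norm ?bump_mass_ge0//.
    by rewrite lerXn2r ?nnegrE ?bump_mass_ge0 ?bump_mass_le// (le_trans (bump_mass_ge0 w))// bump_mass_le.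
  - by apply: integrable_scaler; exact: integrable_norm.
pose F N w := W w * series (exp_coeff (- (t * bump_mass w))) N.
have E N : \int[m1]_w F N w = \sum_(0 <= i < N) ((- t) ^+ i / i`!%:R * \int[m1]_w (W w * bump_mass w ^+ i)).
  have sE w : F N w = \sum_(0 <= i < N) ((- t) ^+ i / i`!%:R * (W w * bump_mass w ^+ i)).
    rewrite /F /series/= mulr_sumr; apply: eq_bigr => i _.
    by rewrite /exp_coeff /= -mulNr exprMn; ring.
  under eq_Rintegral do rewrite sE.
  rewrite Rintegral_sumr => [|i]; last exact: integrable_scaler.
  by apply: eq_bigr => i _; rewrite RintegralZl.
rewrite -(funext E).
apply: (@Rintegral_dominated_cvg _ _ _ m1 F _ (fun w => expR (t * K) * `|W w|)).
- move=> N; apply: measurable_funM => //.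
  rewrite /series/=; apply: measurable_sum => i.
  apply: measurable_funM => //; apply: measurable_funX.
  by apply: measurableT_comp => //; exact: measurable_funM.
- apply: measurable_funM => //; apply: measurableT_comp => //.
  by apply: measurableT_comp => //; exact: measurable_funM.
- apply: aeW => w; apply: cvgMl_tmp.
  exact: is_cvg_series_exp_coeff.
- by apply: integrable_scaler; exact: integrable_norm.
- move=> N w; rewrite /F normrM mulrC ler_wpM2r//.
  apply: (@le_trans _ _ (series (exp_coeff (t * bump_mass w)) N)).
    rewrite /series/=; apply: le_trans (ler_norm_sum _ _ _) _.
    apply: ler_sum => i _; rewrite /exp_coeff /= normrM normrX normrN normfV !ger0_norm//.
    by rewrite mulr_ge0// bump_mass_ge0.
  apply: (@le_trans _ _ (expR (t * bump_mass w))).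
    apply: nondecreasing_cvgn_le; last exact: is_cvg_series_exp_coeff.
    apply: nondecreasing_series => n _ _; apply: exp_coeff_ge0.
    by rewrite mulr_ge0// bump_mass_ge0.
  by rewrite ler_expR ler_wpM2l// bump_mass_le.
Qed.

End one_side.

End chaos_functional.

Section eq_char.
Context {R : realType} dI (I : measurableType dI).
Variable lam : {sigma_finite_measure set I -> \bar R}.
Context d1 d2 (T1 : measurableType d1) (T2 : measurableType d2).
Variables (m1 : {sigma_finite_measure set T1 -> \bar R})
          (m2 : {sigma_finite_measure set T2 -> \bar R}).
Variables (W1 : T1 -> R) (W2 : T2 -> R) (X1 : I -> T1 -> R) (X2 : I -> T2 -> R).
Hypothesis iW1 : m1.-integrable setT (EFin \o W1).
Hypothesis iW2 : m2.-integrable setT (EFin \o W2).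
Hypothesis mX1 : measurable_fun setT (fun z : I * T1 => X1 z.1 z.2).
Hypothesis mX2 : measurable_fun setT (fun z : I * T2 => X2 z.1 z.2).
Variable A : set I.
Hypothesis E : forall s c0, List.Forall (fun p => A p.2) s ->
    \int[m1]_w (W1 w * cos (lincomb X1 s w + c0)) =
    \int[m2]_w (W2 w * cos (lincomb X2 s w + c0)).

Let mX1i i : measurable_fun setT (X1 i).
Proof. exact: (measurableT_comp mX1 (pair1_measurable i)). Qed.

Let mX2i i : measurable_fun setT (X2 i).
Proof. exact: (measurableT_comp mX2 (pair1_measurable i)). Qed.

Section fixed_bump.
Variables (q m : R) (b : I -> R).
Hypothesis q0 : 0 < q.
Hypothesis b0 : forall i, 0 <= b i.
Hypothesis ib : lam.-integrable setT (EFin \o b).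
Hypothesis bA : forall i, ~ A i -> b i = 0.

(** The induction is on the power and generalizes over the list of points,
    since each step of [bump_mass_step] adds a point. *)
Lemma eq_char_eq_moments n l : List.Forall A l ->
  \int[m1]_w (W1 w * \prod_(j <- l) gauss_bump q m (X1 j w) * bump_mass lam X1 q m b w ^+ n) =
  \int[m2]_w (W2 w * \prod_(j <- l) gauss_bump q m (X2 j w) * bump_mass lam X2 q m b w ^+ n).
Proof.
elim: n l => [|n IH] l Al.
  have := eq_char_eq_bumps m iW1 iW2 mX1i mX2i q0 E 0 Al (List.Forall_nil _).
  rewrite (_ : \int[m1]_w _ = \int[m1]_w (W1 w * \prod_(j <- l) gauss_bump q m (X1 j w) * bump_mass lam X1 q m b w ^+ 0)).
    move=> ->; apply: eq_Rintegral => w _.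
    by rewrite /lincomb big_nil addr0 cos0 expr0.
  by apply: eq_Rintegral => w _; rewrite /lincomb big_nil addr0 cos0 expr0.
rewrite !bump_mass_step//; apply: eq_Rintegral => x _.
have [Ax|Ax] := pselect (A x); last by rewrite bA// !mul0r.
by rewrite IH//; exact: List.Forall_cons.
Qed.

Lemma eq_char_eq_bump_laplace t : 0 <= t ->
  \int[m1]_w (W1 w * expR (- (t * bump_mass lam X1 q m b w))) =
  \int[m2]_w (W2 w * expR (- (t * bump_mass lam X2 q m b w))).
Proof.
move=> t0; have H2 := @bump_mass_laplace _ _ _ lam _ _ _ _ _ iW2 mX2 q m _ q0 b0 ib _ t0.
have := @bump_mass_laplace _ _ _ lam _ _ _ _ _ iW1 mX1 q m _ q0 b0 ib _ t0.
set F2 := (X in X @ _ --> _) => H1; set F1 := (X in X @ _ --> _) in H2.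
have EF : F2 = F1.
  apply/funext => N; apply: eq_bigr => i _; congr (_ * _).
  have := eq_char_eq_moments i (List.Forall_nil _).
  under eq_Rintegral do rewrite big_nil mulr1.
  by under [in RHS]eq_Rintegral do rewrite big_nil mulr1.
by move: H1; rewrite EF => H1; exact: (cvg_unique _ H1 H2).
Qed.
End fixed_bump.

End eq_char.

Section exp_mass.
Context {R : realType} dI (I : measurableType dI).
Variable lam : {sigma_finite_measure set I -> \bar R}.
Variables (g : R) (b : I -> R).
Hypothesis b0 : forall i, 0 <= b i.
Hypothesis mb : measurable_fun setT b.

(** The total mass of the chaos built on [X], the normalization of the
    exponential being part of the weight [b]. *)
Definition exp_mass T (X : I -> T -> R) (w : T) : R :=
  \int[lam]_x (b x * expR (g * X x w)).

Definition bump_scale (q : R) : R := expR (g ^+ 2 / (4 * q)).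

Lemma bump_scaleE q y : 0 < q ->
  bump_scale q * gauss_bump q (g / (2 * q)) y = expR (g * y - q * y ^+ 2).
Proof. by move=> q0; rewrite -expRD; congr expR; field; rewrite gt_eqF. Qed.

Context d (T : measurableType d) (m1 : {measure set T -> \bar R}).
Variables (W : T -> R) (X : I -> T -> R).
Hypothesis iW : m1.-integrable setT (EFin \o W).
Hypothesis mX : measurable_fun setT (fun z : I * T => X z.1 z.2).
Hypothesis fin : {ae m1, forall w, lam.-integrable setT (EFin \o (fun x => b x * expR (g * X x w)))}.

Lemma exp_mass_ge0 w : 0 <= exp_mass X w.
Proof. by apply: Rintegral_ge0 => x _; rewrite mulr_ge0 ?expR_ge0. Qed.

Lemma measurable_exp_mass : measurable_fun setT (exp_mass X).
Proof.
have mX' : measurable_fun setT (fun z : T * I => X z.2 z.1).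
  exact: (measurableT_comp mX (@measurable_swap _ _ T I)).
have mf : measurable_fun setT (fun z : T * I => (b z.2 * expR (g * X z.2 z.1))%:E).
  apply/measurable_EFinP; apply: measurable_funM.
    exact: (measurableT_comp mb measurable_snd).
  by apply: measurableT_comp => //; exact: measurable_funM.
have := measurable_fun_fubini_tonelli_F _ mf.
rewrite /fubini_F /= => h; apply: measurableT_comp; [exact: fine_measurable|apply: h].
by move=> z; rewrite lee_fin mulr_ge0 ?expR_ge0.
Qed.

Definition bump_rate (n : nat) : R := n.+1%:R^-1.

(** The exponential functional with the exponential cut off by [exp (- q y
    ^ 2)], so that it is a bump functional with a rescaled weight. *)
Definition bump_approx (n : nat) : T -> R :=
  bump_mass lam X (bump_rate n) (g / (2 * bump_rate n))
    (fun x => b x * bump_scale (bump_rate n)).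

Lemma bump_rate_gt0 n : 0 < bump_rate n. Proof. by rewrite invr_gt0 ltr0n. Qed.

Lemma bump_approx_cvg : {ae m1, forall w, bump_approx n w @[n --> \oo] --> exp_mass X w}.
Proof.
have mXw w : measurable_fun setT (fun i => X i w).
  exact: (measurableT_comp mX (pair2_measurable w)).
apply: filterS fin => w iw.
pose f n x := b x * expR (g * X x w - bump_rate n * X x w ^+ 2).
have E n : bump_approx n w = \int[lam]_x f n x.
  by apply: eq_Rintegral => x _; rewrite -mulrA bump_scaleE ?bump_rate_gt0.
have -> : bump_approx ^~ w = (fun n => \int[lam]_x f n x) by apply/funext.
apply: (@Rintegral_dominated_cvg _ _ _ lam f _ (fun x => b x * expR (g * X x w))) => //.
- move=> n; apply: measurable_funM => //; apply: measurableT_comp => //.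
  by apply: measurable_funB => //; apply: measurable_funM => //; exact: measurable_funX.
- exact: integrable_measurable iw.
- apply: aeW => x; apply: cvgMl_tmp; apply: continuous_cvg; first exact: continuous_expR.
  rewrite -[X in _ --> X]subr0; apply: cvgB; first exact: cvg_cst.
  rewrite -(mul0r (X x w ^+ 2)); apply: cvgMr_tmp; exact: cvg_harmonic.
- move=> n x; rewrite ger0_norm ?mulr_ge0 ?expR_ge0// ler_wpM2l// ler_expR.
  by rewrite gerBl mulr_ge0 ?sqr_ge0// ltW ?bump_rate_gt0.
Qed.

Lemma bump_approx_laplace t : 0 <= t ->
  (forall n, lam.-integrable setT (EFin \o (fun x => b x * bump_scale (bump_rate n)))) ->
  \int[m1]_w (W w * expR (- (t * bump_approx n w))) @[n --> \oo] -->
  \int[m1]_w (W w * expR (- (t * exp_mass X w))).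
Proof.
move=> t0 ib; have mW := integrable_measurable iW.
have bs0 n x : 0 <= b x * bump_scale (bump_rate n) by rewrite mulr_ge0 ?expR_ge0.
apply: (@Rintegral_dominated_cvg _ _ _ m1 (fun n w => W w * expR (- (t * bump_approx n w))) _
   (fun w => `|W w|)).
- move=> n; apply: measurable_funM => //; apply: measurableT_comp => //.
  apply: measurableT_comp => //; apply: measurable_funM => //.
  exact: measurable_bump_mass.
- apply: measurable_funM => //; apply: measurableT_comp => //.
  by apply: measurableT_comp => //; apply: measurable_funM => //; exact: measurable_exp_mass.
- apply: filterS bump_approx_cvg => w cw; apply: cvgMl_tmp.
  apply: continuous_cvg; first exact: continuous_expR.
  by apply: cvgN; apply: cvgMl_tmp.
- exact: integrable_norm.
- move=> n w; rewrite normrM ler_piMr// ger0_norm ?expR_ge0// -expR0 ler_expR.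
  rewrite oppr_le0 mulr_ge0//; apply: Rintegral_ge0 => x _.
  by rewrite mulr_ge0 ?bump_ge0// bs0.
Qed.

End exp_mass.

(** Equality of the weighted characteristic functions of all linear
    combinations passes to the Laplace transforms of exponential
    functionals, through the bump functionals that approximate them. The
    weights [W1] and [W2] leave room for a change of probability. *)
Theorem eq_char_eq_laplace (R : realType) dI (I : measurableType dI)
    (lam : {sigma_finite_measure set I -> \bar R})
    d1 d2 (T1 : measurableType d1) (T2 : measurableType d2)
    (m1 : {sigma_finite_measure set T1 -> \bar R})
    (m2 : {sigma_finite_measure set T2 -> \bar R})
    (W1 : T1 -> R) (W2 : T2 -> R) (X1 : I -> T1 -> R) (X2 : I -> T2 -> R)
    (A : set I) (g : R) (b : I -> R) (t : R) :
  m1.-integrable setT (EFin \o W1) -> m2.-integrable setT (EFin \o W2) ->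
  measurable_fun setT (fun z : I * T1 => X1 z.1 z.2) ->
  measurable_fun setT (fun z : I * T2 => X2 z.1 z.2) ->
  (forall s c0, List.Forall (fun p => A p.2) s ->
    \int[m1]_w (W1 w * cos (lincomb X1 s w + c0)) =
    \int[m2]_w (W2 w * cos (lincomb X2 s w + c0))) ->
  (forall i, 0 <= b i) -> lam.-integrable setT (EFin \o b) ->
  (forall i, ~ A i -> b i = 0) ->
  {ae m1, forall w, lam.-integrable setT (EFin \o (fun x => b x * expR (g * X1 x w)))} ->
  {ae m2, forall w, lam.-integrable setT (EFin \o (fun x => b x * expR (g * X2 x w)))} ->
  0 <= t ->
  \int[m1]_w (W1 w * expR (- (t * exp_mass lam g b X1 w))) =
  \int[m2]_w (W2 w * expR (- (t * exp_mass lam g b X2 w))).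
Proof.
move=> iW1 iW2 mX1 mX2 E b0 ib bA fin1 fin2 t0.
have mb := integrable_measurable ib.
have ib' n : lam.-integrable setT (EFin \o (fun x => b x * bump_scale g (@bump_rate R n))).
  by under eq_fun do rewrite mulrC; exact: integrable_scaler.
have := bump_approx_laplace b0 mb iW1 mX1 fin1 t0 ib'.
have := bump_approx_laplace b0 mb iW2 mX2 fin2 t0 ib'.
set F2 := (X in X @ _ --> _) => H2; set F1 := (X in X @ _ --> _) => H1.
have EF : F1 = F2.
  apply/funext => n; apply: (eq_char_eq_bump_laplace iW1 iW2 mX1 mX2 E) => //.
  - exact: bump_rate_gt0.
  - by move=> i; rewrite mulr_ge0 ?expR_ge0.
  - by move=> i /bA ->; rewrite mul0r.
by move: H1; rewrite EF => H1; exact: (cvg_unique _ H1 H2).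
Qed.

(** * Exponential tilting of a Gaussian vector *)

Section tilt.
Context {R : realType}.
Local Notation mu := (@lebesgue_measure R).

(** Completing the square in the Gaussian density; the factor [exp (- t ^
    2 v / 2)] changes the variance from [s ^ 2] to [s ^ 2 / (1 + s ^ 2
    v)]. *)
Lemma gauss_quad_cos (s v c u c0 : R) : 0 < s -> 0 <= v ->
  let S := 1 + s ^+ 2 * v in let tt := s ^+ 2 / S in
  \int[normal_prob 0 s]_t (cos (u * t + c0) * expR (- (t * c + t ^+ 2 * v / 2))) =
  (Num.sqrt S)^-1 * expR (c ^+ 2 * tt / 2) *
  (cos (c0 - u * c * tt) * expR (- (u ^+ 2 * tt / 2))).
Proof.
move=> s0 v0 S tt.
have S0 : 0 < S by rewrite ltr_pwDl// mulr_ge0// sqr_ge0.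
have t0 : 0 < tt by rewrite divr_gt0// exprn_gt0.
pose tau := Num.sqrt tt; pose m := - (c * tt).
have tau2 : tau ^+ 2 = tt by rewrite sqr_sqrtr// ltW.
have tau0 : tau != 0 by rewrite gt_eqF// sqrtr_gt0.
have mc w : measurable_fun setT (fun t : R => cos (u * t + w)).
  exact: measurable_cos_affine.
rewrite integral_normal_prob; last first.
  apply: measurable_funM => //; apply: measurableT_comp => //.
  apply: measurableT_comp => //; apply: measurable_funD.
    exact: measurable_funM.
  by apply: measurable_funM => //; apply: measurable_funM => //; exact: measurable_funX.
pose K := (Num.sqrt S)^-1 * expR (c ^+ 2 * tt / 2).
have E t : cos (u * t + c0) * expR (- (t * c + t ^+ 2 * v / 2)) * normal_pdf 0 s t =
    K * (cos (u * t + c0) * normal_pdf m tau t).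
  have peakE : normal_peak s = (Num.sqrt S)^-1 * normal_peak tau.
    rewrite /normal_peak -invfM -sqrtrM ?(ltW S0)//; congr (Num.sqrt _)^-1.
    by rewrite tau2 /tt; field; rewrite gt_eqF.
  have eE : expR (- (t * c + t ^+ 2 * v / 2)) * normal_fun 0 s t =
      expR (c ^+ 2 * tt / 2) * normal_fun m tau t.
    rewrite /normal_fun -!expRD tau2 /m /tt; congr expR.
    rewrite -[s ^+ 2 *+ 2]mulr_natr -[_ *+ 2]mulr_natr /S.
    by field; rewrite !gt_eqF.
  rewrite !normal_pdfE ?(gt_eqF s0)// peakE /K.
  transitivity (cos (u * t + c0) * (Num.sqrt S)^-1 * normal_peak tau *
      (expR (- (t * c + t ^+ 2 * v / 2)) * normal_fun 0 s t)); first by ring.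
  by rewrite eE; ring.
under eq_Rintegral do rewrite E.
have ic w : mu.-integrable setT (EFin \o (fun t => cos (u * t + w) * normal_pdf 0 tau t)).
  apply: integrable_normal_prob => //; exact: integrable_cos_affine.
have mn w : measurable_fun setT (fun t => cos (u * t + c0) * normal_pdf w tau t).
  by apply: measurable_funM => //; exact: measurable_normal_pdf.
have sh t : cos (u * (t + m) + c0) * normal_pdf m tau (t + m) =
    cos (u * t + (c0 - u * c * tt)) * normal_pdf 0 tau t.
  rewrite !normal_pdfE// /normal_fun addrK subr0 /m; congr (cos _ * _); ring.
have I1 : \int[mu]_t (cos (u * t + c0) * normal_pdf m tau t) =
    cos (c0 - u * c * tt) * expR (- (u ^+ 2 * tt / 2)).
  rewrite (Rintegral_shift m (mn m)).
  under eq_Rintegral do rewrite sh.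
  by rewrite -integral_normal_prob// char_normal_prob// tau2.
rewrite -I1 -RintegralZl//.
apply: (@integrable_le _ _ _ mu _ (normal_pdf m tau)); first exact: mn.
  move=> x; rewrite normrM (ger0_norm (normal_pdf_ge0 _ _ _)) ler_piMl ?normal_pdf_ge0//.
  by rewrite ler_norml cos_geN1 cos_le1.
exact: integrable_normal_pdf.
Qed.

(** Exponential tilting of a Gaussian vector shifts it by its covariance
    with the tilting variable. Characteristic functions at complex
    arguments are avoided: [exp (G - q G ^ 2)] is a multiple of a bump,
    hence an average of cosines of [G] that [gauss_quad_cos] evaluates,
    and [q] tends to [0]. *)
Lemma tilt_char dO (Omega : measurableType dO) (P : probability Omega R)
    (G L : Omega -> R) (v vL c : R) :
  measurable_fun setT G -> measurable_fun setT L -> 0 <= v ->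
  (forall t c0, \int[P]_w cos (L w + t * G w + c0) =
    cos c0 * expR (- ((vL + 2 * t * c + t ^+ 2 * v) / 2))) ->
  P.-integrable setT (EFin \o (fun w => expR (G w))) ->
  forall c0, \int[P]_w (expR (G w) * cos (L w + c0)) =
    expR ((v - vL) / 2) * cos (c0 + c).
Proof.
move=> mG mL v0 Hch iG c0.
pose X (i : bool) := if i then G else L.
have mX i : measurable_fun setT (X i) by case: i.
have i1 : P.-integrable setT (EFin \o (fun=> 1 : R)).
  exact: finite_measure_integrable_cst.
pose V q := expR (- (vL / 2)) * ((Num.sqrt (1 + 2 * q * v))^-1 *
  expR (q * c ^+ 2 / (1 + 2 * q * v)) * (cos (c0 + c / (1 + 2 * q * v)) *
  expR (v / (2 * (1 + 2 * q * v))))).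
have VE q : 0 < q ->
    \int[P]_w (expR (G w - q * G w ^+ 2) * cos (L w + c0)) = V q.
  move=> q0; pose m := 1 / (2 * q).
  have S0 : 0 < 1 + 2 * q * v by rewrite ltr_pwDl// !mulr_ge0// ltW.
  transitivity (bump_scale 1 q * \int[P]_w (1 * \prod_(j <- [:: true]) gauss_bump q m (X j w) *
      cos (lincomb X [:: (1, false)] w + c0))).
    rewrite -RintegralZl//; last first.
      apply: (@integrable_le _ _ _ P _ (fun=> 1)) => //.
        apply: measurable_funM.
          apply: measurable_funM => //; exact: measurable_prod_bump.
        apply: (measurableT_comp measurable_cosR); apply: measurable_funD => //.
        exact: measurable_lincomb.
      move=> w; rewrite mul1r normrM mulr_ile1//; first exact: prod_bump_norm.
      by rewrite ler_norml cos_geN1 cos_le1.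
    apply: eq_Rintegral => w _.
    have bE : bump_scale 1 q * gauss_bump q m (G w) = expR (G w - q * G w ^+ 2).
      by rewrite bump_scaleE// mul1r.
    by rewrite big_seq1 /lincomb big_seq1 /= !mul1r mulrA bE.
  rewrite bump_mix//; have s0 : 0 < Num.sqrt (2 * q) by rewrite sqrtr_gt0 mulr_gt0.
  transitivity (bump_scale 1 q * \int[normal_prob 0 (Num.sqrt (2 * q))]_t
      (expR (- (vL / 2)) * (cos (- m * t + c0) * expR (- (t * c + t ^+ 2 * v / 2))))).
    congr (_ * _); apply: eq_Rintegral => t _.
    transitivity (\int[P]_w cos (L w + t * G w + (c0 - t * m))).
      apply: eq_Rintegral => w _; rewrite big_nil !mul1r /lincomb big_cons big_seq1/=.
      by congr cos; ring.
    rewrite Hch [RHS]mulrCA -expRD; congr (cos _ * expR _); first ring.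
    by field.
  rewrite RintegralZl//; last first.
    have q20 : (0 : R) <= 2 * q by rewrite mulr_ge0// ltW.
    apply: (@integrable_le _ _ _ (normal_prob 0 (Num.sqrt (2 * q))) _ (fun t => expR (- c * t))).
    - apply: measurable_funM; first exact: measurable_cos_affine.
      apply: measurableT_comp => //; apply: measurableT_comp => //; apply: measurable_funD.
        exact: measurable_funM.
      by apply: measurable_funM => //; apply: measurable_funM => //; exact: measurable_funX.
    - move=> t; rewrite normrM (ger0_norm (expR_ge0 _)).
      apply: (@le_trans _ _ (1 * expR (- (t * c + t ^+ 2 * v / 2)))).
        by rewrite ler_wpM2r ?expR_ge0// ler_norml cos_geN1 cos_le1.
      rewrite mul1r ler_expR.
      have : 0 <= t ^+ 2 * v / 2 by rewrite divr_ge0// mulr_ge0// sqr_ge0.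
      by nra.
    - by apply: integrable_expR_normal; rewrite gt_eqF.
  rewrite gauss_quad_cos//= sqr_sqrtr ?mulr_ge0 ?(ltW q0)//.
  rewrite mulrCA /V; congr (_ * _); rewrite /bump_scale.
  have -> : c ^+ 2 * (2 * q / (1 + 2 * q * v)) / 2 = q * c ^+ 2 / (1 + 2 * q * v).
    by field; rewrite gt_eqF.
  have -> : c0 - - m * c * (2 * q / (1 + 2 * q * v)) = c0 + c / (1 + 2 * q * v).
    by rewrite /m; field; rewrite !gt_eqF.
  rewrite mulrCA; congr (_ * _); rewrite mulrCA; congr (_ * _).
  rewrite -expRD; congr expR; rewrite /m; field.
  by rewrite !gt_eqF.
have rate0 : bump_rate n @[n --> \oo] --> (0 : R) by exact: cvg_harmonic.
have lim1 : V (bump_rate n) @[n --> \oo] --> V 0.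
  have cS : 1 + 2 * bump_rate n * v @[n --> \oo] --> (1 + 2 * 0 * v : R).
    apply: cvgD; first exact: cvg_cst.
    by apply: cvgMr_tmp; apply: cvgMl_tmp.
  have S1 : 1 + 2 * 0 * v = 1 :> R by rewrite mulr0 mul0r addr0.
  have cSV : (1 + 2 * bump_rate n * v)^-1 @[n --> \oo] --> ((1 + 2 * 0 * v)^-1 : R).
    by apply: cvgV => //; rewrite S1.
  apply: cvgMl_tmp; apply: cvgM.
    apply: cvgM.
      apply: cvgV; first by rewrite S1 sqrtr1.
      by apply: continuous_cvg => //; exact: sqrt_continuous.
    apply: continuous_cvg; first exact: continuous_expR.
    by apply: cvgM => //; apply: cvgMr_tmp.
  apply: cvgM.
    apply: continuous_cvg; first exact: continuous_cos.
    by apply: cvgD; [exact: cvg_cst|apply: cvgMl_tmp].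
  apply: continuous_cvg; first exact: continuous_expR.
  apply: cvgMl_tmp; apply: cvgV; first by rewrite S1 mulr1.
  exact: cvgMl_tmp.
have -> : expR ((v - vL) / 2) * cos (c0 + c) = V 0.
  have S1 : 1 + 2 * 0 * v = 1 by rewrite mulr0 mul0r addr0.
  rewrite /V S1 sqrtr1 !divr1 invr1 mul0r expR0 !mul1r mulr1.
  by rewrite mulrCA -expRD mulrC; congr (_ * expR _); field.
have lim2 : V (bump_rate n) @[n --> \oo] --> \int[P]_w (expR (G w) * cos (L w + c0)).
  pose f n w := expR (G w - bump_rate n * G w ^+ 2) * cos (L w + c0).
  have EV : (fun n => V (bump_rate n)) = (fun n => \int[P]_w f n w).
    by apply/funext => n; rewrite VE// bump_rate_gt0.
  rewrite EV.
  have mcos : measurable_fun setT (fun w => cos (L w + c0)).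
    by apply: (measurableT_comp measurable_cosR); exact: measurable_funD.
  apply: (@Rintegral_dominated_cvg _ _ _ P f _ (fun w => expR (G w))) => //.
  - move=> n; apply: measurable_funM => //; apply: measurableT_comp => //.
    by apply: measurable_funB => //; apply: measurable_funM => //; exact: measurable_funX.
  - by apply: measurable_funM => //; exact: measurableT_comp.
  - apply: aeW => w; apply: cvgMr_tmp; apply: continuous_cvg; first exact: continuous_expR.
    rewrite -[X in _ --> X]subr0; apply: cvgB; first exact: cvg_cst.
    by rewrite -(mul0r (G w ^+ 2)); apply: cvgMr_tmp.
  - move=> n w; rewrite normrM (ger0_norm (expR_ge0 _)).
    apply: (@le_trans _ _ (expR (G w - bump_rate n * G w ^+ 2))).
      by rewrite ler_piMr ?expR_ge0// ler_norml cos_geN1 cos_le1.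
    by rewrite ler_expR gerBl mulr_ge0 ?sqr_ge0// ltW ?bump_rate_gt0.
exact: (cvg_unique _ lim2 lim1).
Qed.
End tilt.

(** * Euclidean geometry and Lebesgue measure *)

(* the Euclidean distance, not the extended distance of a pseudometric space *)
Local Notation edist := Defs.edist.

Section euclidean_geometry.
Context {R : realType} {d : nat}.
Implicit Types x y z u v : Rd R d.

(** Multiplied by the sum [B] of the squares of [b], the difference of the
    two sides is the sum of the squares of [B a - C b], with [C] the
    scalar product. *)
Lemma cauchy_schwarz_sum (a b : 'I_d -> R) :
  (\sum_i a i * b i) ^+ 2 <= (\sum_i a i ^+ 2) * (\sum_i b i ^+ 2).
Proof.
set A := \sum_i a i ^+ 2; set B := \sum_i b i ^+ 2; set C := \sum_i a i * b i.
have B0 : 0 <= B by apply: sumr_ge0 => i _; exact: sqr_ge0.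
have H : 0 <= B * (A * B - C ^+ 2).
  have <- : \sum_i (B * a i - C * b i) ^+ 2 = B * (A * B - C ^+ 2).
    under eq_bigr do rewrite sqrrB !exprMn.
    rewrite big_split/= big_split/= sumrN -!mulr_sumr -/A -/B.
    rewrite (_ : \sum_(i < d) B * a i * (C * b i) *+ 2 = 2 * B * C * C); last first.
      rewrite {3}/C mulr_sumr; apply: eq_bigr => i _.
      by rewrite -mulr_natl; ring.
    ring.
  by apply: sumr_ge0 => i _; exact: sqr_ge0.
have [B00|B00] := eqVneq B 0.
  have b0 i : b i = 0.
    move: B00 => /eqP; rewrite psumr_eq0 => [|j _]; last exact: sqr_ge0.
    by move=> /allP/(_ i (mem_index_enum _)); rewrite sqrf_eq0 => /eqP.
  by rewrite /C B00 mulr0 big1 ?expr0n// => i _; rewrite b0 mulr0.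
rewrite -subr_ge0; move: H; rewrite pmulr_rge0// lt_neqAle eq_sym B00//.
Qed.

Lemma edist_ge0 x y : 0 <= edist x y. Proof. exact: sqrtr_ge0. Qed.

Lemma edist_sym x y : edist x y = edist y x.
Proof.
by rewrite /edist; congr Num.sqrt; apply: eq_bigr => i _; rewrite -sqrrN opprB.
Qed.

Lemma edist_triangle y x z : edist x z <= edist x y + edist y z.
Proof.
pose a i : R := (tnth x i : R) - (tnth y i : R).
pose b i : R := (tnth y i : R) - (tnth z i : R).
have A0 : 0 <= \sum_i a i ^+ 2 by apply: sumr_ge0 => i _; exact: sqr_ge0.
have B0 : 0 <= \sum_i b i ^+ 2 by apply: sumr_ge0 => i _; exact: sqr_ge0.
rewrite -(@ler_pXn2r _ 2)// ?nnegrE ?addr_ge0 ?edist_ge0//.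
rewrite sqrrD !sqr_sqrtr//; last by apply: sumr_ge0 => i _; exact: sqr_ge0.
have -> : \sum_(i < d) ((tnth x i : R) - (tnth z i : R)) ^+ 2 =
    \sum_i a i ^+ 2 + (\sum_i a i * b i) *+ 2 + \sum_i b i ^+ 2.
  rewrite -sumrMnl -!big_split/=; apply: eq_bigr => i _.
  by rewrite -sqrrD /a /b; congr (_ ^+ 2); ring.
rewrite lerD2r lerD2l lerMn2r//= -sqrtrM//.
apply: le_trans (ler_norm _) _; rewrite -sqrtr_sqr ler_wsqrtr//.
exact: cauchy_schwarz_sum.
Qed.

Lemma edist_affine (e : R) x y u v : 0 <= e ->
  (forall i, (tnth x i : R) - tnth y i = e * ((tnth u i : R) - tnth v i)) ->
  edist x y = e * edist u v.
Proof.
move=> e0 E; rewrite /edist -[in RHS](ger0_norm e0) -sqrtr_sqr -sqrtrM ?sqr_ge0//.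
by congr Num.sqrt; rewrite mulr_sumr; apply: eq_bigr => i _; rewrite E exprMn.
Qed.

Lemma measurable_edist2 :
  measurable_fun setT (fun p : Rd R d * Rd R d => edist p.1 p.2).
Proof.
pose g (p : Rd R d * Rd R d) := \sum_(i < d) ((tnth p.1 i : R) - (tnth p.2 i : R)) ^+ 2.
apply: (@measurableT_comp _ _ _ _ _ _ (@Num.sqrt R) _ g).
  by apply: continuous_measurable_fun; exact: sqrt_continuous.
apply: measurable_sum => i; apply: measurable_funX; apply: measurable_funB.
  exact: (measurableT_comp (measurable_coord i) measurable_fst).
exact: (measurableT_comp (measurable_coord i) measurable_snd).
Qed.

(** Dilation of the space; [reflect_scale] of the dilated point at the
    dilated scale is the dilation of [reflect_scale]. *)
Definition scale (r : R) x : Rd R d := [tuple r * (tnth x i : R) | i < d].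

Lemma measurable_scale r : measurable_fun setT (scale r).
Proof.
apply/measurable_fun_tnthP => i.
rewrite (_ : _ \o _ = fun y => r * (tnth y i : R)); last first.
  by apply/funext => y /=; rewrite tnth_mktuple.
by apply: measurable_funM => //; exact: measurable_coord.
Qed.

Lemma edist_scale r x y : 0 <= r -> edist (scale r x) (scale r y) = r * edist x y.
Proof. by move=> r0; apply: edist_affine => // i; rewrite !tnth_mktuple mulrBr. Qed.

Lemma scale_origin r : scale r origin = origin.
Proof. by apply: eq_from_tnth => i; rewrite !tnth_mktuple mulr0. Qed.

Lemma eball_scale (r s : R) x : 0 < r -> eball (r * s) (scale r x) <-> eball s x.
Proof.
move=> r0; rewrite /eball /= -{1}(scale_origin r) edist_scale ?(ltW r0)//.
by rewrite ltr_pM2l.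
Qed.

Lemma reflect_scale_scale r e x u :
  reflect_scale (r * e) (scale r x) u = scale r (reflect_scale e x u).
Proof. by apply: eq_from_tnth => i; rewrite !tnth_mktuple; ring. Qed.

Lemma edist_reflect e x u : 0 <= e -> edist (reflect_scale e x u) x = e * edist u origin.
Proof.
move=> e0; rewrite edist_sym; apply: edist_affine => // i.
by rewrite !tnth_mktuple; ring.
Qed.

Lemma edist_reflect2 e x u v : 0 <= e ->
  edist (reflect_scale e x u) (reflect_scale e x v) = e * edist u v.
Proof.
move=> e0; rewrite (edist_sym u); apply: edist_affine => // i.
by rewrite !tnth_mktuple; ring.
Qed.

Lemma edist_reflect_l e x z v : 0 < e ->
  edist z (reflect_scale e x v) = e * edist [tuple ((tnth x i : R) - tnth z i) / e | i < d] v.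
Proof.
move=> e0; rewrite edist_sym; apply: edist_affine => [|i]; first exact: ltW.
by rewrite !tnth_mktuple; field; rewrite gt_eqF.
Qed.

End euclidean_geometry.

Section lebesgue_tuple.
Context {R : realType}.
Local Open Scope ereal_scope.

Lemma ge0_integral_lebesgueT_S n (f : Rd R n.+1 -> \bar R) :
  measurable_fun setT f -> (forall x, 0 <= f x) ->
  \int[lebesgue_measureT R n.+1]_x f x =
  \int[lebesgue_measure]_a \int[lebesgue_measureT R n]_t f (tcons (a, t)).
Proof.
move=> mf f0.
rewrite (eq_measure_integral (measure_function_pushforward__canonical__measure_function_Measure
  (lebesgue_measure \x lebesgue_measureT R n)%E (@measurable_tcons R n))); last by [].
rewrite ge0_integral_pushforward//; last exact: measurable_tcons.
rewrite preimage_setT fubini_tonelli1//=.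
exact: (measurableT_comp mf (@measurable_tcons R n)).
Qed.

Lemma tcons_scale n (r : R) (p : measurableTypeR R * Rd R n) :
  scale r (tcons p) = tcons (r * p.1, scale r p.2)%R.
Proof.
apply: eq_from_tnth => i; rewrite tnth_mktuple.
case: (unliftP ord0 i) => [j|] ->; first by rewrite !tnthS tnth_mktuple.
by rewrite !tnth0.
Qed.

(** Induction on the dimension, one coordinate at a time, by the change of
    variables on the line. *)
Lemma ge0_integral_lebesgueT_scale n (r : R) (f : Rd R n -> \bar R) : (0 < r)%R ->
  measurable_fun setT f -> (forall x, 0 <= f x) ->
  \int[lebesgue_measureT R n]_x f x =
  (r ^+ n)%:E * \int[lebesgue_measureT R n]_x f (scale r x).
Proof.
move=> r0.
have key m (H : R -> \bar R) : measurable_fun setT H -> (forall a, 0 <= H a) ->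
    \int[lebesgue_measure]_a ((r ^+ m)%:E * H a) =
    (r ^+ m.+1)%:E * \int[lebesgue_measure]_a H (r * a + 0)%R.
  move=> mH H0; rewrite ge0_integralZl//; last by rewrite lee_fin exprn_ge0// ltW.
  by rewrite exprSr EFinM -muleA -(ge0_integral_affine 0 r0).
elim: n f => [|n IH] f mf f0.
  rewrite expr0 mul1e; apply: eq_integral => x _; congr f.
  by apply: eq_from_tnth => -[].
have mft : measurable_fun setT (fun p => f (tcons p)).
  exact: (measurableT_comp mf (@measurable_tcons R n)).
have mfs : measurable_fun setT (fun x => f (scale r x)).
  exact: (measurableT_comp mf (measurable_scale r)).
rewrite !ge0_integral_lebesgueT_S//.
under eq_integral.
  move=> a _; rewrite (IH (fun t => f (tcons (a, t))))//; last first.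
    exact: (measurableT_comp mft (pair1_measurable a)).
  over.
have mg : measurable_fun setT (fun p : measurableTypeR R * Rd R n => f (tcons (p.1, scale r p.2))).
  apply: (measurableT_comp mft (g := fun p : measurableTypeR R * Rd R n => (p.1, scale r p.2))).
  apply: measurable_fun_pair => //.
  exact: (measurableT_comp (measurable_scale r) measurable_snd).
have mG : measurable_fun setT (fun a => \int[lebesgue_measureT R n]_t f (tcons (a, scale r t))).
  exact: (measurable_fun_fubini_tonelli_F (m2 := lebesgue_measureT R n)
    (fun p => f (tcons (p.1, scale r p.2)))).
have G0 a : 0 <= \int[lebesgue_measureT R n]_t f (tcons (a, scale r t)).
  exact: integral_ge0.
rewrite (key n _ mG G0); congr (_ * _); apply: eq_integral => a _; apply: eq_integral => t _.
by rewrite tcons_scale addr0.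
Qed.

Lemma coord_le_edist n (x : Rd R n) (i : 'I_n) : (`|(tnth x i : R)| <= edist x origin)%R.
Proof.
rewrite -sqrtr_sqr /Defs.edist ler_wsqrtr// (bigD1 i)//= tnth_mktuple subr0.
by rewrite lerDl sumr_ge0// => j _; exact: sqr_ge0.
Qed.

Lemma lebesgueT_eball_lty n : lebesgue_measureT R n (eball 1) < +oo.
Proof.
have mbox : forall i : 'I_n, measurable (`](-1)%R, 1%R[%classic : set (measurableTypeR R)).
  by move=> i; exact: measurable_itv.
apply: (@le_lt_trans _ _ (lebesgue_measureT R n [set x | forall i, `](-1)%R, 1%R[%classic (tnth x i)])).
  apply: le_measure; rewrite ?inE; [exact: measurable_eball|exact: (measurable_box mbox)|].
  move=> x x1 i /=; rewrite in_itv/= -ltr_norml.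
  by apply: le_lt_trans x1; exact: coord_le_edist.
rewrite (lebesgue_measureT_box mbox) (_ : \prod_(i < n) _ = (\prod_(i < n) (2 : R))%:E).
  exact: ltry.
apply: (big_rec2 (fun a b => a = b%:E)) => // i _ b _ ->; rewrite EFinM; congr (_ * _).
by rewrite lebesgue_measure_itv/= lte_fin gtrN ?ltr01// -EFinD opprK.
Qed.

End lebesgue_tuple.

(** * The logarithmic kernel *)

Lemma measurable_invr (R : realType) : measurable_fun setT (@GRing.inv R).
Proof.
have -> : @GRing.inv R = fun x => if 0 < x then expR (- ln x) else
    if x < 0 then - expR (- ln (- x)) else 0.
  apply/funext => x; case: ltgtP => [x0|x0|<-]; last by rewrite invr0.
    by rewrite expRN lnK.
  by rewrite expRN lnK ?posrE ?oppr_gt0// invrN opprK.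
apply: measurable_fun_ifT.
- exact: measurable_fun_ltr.
- by apply: measurableT_comp => //; apply: measurableT_comp => //; exact: measurable_ln.
- apply: measurable_fun_ifT => //; first exact: measurable_fun_ltr.
  apply: measurableT_comp => //; apply: measurableT_comp => //.
  by apply: measurableT_comp => //; apply: measurableT_comp.
Qed.

Section kernel.
Context {R : realType} {d : nat}.
Implicit Types x y z u v : Rd R d.
Variable T : R.
Hypothesis T0 : 0 < T.
Local Notation K := (@log_kernel R d T).
Local Open Scope ereal_scope.

Let measurable_if_edist0 (f : Rd R d * Rd R d -> R) :
  measurable_fun setT f ->
  measurable_fun setT (fun p : Rd R d * Rd R d =>
    if edist p.1 p.2 == 0%R then +oo else (f p)%:E).
Proof.
move=> mf; apply: measurable_fun_if => //.
- have m0 := measurable_edist2 (R := R) (d := d).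
  apply: (measurable_fun_bool true).
  rewrite setTI (_ : _ @^-1` _ = (fun p : Rd R d * Rd R d => edist p.1 p.2) @^-1` [set 0%R]).
    by rewrite -[X in measurable X]setTI; apply: m0 => //; exact: measurable_set1.
  by apply/seteqP; split => p /= /eqP.
- by apply: measurable_funTS; exact/measurable_EFinP.
Qed.

Lemma measurable_log_kernel : measurable_fun setT (fun p => K p.1 p.2).
Proof.
apply: (measurable_if_edist0 (f := fun p => ln (T / edist p.1 p.2))).
apply: measurableT_comp; first exact: measurable_ln.
apply: measurable_funM => //; apply: measurableT_comp; last exact: measurable_edist2.
exact: measurable_invr.
Qed.

Lemma measurable_abs_log : measurable_fun setT (fun p => @abs_log R d p.1 p.2).
Proof.
apply: (measurable_if_edist0 (f := fun p => `|ln (edist p.1 p.2)|%R)).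
apply: measurableT_comp => //; apply: measurableT_comp; first exact: measurable_ln.
exact: measurable_edist2.
Qed.

Lemma measurable_log_kernel1 x : measurable_fun setT (K x).
Proof. exact: (measurableT_comp measurable_log_kernel (pair1_measurable x)). Qed.

Lemma log_kernel_ge (C : R) x y : (0 < C)%R -> (edist x y <= C)%R ->
  (ln (T / C))%:E <= K x y.
Proof.
move=> C0 xyC; rewrite /log_kernel; case: eqVneq => [_|xy0]; first exact: leey.
rewrite lee_fin ler_ln ?posrE ?divr_gt0//.
  by rewrite ler_pM2l// lef_pV2 ?posrE// lt_neqAle eq_sym xy0 edist_ge0.
by rewrite lt_neqAle eq_sym xy0 edist_ge0.
Qed.

Lemma log_kernel_le (C : R) x y : (0 < C)%R -> (C <= edist x y)%R ->
  K x y <= (ln (T / C))%:E.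
Proof.
move=> C0 xyC; have xy0 : (0 < edist x y)%R by exact: lt_le_trans xyC.
rewrite /log_kernel gt_eqF// lee_fin ler_ln ?posrE ?divr_gt0//.
by rewrite ler_pM2l// lef_pV2 ?posrE.
Qed.

Lemma log_kernel_ball x y : eball 1 x -> eball 1 y -> (ln (T / 2))%:E <= K x y.
Proof.
move=> xB yB; apply: log_kernel_ge => //.
apply: le_trans (edist_triangle origin x y) _.
rewrite (edist_sym origin); apply: ltW.
by rewrite (_ : 2 = 1 + 1)%R//; apply: ltrD.
Qed.

(** This reduces energies of mollified measures to the integrability of
    the logarithm that is part of the definition of a mollifier. *)
Lemma abse_log_kernel_le (e : R) x y u v : (0 < e)%R ->
  edist x y = (e * edist u v)%R ->
  `|K x y| <= `|ln (T / e)|%:E + abs_log u v.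
Proof.
move=> e0 E; rewrite /log_kernel /abs_log E mulf_eq0 gt_eqF//=.
case: eqVneq => [_|uv0]; first by rewrite addey.
have uv : (0 < edist u v)%R by rewrite lt_neqAle eq_sym uv0 edist_ge0.
rewrite -EFinD !abse_EFin lee_fin.
by rewrite invfM mulrA lnM ?posrE ?invr_gt0 ?divr_gt0// lnV ?posrE// ler_normB.
Qed.

(** The one place where the kernel has to be logarithmic: a dilation acts
    on it by adding a constant. *)
Lemma log_kernel_scale (r : R) x y : (0 < r)%R ->
  K (scale r x) (scale r y) = (ln r^-1)%:E + K x y.
Proof.
move=> r0; rewrite /log_kernel edist_scale ?(ltW r0)// mulf_eq0 (gt_eqF r0)/=.
case: eqVneq => [_|xy0]; first by rewrite addey.
have xy : (0 < edist x y)%R by rewrite lt_neqAle eq_sym xy0 edist_ge0.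
rewrite -EFinD -lnM ?posrE ?invr_gt0 ?divr_gt0//; congr (ln _)%:E.
by field; rewrite !gt_eqF.
Qed.

End kernel.

(** * Energies of mollified measures *)

Lemma integral_probability_cst d (T : measurableType d) (R : realType)
    (P : probability T R) (c : \bar R) : (\int[P]__ c = c)%E.
Proof. by rewrite integral_cst// [X in (_ * X)%E]probability_setT mule1. Qed.

Lemma ge0_integral_mrestr d (T : measurableType d) (R : realType)
    (mu : {measure set T -> \bar R}) (D : set T) (mD : measurable D)
    (f : T -> \bar R) : measurable_fun setT f -> (forall x, 0 <= f x)%E ->
  (\int[mrestr mu mD]_x f x = \int[mu]_x (f x * (\1_D x)%:E))%E.
Proof.
move=> mf f0; apply: ge0_integral_density => //.
by move=> A mA; rewrite integral_indic// setIC.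
Qed.

Section mollified_measures.
Context {R : realType} {d : nat}.
Implicit Types x y z u v : Rd R d.
Variable T : R.
Hypothesis T0 : 0 < T.
Local Notation K := (@log_kernel R d T).
Variable theta : probability (Rd R d) R.
Hypothesis htheta : mollifier theta.
Local Open Scope ereal_scope.

Lemma ge0_integral_theta_eps e x (f : Rd R d -> \bar R) :
  measurable_fun setT f -> (forall z, 0 <= f z) ->
  \int[theta_eps theta e x]_z f z =
  \int[theta]_u (f (reflect_scale e x u) * (\1_(eball 1) (reflect_scale e x u))%:E).
Proof.
move=> mf f0; rewrite ge0_integral_mrestr// ge0_integral_distribution//.
- by apply: emeasurable_funM => //; apply/measurable_EFinP; apply: measurable_indic; exact: measurable_eball.
- by move=> z; rewrite mule_ge0// lee_fin.
Qed.

Lemma le_integral_theta_eps e x (f : Rd R d -> \bar R) :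
  measurable_fun setT f -> (forall z, 0 <= f z) ->
  \int[theta_eps theta e x]_z f z <= \int[theta]_u f (reflect_scale e x u).
Proof.
move=> mf f0; rewrite ge0_integral_theta_eps//.
have mfr : measurable_fun setT (fun u => f (reflect_scale e x u)).
  exact: (measurableT_comp mf (measurable_reflect_scale e x)).
apply: ge0_le_integral => //.
- by move=> u _; rewrite mule_ge0// lee_fin.
- apply: emeasurable_funM => //; apply/measurable_EFinP.
  have mi : measurable_fun setT (\1_(eball 1) : Rd R d -> R).
    by apply: measurable_indic; exact: measurable_eball.
  exact: (measurableT_comp mi (measurable_reflect_scale e x)).
- by move=> u _; rewrite -[leRHS]mule1 lee_wpmul2l// lee_fin indicE; case: (_ \in _).
Qed.

Let mabsK z : measurable_fun setT (fun y => `|K z y|).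
Proof. by apply: measurableT_comp => //; exact: measurable_log_kernel1. Qed.

Lemma potential_theta_lty e x z : (0 < e)%R ->
  \int[theta]_v `|K z (reflect_scale e x v)| < +oo.
Proof.
move=> e0; pose w : Rd R d := [tuple (((tnth x i : R) - tnth z i) / e)%R | i < d].
have [_ h _] := htheta.
have mal : measurable_fun setT (@abs_log R d w).
  exact: (measurableT_comp measurable_abs_log (pair1_measurable w)).
have al0 v : 0 <= abs_log w v by rewrite /abs_log; case: ifP.
apply: (@le_lt_trans _ _ (\int[theta]_v (`|ln (T / e)|%:E + abs_log w v))).
  apply: ge0_le_integral => //.
  - exact: (measurableT_comp (mabsK z) (measurable_reflect_scale e x)).
  - by apply: emeasurable_funD.
  - by move=> v _; apply: abse_log_kernel_le => //; rewrite edist_reflect_l.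
rewrite ge0_integralD// integral_probability_cst.
by rewrite lte_add_pinfty ?ltry.
Qed.

Lemma self_energy_theta_lty e x : (0 < e)%R ->
  \int[theta]_u \int[theta]_v `|K (reflect_scale e x u) (reflect_scale e x v)| < +oo.
Proof.
move=> e0; have [_ _ h] := htheta.
have mal := @measurable_abs_log R d.
have mal1 w : measurable_fun setT (@abs_log R d w).
  exact: (measurableT_comp mal (pair1_measurable w)).
have al0 (p : Rd R d * Rd R d) : 0 <= abs_log p.1 p.2 by rewrite /abs_log; case: ifP.
have mKr : measurable_fun setT (fun p : Rd R d * Rd R d =>
    `|K (reflect_scale e x p.1) (reflect_scale e x p.2)|).
  apply: measurableT_comp => //.
  apply: (measurableT_comp (f := fun p => K p.1 p.2) (g := fun p : Rd R d * Rd R d =>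
    (reflect_scale e x p.1, reflect_scale e x p.2))).
    exact: measurable_log_kernel.
  apply: measurable_fun_pair.
    exact: (measurableT_comp (measurable_reflect_scale e x) measurable_fst).
  exact: (measurableT_comp (measurable_reflect_scale e x) measurable_snd).
apply: (@le_lt_trans _ _ (\int[theta]_u \int[theta]_v (`|ln (T / e)|%:E + abs_log u v))).
  apply: ge0_le_integral => //.
  - by move=> u _; exact: integral_ge0.
  - exact: (measurable_fun_fubini_tonelli_F _ mKr).
  - apply: (measurable_fun_fubini_tonelli_F (fun p : Rd R d * Rd R d => `|ln (T / e)|%:E + abs_log p.1 p.2)).
      exact: emeasurable_funD.
    by move=> p; rewrite adde_ge0.
  - move=> u _; apply: ge0_le_integral => //.
    + exact: (measurableT_comp mKr (pair1_measurable u)).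
    + exact: emeasurable_funD.
    + by move=> v _; apply: abse_log_kernel_le => //; rewrite edist_reflect2// ltW.
under eq_integral.
  move=> u _; rewrite ge0_integralD//; last by move=> v _; exact: (al0 (u, v)).
  rewrite integral_probability_cst; over.
rewrite ge0_integralD//.
- by rewrite integral_probability_cst lte_add_pinfty ?ltry.
- by move=> u _; apply: integral_ge0 => v _; exact: (al0 (u, v)).
- exact: (measurable_fun_fubini_tonelli_F (fun p : Rd R d * Rd R d => abs_log p.1 p.2)).
Qed.

(** Truncation to the unit ball only lowers an energy of absolute values,
    and the untruncated one is that of [theta] up to the constant brought
    by the dilation. *)
Lemma theta_eps_finite_energy e x : (0 < e)%R -> finite_energy T (theta_eps theta e x).
Proof.
move=> e0; split.
  change (distribution theta (reflect_scale e x) (~` eball 1 `&` eball 1) = 0).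
  by rewrite setICl measure0.
have mK := measurable_log_kernel (R := R) (d := d) T.
have mabs : measurable_fun setT (fun p => `|K p.1 p.2|) by exact: measurableT_comp.
apply: le_lt_trans (self_energy_theta_lty x e0).
apply: le_trans.
  apply: le_integral_theta_eps.
    exact: (measurable_fun_fubini_tonelli_F (m2 := theta_eps theta e x) _ mabs).
  by move=> z; exact: integral_ge0.
apply: ge0_le_integral => //.
- by move=> u _; exact: integral_ge0.
- have := measurable_fun_fubini_tonelli_F (m2 := theta_eps theta e x) _ mabs.
  by move=> /(_ (fun _ => abse_ge0 _)) mF; exact: (measurableT_comp mF (measurable_reflect_scale e x)).
- apply: (measurable_fun_fubini_tonelli_F (m2 := theta) (fun p : Rd R d * Rd R d =>
    `|K (reflect_scale e x p.1) (reflect_scale e x p.2)|)) => //.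
  apply: (measurableT_comp (f := fun p => `|K p.1 p.2|) (g := fun p : Rd R d * Rd R d =>
    (reflect_scale e x p.1, reflect_scale e x p.2))) => //.
  apply: measurable_fun_pair.
    exact: (measurableT_comp (measurable_reflect_scale e x) measurable_fst).
  exact: (measurableT_comp (measurable_reflect_scale e x) measurable_snd).
- move=> u _; apply: le_integral_theta_eps => //.
Qed.

End mollified_measures.

Section log_energy.
Context {R : realType} {d : nat}.
Implicit Types x y z u v : Rd R d.
Variable T : R.
Hypothesis T0 : 0 < T.
Local Notation K := (@log_kernel R d T).
Local Open Scope ereal_scope.
Implicit Types mu nu : {finite_measure set (Rd R d) -> \bar R}.

Let Kp x y := Order.max (K x y) 0.
Let Kn x y := Order.max (- K x y) 0.

Let mK := measurable_log_kernel (R := R) (d := d) T.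

Let mKp : measurable_fun setT (fun p => Kp p.1 p.2).
Proof. by apply: measurable_maxe. Qed.

Let mKn : measurable_fun setT (fun p => Kn p.1 p.2).
Proof. by apply: measurable_maxe => //; exact: measurableT_comp. Qed.

Let Kp0 x y : 0 <= Kp x y. Proof. by rewrite le_max lexx orbT. Qed.
Let Kn0 x y : 0 <= Kn x y. Proof. by rewrite le_max lexx orbT. Qed.

Let mK1 (f : Rd R d -> Rd R d -> \bar R) x :
  measurable_fun setT (fun p => f p.1 p.2) -> measurable_fun setT (f x).
Proof. by move=> mf; exact: (measurableT_comp mf (pair1_measurable x)). Qed.

Let mint (f : Rd R d -> Rd R d -> \bar R) nu :
  measurable_fun setT (fun p => f p.1 p.2) -> (forall x y, 0 <= f x y) ->
  measurable_fun setT (fun x => \int[nu]_y f x y).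
Proof.
move=> mf f0; exact: (measurable_fun_fubini_tonelli_F (m2 := nu) (fun p => f p.1 p.2)).
Qed.

Lemma integral_log_kernel nu x :
  \int[nu]_y K x y = \int[nu]_y Kp x y - \int[nu]_y Kn x y.
Proof.
rewrite integralE; congr (_ - _); apply: eq_integral => y _.
  by rewrite funeposE.
by rewrite funenegE.
Qed.

Lemma measurable_potential nu : measurable_fun setT (fun x => \int[nu]_y K x y).
Proof.
under eq_fun do rewrite integral_log_kernel.
apply: emeasurable_funB; exact: mint.
Qed.

(** Inside the unit ball the kernel is at least [ln (T / 2)], so the
    negative part of an energy is bounded by the total masses. *)
Definition energy_slack mu nu : R :=
  `|ln (T / 2)| * fine (nu setT) * fine (mu setT).

Lemma double_neg_le mu nu : mu (~` eball 1) = 0 -> nu (~` eball 1) = 0 ->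
  \int[mu]_x \int[nu]_y Kn x y <= (energy_slack mu nu)%:E.
Proof.
move=> mu0 nu0; pose c : R := `|ln (T / 2)|%R; have c0 : (0 <= c)%R by exact: normr_ge0.
have mB : measurable (~` (eball 1 : set (Rd R d))) by apply: measurableC; exact: measurable_eball.
have aeb (m : {finite_measure set (Rd R d) -> \bar R}) : m (~` eball 1) = 0 ->
    {ae m, forall x, eball 1 x}.
  by move=> m0; exists (~` eball 1); split.
have intc (m : {finite_measure set (Rd R d) -> \bar R}) (k : R) :
    \int[m]__ k%:E = (k * fine (m setT))%:E.
  by rewrite integral_cst// EFinM fineK// fin_num_measure.
have Knc x y : eball 1 x -> eball 1 y -> Kn x y <= c%:E.
  move=> xB yB; rewrite ge_max lee_fin normr_ge0 andbT leeNl.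
  apply: le_trans (log_kernel_ball T0 xB yB); rewrite -EFinN lee_fin lerNl.
  by rewrite (le_trans (ler_norm _))// normrN.
have step1 x : eball 1 x -> \int[nu]_y Kn x y <= (c * fine (nu setT))%:E.
  move=> xB; rewrite -intc; apply: ae_ge0_le_integral => //.
  - exact: (mK1 x mKn).
  - by apply: filterS (aeb nu nu0) => y yB _; exact: Knc.
rewrite -[leRHS]intc; apply: ae_ge0_le_integral => //.
- by move=> x _; exact: integral_ge0.
- exact: mint.
- by move=> y _; rewrite lee_fin mulr_ge0// fine_ge0.
- by apply: filterS (aeb mu mu0) => x xB _; exact: step1.
Qed.

Lemma energy_ge mu nu : mu (~` eball 1) = 0 -> nu (~` eball 1) = 0 ->
  (- energy_slack mu nu <= energy T mu nu)%R.
Proof.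
move=> mu0 nu0; rewrite /energy.
set I := \int[mu]_x _.
suff : (- energy_slack mu nu)%:E <= I.
  case: I => [s|//|//] /=; first by rewrite lee_fin.
  by move=> _; rewrite oppr_le0 !mulr_ge0// fine_ge0.
rewrite /I integralE EFinN.
rewrite -[leLHS]add0e; apply: leeB; first by apply: integral_ge0.
apply: le_trans (double_neg_le mu0 nu0).
apply: ge0_le_integral => //.
- by apply: measurable_funeneg; exact: measurable_potential.
- exact: mint.
- move=> x _; rewrite funenegE ge_max integral_ge0// andbT integral_log_kernel.
  have : 0 <= \int[nu]_y Kp x y by exact: integral_ge0.
  have : 0 <= \int[nu]_y Kn x y by exact: integral_ge0.
  move: (\int[nu]_y Kp x y) (\int[nu]_y Kn x y) => [p| |] [n| |]//=; rewrite ?lee_fin ?leey ?leNye// => n0 p0; lra.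
Qed.

Lemma energy_le_abs mu nu : \int[mu]_x \int[nu]_y `|K x y| < +oo ->
  (energy T mu nu <= fine (\int[mu]_x \int[nu]_y `|K x y|))%R.
Proof.
move=> fin; rewrite /energy.
have mabs : measurable_fun setT (fun p => `|K p.1 p.2|) by exact: measurableT_comp.
have fin' : \int[mu]_x \int[nu]_y `|K x y| \is a fin_num.
  by rewrite ge0_fin_numE// integral_ge0// => x _; exact: integral_ge0.
have h : `|\int[mu]_x \int[nu]_y K x y| <= \int[mu]_x \int[nu]_y `|K x y|.
  apply: le_trans.
    by apply: le_abse_integral => //; exact: measurable_potential.
  apply: ge0_le_integral => //.
  - by apply: measurableT_comp => //; exact: measurable_potential.
  - exact: mint.
  - by move=> x _; apply: le_abse_integral => //; exact: (mK1 x mK).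
have hf : \int[mu]_x \int[nu]_y K x y \is a fin_num.
  by rewrite fin_num_abs (le_lt_trans h).
exact: (fine_le hf fin' (le_trans (lee_abs _) h)).
Qed.

Lemma abs_energy_le mu nu : mu (~` eball 1) = 0 -> nu (~` eball 1) = 0 ->
  \int[mu]_x \int[nu]_y `|K x y| < +oo ->
  \int[mu]_x \int[nu]_y `|K x y| <= (energy T mu nu + 2 * energy_slack mu nu)%:E.
Proof.
move=> mu0 nu0 fin; have mabs : measurable_fun setT (fun p => `|K p.1 p.2|) by exact: measurableT_comp.
have absE x y : `|K x y| = Kp x y + Kn x y.
  rewrite /Kp /Kn; case: (leP 0 (K x y)) => h.
    by rewrite gee0_abs// max_r ?adde0// oppe_le0.
  by rewrite lte0_abs// max_l ?add0e// oppe_ge0 ltW.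
have inner x : \int[nu]_y `|K x y| = \int[nu]_y Kp x y + \int[nu]_y Kn x y.
  under eq_integral do rewrite absE.
  by rewrite ge0_integralD//; [exact: (mK1 x mKp)|exact: (mK1 x mKn)].
have outer : \int[mu]_x \int[nu]_y `|K x y| =
    \int[mu]_x \int[nu]_y Kp x y + \int[mu]_x \int[nu]_y Kn x y.
  under eq_integral do rewrite inner.
  by rewrite ge0_integralD//; try (exact: mint); move=> x _; exact: integral_ge0.
pose A := \int[mu]_x \int[nu]_y Kp x y; pose B := \int[mu]_x \int[nu]_y Kn x y.
have A0 : 0 <= A by apply: integral_ge0 => x _; exact: integral_ge0.
have B0 : 0 <= B by apply: integral_ge0 => x _; exact: integral_ge0.
have finAB : A + B < +oo by rewrite -outer; exact: fin.
have Afin : A \is a fin_num.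
  by rewrite (ge0_fin_numE A0); exact: le_lt_trans (leeDl A B0) finAB.
have Bfin : B \is a fin_num.
  by rewrite (ge0_fin_numE B0); exact: le_lt_trans (leeDr B A0) finAB.
have iA : mu.-integrable setT (fun x => \int[nu]_y Kp x y).
  apply/integrableP; split; first exact: mint.
  under eq_integral do rewrite gee0_abs ?integral_ge0//.
  by rewrite -(ge0_fin_numE A0); exact: Afin.
have iB : mu.-integrable setT (fun x => \int[nu]_y Kn x y).
  apply/integrableP; split; first exact: mint.
  under eq_integral do rewrite gee0_abs ?integral_ge0//.
  by rewrite -(ge0_fin_numE B0); exact: Bfin.
have EE : energy T mu nu = (fine A - fine B)%R.
  rewrite /energy -(fineB Afin Bfin); congr fine.
  under eq_integral do rewrite integral_log_kernel.
  exact: (integralB measurableT iA iB).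
have := double_neg_le mu0 nu0; rewrite -/B -(fineK Bfin) lee_fin => BC.
rewrite outer -/A -/B -(fineK Afin) -(fineK Bfin) -EFinD lee_fin EE /=.
by rewrite -addrA lerD2l -lerBlDl opprK mulr_natl mulr2n lerD.
Qed.
End log_energy.

Lemma cross_arith (R : realType) (e11 e12 e21 e22 b b1 b2 s1 s2 t1 t2 : R) :
  0 <= e11 - e12 - e21 + e22 -> e11 <= b -> b <= b1 -> e22 <= b2 ->
  - s1 <= e21 -> s1 <= t1 -> s2 <= t2 ->
  e12 + 2 * s2 <= b1 + b2 + (t1 + 2 * t2).
Proof. by move=> *; lra. Qed.

Section cross_energy.
Context {R : realType} {d : nat}.
Variable T : R.
Hypothesis T0 : 0 < T.
Local Notation K := (@log_kernel R d T).
Context {dO : measure_display} {Omega : measurableType dO}.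
Variable P : probability Omega R.
Variable Z : signed_measure R d -> {RV P >-> R}.
Hypothesis hZ : log_field T Z.
Implicit Types mu nu : {finite_measure set (Rd R d) -> \bar R}.

Definition pos_measure mu : signed_measure R d := SignedMeasure mu mzero.

Lemma log_cov_pos mu nu : log_cov T (pos_measure mu) (pos_measure nu) = energy T mu nu.
Proof.
rewrite /log_cov /=.
have e1 m : @energy R d T m mzero = 0.
  by rewrite /energy; under eq_integral do rewrite integral_measure_zero; rewrite integral0.
have e2 m : @energy R d T mzero m = 0 by rewrite /energy integral_measure_zero.
by rewrite !e1 !e2 !subr0 addr0.
Qed.

Lemma admissible_pos mu : finite_energy T mu -> admissible T (pos_measure mu).
Proof.
move=> fmu; split => //; split => //=.
by rewrite integral_measure_zero.
Qed.

(** The variance of a difference of two values of the field is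
    nonnegative. *)
Lemma cross_variance mu nu : finite_energy T mu -> finite_energy T nu ->
  0 <= energy T mu mu - energy T mu nu - energy T nu mu + energy T nu nu.
Proof.
move=> fmu fnu.
pose mm (i : 'I_2) := if i == ord0 then pos_measure mu else pos_measure nu.
pose c (i : 'I_2) : R := if i == ord0 then 1 else -1.
have [|v0 _] := hZ (mu := mm) c.
  by move=> i; rewrite /mm; case: ifP => _; exact: admissible_pos.
apply: le_trans v0 _; rewrite !big_ord_recl !big_ord0 /c /mm /= !log_cov_pos.
by rewrite le_eqVlt; apply/orP; left; apply/eqP; ring.
Qed.

Lemma abs_energy_mrestr_le mu (D : set (Rd R d)) (mD : measurable D) :
  (\int[mrestr mu mD]_x \int[mrestr mu mD]_y `|K x y| <=
   \int[mu]_x \int[mu]_y `|K x y|)%E.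
Proof.
have mabs : measurable_fun setT (fun p : Rd R d * Rd R d => `|K p.1 p.2|%E).
  by apply: measurableT_comp => //; exact: measurable_log_kernel.
have mabs1 x : measurable_fun setT (fun y => `|K x y|%E).
  exact: (measurableT_comp mabs (pair1_measurable x)).
have le_restr (f : Rd R d -> \bar R) : measurable_fun setT f -> (forall x, 0 <= f x)%E ->
    (\int[mrestr mu mD]_x f x <= \int[mu]_x f x)%E.
  move=> mf f0; rewrite ge0_integral_mrestr//.
  have mi : measurable_fun setT (\1_D : Rd R d -> R) by exact: measurable_indic.
  apply: ge0_le_integral => //.
  - by move=> u _; rewrite mule_ge0// lee_fin.
  - by apply: emeasurable_funM => //; exact/measurable_EFinP.
  - by move=> u _; rewrite -[leRHS]mule1 lee_wpmul2l// lee_fin indicE; case: (_ \in _).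
apply: le_trans.
  apply: le_restr.
    exact: (measurable_fun_fubini_tonelli_F (m2 := mrestr mu mD) _ mabs).
  by move=> x; exact: integral_ge0.
apply: ge0_le_integral => //.
- by move=> u _; exact: integral_ge0.
- exact: (measurable_fun_fubini_tonelli_F (m2 := mrestr mu mD) _ mabs).
- exact: (measurable_fun_fubini_tonelli_F (m2 := mu) _ mabs).
- by move=> x _; exact: le_restr.
Qed.

Lemma finite_energy_mrestr mu (D : set (Rd R d)) (mD : measurable D) :
  finite_energy T mu -> finite_energy T (mrestr mu mD).
Proof.
move=> [mu0 mufin]; split; last first.
  exact: le_lt_trans (abs_energy_mrestr_le mu mD) mufin.
apply/eqP; rewrite eq_le measure_ge0 andbT -mu0.
change (mu (~` eball 1 `&` D) <= mu (~` eball 1))%E.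
have mB : measurable (~` (eball 1 : set (Rd R d))) by apply: measurableC; exact: measurable_eball.
by apply: le_measure; rewrite ?inE//; exact: measurableI.
Qed.

(** The part of [mu] where the potential of [nu] is at most [n] has a
    finite mutual energy with [nu], and the nonnegativity of variances
    bounds it independently of [n]; as the potential of [nu] is finite
    everywhere, these parts exhaust [mu]. *)
Lemma cross_energy_lty mu nu : finite_energy T mu -> finite_energy T nu ->
  (forall x, \int[nu]_y `|K x y| < +oo)%E ->
  (\int[mu]_x \int[nu]_y `|K x y| < +oo)%E.
Proof.
move=> fmu fnu potfin.
have mabs : measurable_fun setT (fun p : Rd R d * Rd R d => `|K p.1 p.2|%E).
  by apply: measurableT_comp => //; exact: measurable_log_kernel.
pose U x := (\int[nu]_y `|K x y|)%E.
have mU : measurable_fun setT U.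
  exact: (measurable_fun_fubini_tonelli_F (m2 := nu) _ mabs).
have U0 x : (0 <= U x)%E by exact: integral_ge0.
pose D (n : nat) : set (Rd R d) := [set x | (U x <= n%:R%:E)%E].
have mD n : measurable (D n).
  rewrite (_ : D n = setT `&` U @^-1` [set y | (y <= n%:R%:E)%E]).
    by apply: emeasurable_fun_infty_c.
  by rewrite setTI.
pose mun n : {finite_measure set (Rd R d) -> \bar R} := mrestr mu (mD n).
have funn n : finite_energy T (mun n) by exact: finite_energy_mrestr.
have munT n : (mun n setT <= mu setT)%E.
  change (mu (setT `&` D n) <= mu setT)%E.
  by apply: le_measure; rewrite ?inE//; exact: measurableI.
have fin_mass (m : {finite_measure set (Rd R d) -> \bar R}) : m setT \is a fin_num.
  exact: fin_num_measure.
have intU n : (\int[mun n]_x U x = \int[mu]_x (U x * (\1_(D n) x)%:E))%E.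
  by rewrite ge0_integral_mrestr.
pose B1 := fine (\int[mu]_x \int[mu]_y `|K x y|)%E.
pose B2 := fine (\int[nu]_x \int[nu]_y `|K x y|)%E.
pose S := energy_slack T nu mu + 2 * energy_slack T mu nu.
have slack_le n : energy_slack T nu (mun n) <= energy_slack T nu mu /\
    energy_slack T (mun n) nu <= energy_slack T mu nu.
  have h : fine (mun n setT) <= fine (mu setT) by apply: fine_le.
  rewrite /energy_slack; split.
    by rewrite ler_wpM2r ?fine_ge0// ler_wpM2l.
  by rewrite ler_wpM2l// mulr_ge0// fine_ge0.
have bound n : (\int[mun n]_x U x <= (B1 + B2 + S)%:E)%E.
  have fin : (\int[mun n]_x U x < +oo)%E.
    apply: (@le_lt_trans _ _ (\int[mu]__ n%:R%:E)%E).
      rewrite intU; apply: ge0_le_integral => //.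
      - by move=> x _; rewrite mule_ge0// lee_fin.
      - apply: emeasurable_funM => //; apply/measurable_EFinP.
        exact: measurable_indic.
      - move=> x _; rewrite indicE; case: (boolP (x \in D n)) => [/set_mem Dx|_].
          by rewrite mule1.
        by rewrite mule0 lee_fin.
    by rewrite integral_cst// lte_mul_pinfty// ltey_eq fin_mass.
  have [s1 s2] := slack_le n.
  have := abs_energy_le T0 (funn n).1 fnu.1 fin.
  move/le_trans; apply; rewrite lee_fin.
  have := cross_variance (funn n) fnu.
  have e1 := energy_le_abs (funn n).2.
  have e2 := energy_le_abs fnu.2.
  have e3 := energy_ge T0 fnu.1 (funn n).1.
  have e4 : fine (\int[mun n]_x \int[mun n]_y `|K x y|)%E <= B1.
    apply: fine_le.
    - by rewrite ge0_fin_numE ?(funn n).2// integral_ge0// => x _; exact: integral_ge0.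
    - by rewrite ge0_fin_numE ?fmu.2// integral_ge0// => x _; exact: integral_ge0.
    - exact: abs_energy_mrestr_le.
  move=> e0; exact: (cross_arith e0 e1 e4 e2 e3 s1 s2).
have cvgU : (\int[mu]_x (U x * (\1_(D n) x)%:E) @[n --> \oo] --> \int[mu]_x U x)%E.
  have nd x : {homo (fun n => U x * (\1_(D n) x)%:E)%E : m n / (m <= n)%N >-> (m <= n)%E}.
    move=> m n mn; apply: lee_wpmul2l => //; rewrite lee_fin !indicE.
    case: (boolP (x \in D m)) => //= /set_mem Dx.
    rewrite mem_set//; rewrite /D/= in Dx *; apply: le_trans Dx _.
    by rewrite lee_fin ler_nat.
  have Ulim x : (U x * (\1_(D n) x)%:E)%E @[n --> \oo] --> U x.
    have Ufin : U x \is a fin_num by rewrite ge0_fin_numE// potfin.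
    apply: cvg_near_cst; near=> n; rewrite indicE mem_set ?mule1//.
    rewrite /D/= -(fineK Ufin) lee_fin; near: n; exact: nbhs_infty_ger.
  rewrite [X in _ --> X](_ : _ = \int[mu]_x limn (fun n => (U x * (\1_(D n) x)%:E)%E))%E.
    apply: cvg_monotone_convergence => //.
    - move=> n; apply: emeasurable_funM => //; apply/measurable_EFinP.
      exact: measurable_indic.
    - by move=> n x _; rewrite mule_ge0// lee_fin.
  by apply: eq_integral => x _; apply/esym/cvg_lim.
apply: (@le_lt_trans _ _ (B1 + B2 + S)%:E); last exact: ltry.
rewrite -(cvg_lim _ cvgU)//; apply: lime_le; first by apply/cvg_ex; exists (\int[mu]_x U x)%E.
by apply: nearW => n; rewrite -intU; exact: bound.
Unshelve. all: by end_near. Qed.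
End cross_energy.

Lemma integral_probability_le d (T : measurableType d) (R : realType)
    (P : probability T R) (f : T -> \bar R) (C : R) :
  measurable_fun setT f -> 0 <= C -> {ae P, forall x, (f x <= C%:E)%E} ->
  (\int[P]_x f x <= C%:E)%E.
Proof.
move=> mf C0 fC; rewrite integralE.
have mp : measurable_fun setT f^\+%E by exact: measurable_funepos.
apply: (@le_trans _ _ (\int[P]_x f^\+ x)%E).
  by rewrite -[leRHS]adde0; apply: leeD => //; rewrite oppe_le0; exact: integral_ge0.
rewrite -[leRHS](integral_probability_cst P).
apply: ae_ge0_le_integral => //.
by apply: filterS fC => x fxC _; rewrite funeposE ge_max fxC lee_fin.
Qed.

Section mollified_covariance.
Context {R : realType} {d : nat}.
Implicit Types x y z u v : Rd R d.
Variable T : R.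
Hypothesis T0 : 0 < T.
Local Notation K := (@log_kernel R d T).
Variable theta : probability (Rd R d) R.
Hypothesis htheta : mollifier theta.
Local Notation mol := (theta_eps theta).

Lemma theta_ae_unit : {ae theta, forall u, edist u origin <= 1}.
Proof.
have [h _ _] := htheta; exists [set u | 1 < edist u origin]; split => //.
  rewrite (_ : [set u | _] = (fun u => edist u origin) @^-1` `]1, +oo[%classic).
    by rewrite -[X in measurable X]setTI; apply: (measurable_edist origin).
  by apply/seteqP; split => u /=; rewrite in_itv/= andbT.
by move=> u /= /negP; rewrite -ltNge.
Qed.

Lemma reflect_scale_ball e x u : 0 < e -> eball (1 - e) x -> edist u origin <= 1 ->
  eball 1 (reflect_scale e x u).
Proof.
move=> e0 xe u1; rewrite /eball/=; apply: le_lt_trans (edist_triangle x _ _) _.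
rewrite edist_reflect ?(ltW e0)//.
have : edist x origin < 1 - e by [].
have : e * edist u origin <= e by rewrite ler_piMr// ltW.
by move: (e * _) (edist x _) => p n; lra.
Qed.

(** Far enough from the boundary the truncation to the unit ball has no
    effect, and only there is the covariance exactly additive under
    dilations. *)
Lemma theta_eps_untruncated e x A : 0 < e -> eball (1 - e) x -> measurable A ->
  mol e x A = distribution theta (reflect_scale e x) A.
Proof.
move=> e0 xe mA; have [N [mN N0 subN]] := theta_ae_unit.
change (theta (reflect_scale e x @^-1` (A `&` eball 1)) = theta (reflect_scale e x @^-1` A)).
have mpre B : measurable B -> measurable (reflect_scale e x @^-1` B).
  move=> mB; rewrite -[X in measurable X]setTI.
  by apply: (measurable_reflect_scale e x).
have mAB : measurable (A `&` (eball 1 : set (Rd R d))).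
  by apply: measurableI => //; exact: measurable_eball.
apply/eqP; rewrite eq_le; apply/andP; split.
  by apply: le_measure; rewrite ?inE; [exact: mpre|exact: mpre|move=> u []].
rewrite -[leRHS]adde0 -N0.
apply: (@le_trans _ _ (theta (reflect_scale e x @^-1` (A `&` eball 1) `|` N))).
  apply: le_measure; rewrite ?inE; [exact: mpre|apply: measurableU => //; exact: mpre|].
  move=> u Au; have [u1|u1] := leP (edist u origin) 1.
    by left; split => //; exact: reflect_scale_ball.
  by right; apply: subN => /=; apply/negP; rewrite -ltNge.
by apply: measureU2 => //; exact: mpre.
Qed.

Lemma integral_theta_eps e x (f : Rd R d -> \bar R) : 0 < e -> eball (1 - e) x ->
  measurable_fun setT f ->
  (\int[mol e x]_z f z = \int[theta]_u f (reflect_scale e x u))%E.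
Proof.
move=> e0 xe mf.
rewrite (eq_measure_integral (distribution theta (reflect_scale e x))); last first.
  by move=> A mA _; exact: theta_eps_untruncated.
rewrite [LHS]integralE [RHS]integralE; congr (_ - _)%E.
- rewrite ge0_integral_distribution//; last exact: measurable_funepos.
  by apply: eq_integral => u _; rewrite /= !funeposE.
- rewrite ge0_integral_distribution//; last exact: measurable_funeneg.
  by apply: eq_integral => u _; rewrite /= !funenegE.
Qed.

Lemma energy_theta_eps e x e' y : 0 < e -> eball (1 - e) x -> 0 < e' -> eball (1 - e') y ->
  energy T (mol e x) (mol e' y) =
  fine (\int[theta]_u \int[theta]_v K (reflect_scale e x u) (reflect_scale e' y v))%E.
Proof.
move=> e0 xe e'0 ye; rewrite /energy; congr fine.
rewrite (integral_theta_eps e0 xe (measurable_potential T (mol e' y))).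
apply: eq_integral => u _.
exact: (integral_theta_eps e'0 ye (measurable_log_kernel1 T _)).
Qed.

(** Used for points that stay away from each other, where the kernel is
    bounded. *)
Lemma energy_theta_eps_le e x e' y (C : R) : 0 < e -> eball (1 - e) x ->
  0 < e' -> eball (1 - e') y -> 0 <= C ->
  (forall u v, edist u origin <= 1 -> edist v origin <= 1 ->
     (K (reflect_scale e x u) (reflect_scale e' y v) <= C%:E)%E) ->
  energy T (mol e x) (mol e' y) <= C.
Proof.
move=> e0 xe e'0 ye C0 KC; rewrite energy_theta_eps//.
set I := (X in fine X).
suff : (I <= C%:E)%E by case: I => //= s; rewrite lee_fin.
have mKi u : measurable_fun setT (fun v => K (reflect_scale e x u) (reflect_scale e' y v)).
  exact: (measurableT_comp (measurable_log_kernel1 T _) (measurable_reflect_scale e' y)).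
apply: integral_probability_le => //.
  have h := measurable_potential T (mol e' y).
  have -> : (fun u => \int[theta]_v K (reflect_scale e x u) (reflect_scale e' y v))%E =
      (fun u => \int[mol e' y]_z K (reflect_scale e x u) z)%E.
    apply/funext => u; symmetry; exact: (integral_theta_eps e'0 ye (measurable_log_kernel1 T _)).
  exact: (measurableT_comp h (measurable_reflect_scale e x)).
apply: filterS theta_ae_unit => u u1.
apply: integral_probability_le => //.
by apply: filterS theta_ae_unit => v v1; exact: KC.
Qed.

Context {dO : measure_display} {Omega : measurableType dO}.
Variable P : probability Omega R.
Variable Z : signed_measure R d -> {RV P >-> R}.
Hypothesis hZ : log_field T Z.

(** The mollified measure at scale [r e] around [r x] is the dilation of
    the one at scale [e] around [x]. *)
Lemma energy_theta_eps_scale r e x y : 0 < r <= 1 -> 0 < e ->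
  eball (1 - e) x -> eball (1 - e) y ->
  energy T (mol (r * e) (scale r x)) (mol (r * e) (scale r y)) =
  ln r^-1 + energy T (mol e x) (mol e y).
Proof.
move=> /andP[r0 r1] e0 xe ye.
have re0 : 0 < r * e by rewrite mulr_gt0.
have inball z : eball (1 - e) z -> eball (1 - r * e) (scale r z).
  move=> ze; have : eball (r * (1 - e)) (scale r z) by apply/eball_scale.
  rewrite /eball/= => /lt_le_trans; apply.
  by rewrite mulrBr mulr1 lerD2r.
rewrite !energy_theta_eps//; try exact: inball.
have mKi u : measurable_fun setT (fun v => K (reflect_scale e x u) (reflect_scale e y v)).
  exact: (measurableT_comp (measurable_log_kernel1 T _) (measurable_reflect_scale e y)).
have ii u : theta.-integrable setT (fun v => K (reflect_scale e x u) (reflect_scale e y v)).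
  by apply/integrableP; split => //; exact: (potential_theta_lty T0).
pose g u := (\int[theta]_v K (reflect_scale e x u) (reflect_scale e y v))%E.
have inner u : (\int[theta]_v K (reflect_scale (r * e) (scale r x) u) (reflect_scale (r * e) (scale r y) v) =
    (ln r^-1)%:E + g u)%E.
  under eq_integral do rewrite !reflect_scale_scale log_kernel_scale//.
  rewrite integralD//; last exact: finite_measure_integrable_cst.
  by rewrite integral_probability_cst.
rewrite (eq_integral (fun u => (ln r^-1)%:E + g u)%E); last by move=> u _; exact: inner.
have gE u : g u = (\int[mol e y]_z K (reflect_scale e x u) z)%E.
  by symmetry; exact: (integral_theta_eps e0 ye (measurable_log_kernel1 T _)).
have mg : measurable_fun setT g.
  rewrite (funext gE).
  exact: (measurableT_comp (measurable_potential T (mol e y)) (measurable_reflect_scale e x)).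
have ig : theta.-integrable setT g.
  apply/integrableP; split => //.
  have mabs : measurable_fun setT (fun p : Rd R d * Rd R d => `|K p.1 p.2|%E).
    by apply: measurableT_comp => //; exact: measurable_log_kernel.
  have mabs1 a : measurable_fun setT (fun y => `|K a y|%E).
    exact: (measurableT_comp mabs (pair1_measurable a)).
  have mpot := measurable_fun_fubini_tonelli_F (m2 := mol e y) _ mabs (fun _ => abse_ge0 _).
  have : (\int[mol e x]_z \int[mol e y]_z' `|K z z'| < +oo)%E.
    apply: (cross_energy_lty T0 hZ); [exact: theta_eps_finite_energy..|].
    move=> z; rewrite (integral_theta_eps e0 ye (mabs1 z)); exact: (potential_theta_lty T0).
  rewrite (integral_theta_eps e0 xe mpot).
  move=> fin; apply: (le_lt_trans _ fin) => {fin}.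
  apply: ge0_le_integral.
  - exact: measurableT.
  - by move=> u _; exact: abse_ge0.
  - by apply: measurableT_comp => //; exact: mg.
  - exact: (measurableT_comp mpot (measurable_reflect_scale e x)).
  - move=> u _; rewrite gE; apply: le_abse_integral => //.
    exact: measurable_log_kernel1.
rewrite integralD//; last exact: finite_measure_integrable_cst.
rewrite integral_probability_cst fineD//; exact: integrable_fin_num.
Qed.

End mollified_covariance.

(** * The regularized field and its chaos *)

(** The regularization is a measurable version of the field, equal to it
    almost surely at each point; laws do not see the difference. *)
Lemma centered_gaussian_ae (R : realType) dO (Omega : measurableType dO)
    (P : probability Omega R) (X X' : Omega -> R) (v : R) :
  measurable_fun setT X -> measurable_fun setT X' ->
  {ae P, forall w, X w = X' w} ->
  centered_gaussian P X' v -> centered_gaussian P X v.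
Proof.
move=> mX mX' XX' [v0 law]; split=> // A mA; rewrite -(law A mA).
have mpre (X0 : Omega -> R) : measurable_fun setT X0 -> measurable (X0 @^-1` A).
  by move=> mX0; rewrite -[X in measurable X]setTI; exact: mX0.
have E (X0 : Omega -> R) : measurable_fun setT X0 ->
    P (X0 @^-1` A) = (\int[P]_w (\1_(X0 @^-1` A) w)%:E)%E.
  by move=> mX0; rewrite integral_indic ?setIT//; exact: mpre.
rewrite (E X mX) (E X' mX'); apply: ae_eq_integral => //.
- by apply/measurable_EFinP; apply: measurable_indic; exact: mpre.
- by apply/measurable_EFinP; apply: measurable_indic; exact: mpre.
- apply: filterS XX' => w XX'w _; congr EFin; rewrite !indicE; congr (nat_of_bool _)%:R.
  have e (X0 : Omega -> R) : (w \in X0 @^-1` A) = (X0 w \in A).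
    by apply/idP/idP => /set_mem h; exact/mem_set.
  by rewrite !e XX'w.
Qed.

Section regularized_field.
Context {R : realType} {d : nat}.
Variable T : R.
Hypothesis T0 : 0 < T.
Context {dO : measure_display} {Omega : measurableType dO}.
Variable P : probability Omega R.
Variable Z : signed_measure R d -> {RV P >-> R}.
Hypothesis hZ : log_field T Z.
Variable theta : probability (Rd R d) R.
Hypothesis htheta : mollifier theta.
Variable Y : R -> Rd R d * Omega -> R.
Hypothesis hY : regularization Z theta Y.

(** A scale and a point, so that values of the field at several scales
    appear in one linear combination. *)
Definition reg_index := (R * Rd R d)%type.
Implicit Types (i j : reg_index) (s : seq (R * reg_index)).

Definition reg_value i (w : Omega) : R := Y i.1 (i.2, w).

Definition reg_dom : set reg_index := [set i | 0 < i.1 /\ eball 1 i.2].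

Definition reg_cov i j : R := energy T (theta_eps theta i.1 i.2) (theta_eps theta j.1 j.2).

Definition reg_var s : R := \sum_(p <- s) \sum_(q <- s) p.1 * q.1 * reg_cov p.2 q.2.

Lemma measurable_reg_value i : 0 < i.1 -> measurable_fun setT (reg_value i).
Proof.
move=> e0; have [mY _] := hY e0.
exact: (measurableT_comp mY (pair1_measurable i.2)).
Qed.

Lemma measurable_reg_lincomb s : List.Forall (fun p => reg_dom p.2) s ->
  measurable_fun setT (lincomb reg_value s).
Proof.
rewrite /lincomb; elim=> [|p s' [p0 _] _ IH].
  by under eq_fun do rewrite big_nil; exact: measurable_cst.
under eq_fun do rewrite big_cons; apply: measurable_funD => //.
by apply: measurable_funM => //; exact: measurable_reg_value.
Qed.

Lemma reg_lincomb_gaussian s : List.Forall (fun p => reg_dom p.2) s ->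
  centered_gaussian P (lincomb reg_value s) (reg_var s).
Proof.
move=> sD.
pose n := size s.
have Dn (i : 'I_n) : reg_dom (tnth (in_tuple s) i).2.
  have : forall p, List.In p s -> reg_dom p.2 by apply/List.Forall_forall.
  apply; rewrite (tnth_nth (0, (0, origin)))/=.
  have : (i < size s)%N by [].
  elim: (s) (nat_of_ord i) => [//|p s' IH] [|k]/=; first by left.
  by rewrite ltnS => ks; right; exact: IH.
pose mu (i : 'I_n) := mollifier_at theta (tnth (in_tuple s) i).2.1 (tnth (in_tuple s) i).2.2.
pose c (i : 'I_n) := (tnth (in_tuple s) i).1.
have adm (i : 'I_n) : admissible T (mu i).
  by apply: admissible_pos; apply: (theta_eps_finite_energy T0 htheta); case: (Dn i).
have := hZ c adm.
have -> : \sum_(i < n) \sum_(j < n) c i * c j * log_cov T (mu i) (mu j) = reg_var s.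
  rewrite /reg_var [RHS]big_tnth; apply: eq_bigr => i _.
  rewrite [RHS]big_tnth; apply: eq_bigr => j _.
  by congr (_ * _); exact: log_cov_pos.
apply: centered_gaussian_ae.
- exact: measurable_reg_lincomb.
- by apply: measurable_sum => i; exact: measurable_funM.
- have aei (i : 'I_n) : {ae P, forall w, reg_value (tnth (in_tuple s) i).2 w = Z (mu i) w}.
    by have [e0 xB] := Dn i; have [_ h] := hY e0; exact: h.
  have : {ae P, forall w, forall i : 'I_n, reg_value (tnth (in_tuple s) i).2 w = Z (mu i) w}.
    exact: filter_forall.
  apply: filterS => w h.
  by rewrite /lincomb [LHS]big_tnth; apply: eq_bigr => i _; rewrite h.
Qed.

Lemma reg_gaussian i : reg_dom i -> centered_gaussian P (reg_value i) (reg_cov i i).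
Proof.
move=> iD; have := reg_lincomb_gaussian (s := [:: (1, i)]).
rewrite /reg_var !big_seq1 !mul1r /= => h.
have -> : reg_value i = lincomb reg_value [:: (1, i)].
  by apply/funext => w; rewrite /lincomb big_seq1 mul1r.
by apply: h; exact: List.Forall_cons.
Qed.

Lemma reg_char s c0 : List.Forall (fun p => reg_dom p.2) s ->
  \int[P]_w cos (lincomb reg_value s w + c0) = cos c0 * expR (- (reg_var s / 2)).
Proof.
move=> sD; apply: gaussian_char; first exact: measurable_reg_lincomb.
exact: reg_lincomb_gaussian.
Qed.

End regularized_field.

Section chaos_mass.
Context {R : realType} {d : nat}.
Variable T : R.
Hypothesis T0 : 0 < T.
Context {dO : measure_display} {Omega : measurableType dO}.
Variable P : probability Omega R.
Variable Z : signed_measure R d -> {RV P >-> R}.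
Hypothesis hZ : log_field T Z.
Variable theta : probability (Rd R d) R.
Hypothesis htheta : mollifier theta.
Variable Y : R -> Rd R d * Omega -> R.
Hypothesis hY : regularization Z theta Y.
Variable gamma : R.
Local Notation leb := (lebesgue_measureT R d).
Local Notation cov := (reg_cov T theta).
Local Notation val := (reg_value Y).

(** In the form that the definition of the chaos uses, which is measurable
    in [x]; [reg_varianceE] identifies it with an energy. *)
Definition reg_variance e x : R := fine 'E_P[fun w => Y e (x, w) ^+ 2].

Lemma reg_varianceE e x : 0 < e -> eball 1 x -> reg_variance e x = cov (e, x) (e, x).
Proof.
move=> e0 xB; rewrite /reg_variance unlock.
have := gaussian_variance (measurable_reg_value hY (i := (e, x)) e0)
  (reg_gaussian T0 hZ htheta hY (i := (e, x)) (conj e0 xB)).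
by move=> /= ->.
Qed.

Lemma measurable_reg_variance e : 0 < e -> measurable_fun setT (reg_variance e).
Proof.
move=> e0; have [mY _] := hY e0.
apply: measurableT_comp; first exact: fine_measurable.
rewrite (_ : (fun x => _) = fun x => (\int[P]_w (Y e (x, w) ^+ 2)%:E)%E).
  apply: (measurable_fun_fubini_tonelli_F (m2 := P) (fun z => (Y e z ^+ 2)%:E)).
    by apply/measurable_EFinP; exact: measurable_funX.
  by move=> z; rewrite lee_fin sqr_ge0.
by apply/funext => x; rewrite unlock.
Qed.

(** The normalization of the chaos does not depend on the outcome; it is
    kept apart so that the mass is an [exp_mass]. *)
Definition chaos_weight e (A : set (Rd R d)) x : R :=
  \1_A x * expR (- (gamma ^+ 2 / 2 * reg_variance e x)).

Lemma chaos_weight_ge0 e A x : 0 <= chaos_weight e A x.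
Proof. by rewrite mulr_ge0 ?expR_ge0. Qed.

Lemma measurable_chaos_weight e A : 0 < e -> measurable A ->
  measurable_fun setT (chaos_weight e A).
Proof.
move=> e0 mA; apply: measurable_funM; first exact: measurable_indic.
apply: measurableT_comp => //; apply: measurableT_comp => //.
by apply: measurable_funM => //; exact: measurable_reg_variance.
Qed.

Lemma integrable_indic_ball (A : set (Rd R d)) : measurable A -> A `<=` eball 1 ->
  leb.-integrable setT (EFin \o (\1_A : Rd R d -> R)).
Proof.
move=> mA AB; apply/integrableP; split.
  by apply/measurable_EFinP; exact: measurable_indic.
under eq_integral do rewrite /= ger0_norm//.
rewrite integral_indic// setIT.
apply: le_lt_trans (@lebesgueT_eball_lty R d).
by apply: le_measure; rewrite ?inE//; exact: measurable_eball.
Qed.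

Lemma reg_variance_ge0 e x : 0 <= reg_variance e x.
Proof.
apply: fine_ge0; rewrite unlock; apply: integral_ge0 => w _.
by rewrite lee_fin sqr_ge0.
Qed.

Lemma integrable_chaos_weight e A : 0 < e -> measurable A -> A `<=` eball 1 ->
  leb.-integrable setT (EFin \o chaos_weight e A).
Proof.
move=> e0 mA AB; apply: (@integrable_le _ _ _ leb _ (\1_A)).
- exact: measurable_chaos_weight.
- move=> x; rewrite ger0_norm ?chaos_weight_ge0// ler_piMr// -expR0 ler_expR.
  by rewrite oppr_le0 mulr_ge0 ?reg_variance_ge0// divr_ge0// sqr_ge0.
- exact: integrable_indic_ball.
Qed.

Definition chaos_mass e A : Omega -> R :=
  exp_mass leb gamma (chaos_weight e A) (fun x => val (e, x)).

Lemma chaos_integrandE e A x w :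
  chaos_weight e A x * expR (gamma * val (e, x) w) =
  \1_A x * expR (gamma * Y e (x, w) - gamma ^+ 2 / 2 * reg_variance e x).
Proof. by rewrite /chaos_weight -[LHS]mulrA -expRD (addrC (- _)). Qed.

Lemma measurable_chaos_integrand e A : 0 < e -> measurable A ->
  measurable_fun setT (fun z : Rd R d * Omega =>
    chaos_weight e A z.1 * expR (gamma * val (e, z.1) z.2)).
Proof.
move=> e0 mA; have [mY _] := hY e0.
apply: measurable_funM.
  exact: (measurableT_comp (measurable_chaos_weight e0 mA) measurable_fst).
apply: measurableT_comp => //; apply: measurable_funM => //.
rewrite (_ : (fun x => _) = Y e)//.
by apply/funext => -[].
Qed.

Lemma chaos_approxE e A w : measurable A ->
  chaos_approx P gamma Y e A w =
  (\int[leb]_x (chaos_weight e A x * expR (gamma * val (e, x) w))%:E)%E.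
Proof.
move=> mA; rewrite /chaos_approx integral_mkcond; apply: eq_integral => x _.
rewrite chaos_integrandE patchE indicE; case: (x \in A).
  by rewrite mul1r.
by rewrite mul0r.
Qed.

Lemma chaos_massE e A w : measurable A ->
  chaos_mass e A w = fine (chaos_approx P gamma Y e A w).
Proof. by move=> mA; rewrite chaos_approxE. Qed.

(** The normalization makes the integrand a probability density, which is
    used both for the mean of the chaos and for tilting. *)
Lemma reg_tilt_mean e x : 0 < e -> eball 1 x ->
  (\int[P]_w (expR (gamma * Y e (x, w) - gamma ^+ 2 / 2 * reg_variance e x))%:E = 1)%E.
Proof.
move=> e0 xB; have mv := measurable_reg_value hY (i := (e, x)) e0.
under eq_integral do rewrite expRD EFinM.
rewrite ge0_integralZr//; last by apply/measurable_EFinP; apply: measurableT_comp => //; exact: measurable_funM.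
have := gaussian_mgf mv (reg_gaussian T0 hZ htheta hY (i := (e, x)) (conj e0 xB)) gamma.
rewrite /reg_value /= => ->; rewrite -EFinM -expRD -(reg_varianceE e0 xB).
by rewrite mulrAC subrr expR0.
Qed.

(** Tonelli and [reg_tilt_mean]; it is what makes the mass finite almost
    surely. *)
Lemma chaos_mean e A : 0 < e -> measurable A -> A `<=` eball 1 ->
  (\int[P]_w chaos_approx P gamma Y e A w = leb A)%E.
Proof.
move=> e0 mA AB.
under eq_integral do rewrite chaos_approxE//.
have mf := measurable_chaos_integrand e0 mA.
rewrite -(fubini_tonelli (m1 := leb) (m2 := P) (fun z : Rd R d * Omega =>
    (chaos_weight e A z.1 * expR (gamma * val (e, z.1) z.2))%:E)).
- rewrite -[in RHS](setIT A) -integral_indic//; apply: eq_integral => x _ /=.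
  under eq_integral do rewrite chaos_integrandE EFinM.
  rewrite indicE; case: (boolP (x \in A)) => [/set_mem/AB xB|_].
    by under eq_integral do rewrite mul1e; rewrite reg_tilt_mean.
  by under eq_integral do rewrite mul0e; rewrite integral0.
- exact/measurable_EFinP.
- by move=> z; rewrite lee_fin mulr_ge0 ?chaos_weight_ge0 ?expR_ge0.
Qed.

Lemma chaos_integrable_ae e A : 0 < e -> measurable A -> A `<=` eball 1 ->
  {ae P, forall w, leb.-integrable setT
    (EFin \o (fun x => chaos_weight e A x * expR (gamma * val (e, x) w)))}.
Proof.
move=> e0 mA AB; have mf := measurable_chaos_integrand e0 mA.
apply: (ae_integrable2 (m1 := leb) (m2 := P) (f := fun z : Rd R d * Omega =>
    (chaos_weight e A z.1 * expR (gamma * val (e, z.1) z.2))%:E)).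
apply/integrable21ltyP; first exact/measurable_EFinP.
rewrite (eq_integral (fun w => chaos_approx P gamma Y e A w)); last first.
  move=> w _; rewrite chaos_approxE//; apply: eq_integral => x _ /=.
  by rewrite ger0_norm// mulr_ge0 ?chaos_weight_ge0 ?expR_ge0.
rewrite chaos_mean//; apply: le_lt_trans (@lebesgueT_eball_lty R d).
by apply: le_measure; rewrite ?inE//; exact: measurable_eball.
Qed.

Lemma chaos_approx_fin_ae e A : 0 < e -> measurable A -> A `<=` eball 1 ->
  {ae P, forall w, chaos_approx P gamma Y e A w = (chaos_mass e A w)%:E}.
Proof.
move=> e0 mA AB; apply: filterS (chaos_integrable_ae e0 mA AB) => w iw.
by rewrite chaos_massE// fineK// chaos_approxE//; exact: integrable_fin_num.
Qed.

Lemma measurable_chaos_mass e A : 0 < e -> measurable A ->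
  measurable_fun setT (chaos_mass e A).
Proof.
move=> e0 mA; apply: measurable_exp_mass.
- by move=> x; exact: chaos_weight_ge0.
- exact: measurable_chaos_weight.
- have [mY _] := hY e0; rewrite (_ : (fun x => _) = Y e)//.
  by apply/funext => -[].
Qed.

Lemma chaos_mass_ge0 e A w : 0 <= chaos_mass e A w.
Proof. by apply: exp_mass_ge0 => x; exact: chaos_weight_ge0. Qed.

End chaos_mass.

(** * Scaling of the regularized chaos *)

Section chaos_scaling.
Context {R : realType} {d : nat}.
Variable T : R.
Hypothesis T0 : 0 < T.
Context {dO : measure_display} {Omega : measurableType dO}.
Variable P : probability Omega R.
Variable Z : signed_measure R d -> {RV P >-> R}.
Hypothesis hZ : log_field T Z.
Variable theta : probability (Rd R d) R.
Hypothesis htheta : mollifier theta.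
Variable Y : R -> Rd R d * Omega -> R.
Hypothesis hY : regularization Z theta Y.
Variable gamma : R.
Local Notation leb := (lebesgue_measureT R d).
Local Notation cov := (reg_cov T theta).
Local Notation val := (reg_value Y).
Local Notation mass := (chaos_mass P Y gamma).

Implicit Types x y : Rd R d.
Variables (r rho e : R).
Hypothesis r01 : 0 < r < 1.
Hypothesis rho0 : 0 < rho.
Hypothesis e0 : 0 < e.
Hypothesis rhoe : rho <= 1 - e.

Let l := ln r^-1.
Let r0 : 0 < r. Proof. by case/andP: r01. Qed.
Let re0 : 0 < r * e. Proof. by rewrite mulr_gt0. Qed.
Let l0 : 0 < l.
Proof. by rewrite ln_gt0// invf_gt1//; case/andP: r01. Qed.
Let s := Num.sqrt l.
Let s0 : s != 0. Proof. by rewrite gt_eqF// sqrtr_gt0. Qed.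
Let s2 : s ^+ 2 = l. Proof. by rewrite sqr_sqrtr// ltW. Qed.

Let ball_e x : eball rho x -> eball (1 - e) x.
Proof. by rewrite /eball/= => /lt_le_trans; apply. Qed.

Let ball_1 x : eball rho x -> eball 1 x.
Proof. by move=> /ball_e; rewrite /eball/= => /lt_le_trans; apply; rewrite gerBl ltW. Qed.

Let ball_scale x : eball rho x -> eball 1 (scale r x).
Proof.
move=> /ball_1 x1; have : eball (r * 1) (scale r x) by apply/eball_scale.
by rewrite /eball/= => /lt_le_trans; apply; rewrite mulr1 ltW//; case/andP: r01.
Qed.

(** Both points lie where the mollified measures are not truncated, at
    both scales. *)
Lemma reg_cov_scale x y : eball rho x -> eball rho y ->
  cov (r * e, scale r x) (r * e, scale r y) = l + cov (e, x) (e, y).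
Proof.
move=> xr yr; apply: (energy_theta_eps_scale T0 htheta hZ) => //.
- by rewrite r0 ltW//; case/andP: r01.
- exact: ball_e.
- exact: ball_e.
Qed.

Let nu := normal_prob 0 s.
Let X1 x w := val (r * e, scale r x) w.
Let X2 x (z : Omega * measurableTypeR R) := val (e, x) z.1 + z.2.

Let mY e' : 0 < e' -> measurable_fun setT (Y e').
Proof. by move=> /hY[]. Qed.

Let mX1 : measurable_fun setT (fun z : Rd R d * Omega => X1 z.1 z.2).
Proof.
apply: (measurableT_comp (mY re0) (g := fun z : Rd R d * Omega => (scale r z.1, z.2))).
apply: measurable_fun_pair => //; exact: (measurableT_comp (measurable_scale r) measurable_fst).
Qed.

Let mX2 : measurable_fun setT (fun z : Rd R d * (Omega * measurableTypeR R) => X2 z.1 z.2).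
Proof.
apply: measurable_funD; last first.
  exact: (measurableT_comp measurable_snd measurable_snd).
apply: (measurableT_comp (mY e0) (g := fun z : Rd R d * (Omega * measurableTypeR R) => (z.1, z.2.1))).
by apply: measurable_fun_pair => //; exact: (measurableT_comp measurable_fst measurable_snd).
Qed.

Let i1 : P.-integrable setT (EFin \o (fun=> 1 : R)).
Proof. exact: finite_measure_integrable_cst. Qed.

Let in1 : nu.-integrable setT (EFin \o (fun=> 1 : R)).
Proof. exact: finite_measure_integrable_cst. Qed.

Let bounded_prod (f : Omega * measurableTypeR R -> R) : measurable_fun setT f ->
  (forall z, `|f z| <= 1) ->
  \int[(P \x nu)%E]_z f z = \int[nu]_u \int[P]_w f (w, u).
Proof.
move=> mf f1; apply: (Rintegral_prod mf _ i1 in1) => w u.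
by rewrite mulr1 f1.
Qed.

(** The added Gaussian constant is modelled on a product space; it
    contributes to a linear combination its variance times the square of
    the sum of the coefficients. *)
Lemma chaos_scaling_char q c0 : List.Forall (fun p => eball rho p.2) q ->
  \int[P]_w (1 * cos (lincomb X1 q w + c0)) =
  \int[(P \x nu)%E]_z (1 * cos (lincomb X2 q z + c0)).
Proof.
move=> qB.
pose q1 := [seq (p.1, (r * e, scale r p.2)) | p <- q].
pose q2 := [seq (p.1, (e, p.2)) | p <- q].
have q1D : List.Forall (fun p => reg_dom p.2) q1.
  by rewrite /q1; elim: qB => [|p q' pB _ IH]; constructor => //; split => //; exact: ball_scale.
have q2D : List.Forall (fun p => reg_dom p.2) q2.
  by rewrite /q2; elim: qB => [|p q' pB _ IH]; constructor => //; split => //; exact: ball_1.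
pose C := \sum_(p <- q) p.1.
have varE : reg_var T theta q1 = reg_var T theta q2 + C ^+ 2 * l.
  have inner (p : R * Rd R d) : eball rho p.2 ->
      \sum_(k <- q) p.1 * k.1 * cov (r * e, scale r p.2) (r * e, scale r k.2) =
      \sum_(k <- q) p.1 * k.1 * cov (e, p.2) (e, k.2) + p.1 * C * l.
    move=> pB; rewrite /C mulr_sumr mulr_suml -big_split/=.
    elim: qB => [|k q' kB _ IH]; first by rewrite !big_nil.
    by rewrite !big_cons IH reg_cov_scale//; ring.
  have outer q' : List.Forall (fun p : R * Rd R d => eball rho p.2) q' ->
      \sum_(p <- q') \sum_(k <- q) p.1 * k.1 * cov (r * e, scale r p.2) (r * e, scale r k.2) =
      \sum_(p <- q') \sum_(k <- q) p.1 * k.1 * cov (e, p.2) (e, k.2) +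
      (\sum_(p <- q') p.1) * C * l.
    elim => [|p q'' pB _ IH]; first by rewrite !big_nil !mul0r addr0.
    by rewrite !big_cons IH inner//; ring.
  rewrite /reg_var !big_map.
  under eq_bigr do rewrite big_map/=.
  under [in RHS]eq_bigr do rewrite big_map/=.
  by rewrite outer// expr2.
rewrite bounded_prod; last 2 first.
- apply: measurable_funM => //; apply: (measurableT_comp measurable_cosR).
  apply: measurable_funD => //; apply: measurable_lincomb => x.
  exact: (measurableT_comp mX2 (pair1_measurable x)).
- by move=> z; rewrite mul1r ler_norml cos_geN1 cos_le1.
transitivity (\int[P]_w cos (lincomb val q1 w + c0)).
  by apply: eq_Rintegral => w _; rewrite mul1r /lincomb big_map.
rewrite (reg_char T0 hZ htheta hY)// varE.
transitivity (\int[nu]_u (expR (- (reg_var T theta q2 / 2)) * cos (C * u + c0))).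
  rewrite RintegralZl//; last exact: integrable_cos_affine.
  rewrite /nu char_normal_prob// s2 mulrCA -expRD; congr (_ * expR _); by field.
apply: eq_Rintegral => u _.
transitivity (\int[P]_w cos (lincomb val q2 w + (C * u + c0))).
  by rewrite (reg_char T0 hZ htheta hY)// mulrC.
apply: eq_Rintegral => w _; rewrite mul1r addrA; congr (cos (_ + _)).
rewrite /lincomb big_map /C mulr_suml -big_split/=.
by apply: eq_bigr => p _; rewrite /X2 mulrDr.
Qed.

Let b x := \1_(eball rho) x * expR (- (gamma ^+ 2 / 2 * reg_variance P Y (r * e) (scale r x))).
Let F x w := chaos_weight P Y gamma (r * e) (eball (r * rho)) x * expR (gamma * val (r * e, x) w).

Let b0 x : 0 <= b x.
Proof. by rewrite mulr_ge0 ?expR_ge0. Qed.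

Let F_scale x w : F (scale r x) w = b x * expR (gamma * X1 x w).
Proof.
rewrite /F /chaos_weight /b /X1; congr (_ * _ * _); rewrite !indicE.
by congr (nat_of_bool _)%:R; apply/idP/idP => /set_mem h; apply/mem_set; apply/(eball_scale rho x r0).
Qed.

Let F0 x w : 0 <= F x w.
Proof. by rewrite mulr_ge0 ?expR_ge0 ?chaos_weight_ge0. Qed.

Let mF w : measurable_fun setT (F ^~ w).
Proof.
exact: (measurableT_comp (measurable_chaos_integrand hY gamma re0 (measurable_eball (r * rho)))
  (pair2_measurable w)).
Qed.

Let b_factor x w u : b x * expR (gamma * X2 x (w, u)) =
  expR (gamma * u - gamma ^+ 2 / 2 * l) *
  (chaos_weight P Y gamma e (eball rho) x * expR (gamma * val (e, x) w)).
Proof.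
rewrite /b /chaos_weight /X2 indicE.
case: (boolP (x \in eball rho)) => [/set_mem xB|_]; last by rewrite !mul0r mulr0.
rewrite !mul1r -!expRD (reg_varianceE T0 hZ htheta hY)//; last exact: ball_scale.
rewrite (reg_varianceE T0 hZ htheta hY)//; last exact: ball_1.
rewrite reg_cov_scale//; congr expR => /=; ring.
Qed.

Let mass1 w : mass (r * e) (eball (r * rho)) w = r ^+ d * exp_mass leb gamma b X1 w.
Proof.
have rd0 : 0 <= r ^+ d by rewrite exprn_ge0// ltW.
rewrite /exp_mass -(ge0_RintegralZl leb _ _ rd0)//.
- rewrite /chaos_mass /exp_mass /Rintegral.
  rewrite (ge0_integral_lebesgueT_scale r0 (f := fun x => (F x w)%:E)); last 2 first.
  + by apply/measurable_EFinP; exact: mF.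
  + by move=> x; rewrite lee_fin.
  congr fine; under [RHS]eq_integral do rewrite EFinM.
  rewrite ge0_integralZl//; last 2 first.
  + apply/measurable_EFinP; under eq_fun do rewrite -F_scale.
    exact: (measurableT_comp (mF w) (measurable_scale r)).
  + by move=> x _; rewrite lee_fin mulr_ge0 ?expR_ge0.
  by congr (_ * _)%E; apply: eq_integral => x _; rewrite F_scale.
- under eq_fun do rewrite -F_scale.
  exact: (measurableT_comp (mF w) (measurable_scale r)).
- by move=> x; rewrite mulr_ge0 ?expR_ge0.
Qed.

Let mass2 w u : exp_mass leb gamma b X2 (w, u) =
  expR (gamma * u - gamma ^+ 2 / 2 * l) * mass e (eball rho) w.
Proof.
rewrite /exp_mass; under eq_Rintegral do rewrite b_factor.
rewrite ge0_RintegralZl ?expR_ge0//.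
  exact: (measurableT_comp (measurable_chaos_integrand hY gamma e0 (measurable_eball rho))
    (pair2_measurable w)).
by move=> x; rewrite mulr_ge0 ?expR_ge0 ?chaos_weight_ge0.
Qed.

(** The self-similarity of the regularized chaos. The scale changes from
    [e] to [r e] together with the ball, so that nothing is lost at a
    fixed scale; [exp (- gamma ^ 2 l / 2)] is the normalization of the
    added constant. *)
Lemma chaos_scaling_laplace t : 0 <= t ->
  \int[P]_w expR (- (t * mass (r * e) (eball (r * rho)) w)) =
  \int[nu]_u \int[P]_w
    expR (- (t * (r ^+ d * (expR (gamma * u - gamma ^+ 2 / 2 * l) * mass e (eball rho) w)))).
Proof.
move=> t0.
have rd0 : 0 <= r ^+ d by rewrite exprn_ge0// ltW.
have rho1 : (eball rho : set (Rd R d)) `<=` eball 1 by move=> x; exact: ball_1.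
have rrho1 : (eball (r * rho) : set (Rd R d)) `<=` eball 1.
  move=> x; rewrite /eball/= => /lt_le_trans; apply.
  case/andP: r01 => _ r1; rewrite -[X in _ <= X](mulr1 1) ler_pM ?ltW//.
  by rewrite (le_lt_trans rhoe)// gtrBl.
have mb : measurable_fun setT b.
  apply: measurable_funM; first by apply: measurable_indic; exact: measurable_eball.
  apply: measurableT_comp => //; apply: measurableT_comp => //.
  apply: measurable_funM => //.
  exact: (measurableT_comp (measurable_reg_variance hY re0) (measurable_scale r)).
have ib : leb.-integrable setT (EFin \o b).
  apply: (@integrable_le _ _ _ leb _ (\1_(eball rho))) => //.
    move=> x; rewrite ger0_norm ?b0// ler_piMr// -expR0 ler_expR.
    by rewrite oppr_le0 mulr_ge0 ?reg_variance_ge0// divr_ge0// sqr_ge0.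
  exact: integrable_indic_ball (measurable_eball rho) rho1.
have := @eq_char_eq_laplace R _ _ leb _ _ Omega _ P (product_probability P nu) (fun=> 1) (fun=> 1)
  X1 X2 (eball rho) gamma b (t * r ^+ d) i1.
have ip : (P \x nu)%E.-integrable setT (EFin \o (fun=> 1 : R)).
  by apply: (@integrable_prod_dominated _ _ _ _ _ P nu _ (fun=> 1) (fun=> 1)) => //= w u; rewrite normr1 mul1r.
move=> /(_ ip mX1 mX2 chaos_scaling_char b0 ib).
have ae1 : {ae P, forall w, leb.-integrable setT (EFin \o (fun x => b x * expR (gamma * X1 x w)))}.
  have := chaos_integrable_ae T0 hZ htheta hY gamma re0 (measurable_eball (r * rho)) rrho1.
  apply: filterS => w /integrableP[_ iF]; apply/integrableP; split.
    apply/measurable_EFinP; under eq_fun do rewrite -F_scale.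
    exact: (measurableT_comp (mF w) (measurable_scale r)).
  under eq_integral do rewrite /= -F_scale.
  move: iF; rewrite (ge0_integral_lebesgueT_scale r0); last 2 first.
  - by apply: measurableT_comp => //; apply/measurable_EFinP; exact: mF.
  - by move=> x; rewrite abse_ge0.
  have : (0 < (r ^+ d)%:E)%E by rewrite lte_fin exprn_gt0.
  have : (0 <= \int[leb]_x `|F (scale r x) w|%:E)%E by apply: integral_ge0 => x _; rewrite lee_fin.
  by case: (integral _ _ _) => [s' _|//|//]; rewrite ?ltry// => _ rd; rewrite gt0_muley.
have ae2 : {ae (P \x nu)%E, forall z, leb.-integrable setT (EFin \o (fun x => b x * expR (gamma * X2 x z)))}.
  have := ae_product_fst nu (chaos_integrable_ae T0 hZ htheta hY gamma e0 (measurable_eball rho) rho1).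
  apply: filterS => -[w u]/= ii.
  under [X in EFin \o X]eq_fun do rewrite b_factor.
  exact: integrable_scaler.
have bA x : ~ eball rho x -> b x = 0.
  by move=> xB; rewrite /b indicE memNset// mul0r.
move=> /(_ bA ae1 ae2 (mulr_ge0 t0 rd0)).
under eq_Rintegral do rewrite mul1r -mulrA -mass1.
move=> ->; rewrite bounded_prod; last 2 first.
- apply: measurable_funM => //; apply: measurableT_comp => //.
  apply: measurableT_comp => //; apply: measurable_funM => //.
  exact: measurable_exp_mass.
- move=> z; rewrite mul1r ger0_norm ?expR_ge0// -expR0 ler_expR oppr_le0.
  by rewrite !mulr_ge0//; exact: exp_mass_ge0.
apply: eq_Rintegral => u _; apply: eq_Rintegral => w _.
by rewrite mul1r mass2 !mulrA.
Qed.

End chaos_scaling.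

(** * Passing to the limit in the chaos *)

Lemma cvg_at_right_seq (R : realType) (a : R) (u : nat -> R) :
  (forall n, a < u n) -> u @ \oo --> a -> u @ \oo --> a^'+.
Proof.
move=> au cu A /= /cu; rewrite /nbhs/= => -[N _ h]; exists N => // n /= Nn.
exact: h.
Qed.

Section laplace_limit.
Context d (Omega : measurableType d) (R : realType).
Variable P : {measure set Omega -> \bar R}.
Implicit Types (f W : Omega -> R) (t : R).

Lemma expRN_le1 t : 0 <= t -> 0 <= expR (- t) <= 1.
Proof. by move=> t0; rewrite expR_ge0/= -expR0 ler_expR oppr_le0. Qed.

Lemma expRN_lip (x y : R) : 0 <= x -> 0 <= y -> `|expR (- x) - expR (- y)| <= `|x - y|.
Proof.
wlog xy : x y / x <= y.
  move=> h x0 y0; have [xy|/ltW yx] := leP x y; first exact: h.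
  by rewrite distrC [leRHS]distrC h.
move=> x0 y0; rewrite ger0_norm ?subr_ge0 ?ler_expR ?lerN2// distrC ger0_norm ?subr_ge0//.
have -> : expR (- y) = expR (- x) * expR (- (y - x)) by rewrite -expRD; congr expR; ring.
have h : 1 - expR (- (y - x)) <= y - x by have := expR_ge1Dx (- (y - x)); lra.
have h0 : 0 <= 1 - expR (- (y - x)).
  have yx : 0 <= y - x by rewrite subr_ge0.
  by rewrite subr_ge0; case/andP: (expRN_le1 yx).
rewrite -{1}(mulr1 (expR (- x))) -mulrBr; apply: le_trans h.
by rewrite ler_piMl//; case/andP: (expRN_le1 x0).
Qed.

(** The weight is only square integrable: Young's inequality trades it
    against the L^1 distance, the difference of the exponentials being at
    most one. *)
Lemma weighted_laplace_cvg W (f_ : nat -> Omega -> R) f t :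
  measurable_fun setT W -> (forall n, measurable_fun setT (f_ n)) -> measurable_fun setT f ->
  (forall n w, 0 <= f_ n w) -> (forall w, 0 <= f w) -> 0 <= t ->
  P.-integrable setT (EFin \o W) -> P.-integrable setT (EFin \o (fun w => W w ^+ 2)) ->
  (\int[P]_w `|f_ n w - f w|%:E)%E @[n --> \oo] --> 0%E ->
  \int[P]_w (W w * expR (- (t * f_ n w))) @[n --> \oo] -->
    \int[P]_w (W w * expR (- (t * f w))).
Proof.
move=> mW mf_ mf f_0 f0 t0 iW iW2 cf.
have mexp (g : Omega -> R) : measurable_fun setT g -> measurable_fun setT (fun w => W w * expR (- (t * g w))).
  move=> mg; apply: measurable_funM => //; apply: measurableT_comp => //.
  by apply: measurableT_comp => //; exact: measurable_funM.
have iexp (g : Omega -> R) : measurable_fun setT g -> (forall w, 0 <= g w) ->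
    P.-integrable setT (EFin \o (fun w => W w * expR (- (t * g w)))).
  move=> mg g0; apply: (@integrable_le _ _ _ P _ (fun w => `|W w|)).
  - exact: mexp.
  - move=> w; rewrite normrM ler_piMr// ger0_norm ?expR_ge0//.
    by case/andP: (expRN_le1 (mulr_ge0 t0 (g0 w))).
  - exact: (integrable_norm iW).
pose C := \int[P]_w (W w ^+ 2).
have C0 : 0 <= C by apply: Rintegral_ge0 => w _; exact: sqr_ge0.
apply/cvgrPdist_le => eps eps0.
(* the weight of Young's inequality: both terms are at most [eps / 2] *)
pose q := eps / (C + 1).
have q0 : 0 < q by rewrite divr_gt0// ltr_wpDl.
have ltr0Sn2 : 0 < 2 :> R by [].
have t1 : 0 < t + 1 by rewrite ltr_wpDl.
have tq : 0 < eps / 2 * (2 * q / (t + 1)).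
  exact: (mulr_gt0 (divr_gt0 eps0 ltr0Sn2) (divr_gt0 (mulr_gt0 ltr0Sn2 q0) t1)).
have /fine_cvgP[fin cvg0] := cf.
move/cvgrPdist_le : cvg0 => /(_ _ tq).
apply: filter_app; apply: filterS fin => n fin.
rewrite sub0r normrN => h.
have idf : P.-integrable setT (EFin \o (fun w => `|f_ n w - f w|)).
  apply/integrableP; split.
    by apply/measurable_EFinP; apply: measurableT_comp => //; exact: measurable_funB.
  under eq_integral do rewrite /= normr_id.
  by rewrite -ge0_fin_numE//; apply: integral_ge0 => w _; rewrite lee_fin.
rewrite distrC -RintegralB//; [|exact: iexp|exact: iexp].
have idiff := integrable_subr (iexp _ (mf_ n) (f_0 n)) (iexp _ mf f0).
apply: le_trans (le_normr_Rintegral measurableT idiff) _.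
apply: (@le_trans _ _ (\int[P]_w (q / 2 * W w ^+ 2 + t / (2 * q) * `|f_ n w - f w|))).
  apply: le_Rintegral => //.
  - exact: (integrable_norm idiff).
  - apply: (integrable_addr (f := fun w => q / 2 * W w ^+ 2)).
      exact: (integrable_scaler (q / 2) iW2).
    exact: (integrable_scaler (t / (2 * q)) idf).
  - move=> w _ /=; rewrite -mulrBr normrM.
    set D := expR _ - expR _.
    have D1 : `|D| <= 1.
      have /andP[a1 a2] := expRN_le1 (mulr_ge0 t0 (f_0 n w)).
      have /andP[b1 b2] := expRN_le1 (mulr_ge0 t0 (f0 w)).
      by rewrite ler_norml; apply/andP; split; rewrite /D; lra.
    have D2 : `|D| <= t * `|f_ n w - f w|.
      apply: le_trans (expRN_lip (mulr_ge0 t0 (f_0 n w)) (mulr_ge0 t0 (f0 w))) _.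
      by rewrite -mulrBr normrM ger0_norm.
    rewrite -[W w ^+ 2]real_normK ?num_real//.
    have : 0 <= (q * `|W w| - `|D|) ^+ 2 / (2 * q).
      by rewrite divr_ge0 ?sqr_ge0// mulr_ge0 ?ltW.
    have -> : (q * `|W w| - `|D|) ^+ 2 / (2 * q) =
       q / 2 * `|W w| ^+ 2 + `|D| ^+ 2 / (2 * q) - `|W w| * `|D|.
      by field; rewrite gt_eqF.
    have : `|D| ^+ 2 / (2 * q) <= t / (2 * q) * `|f_ n w - f w|.
      have q20 : 0 <= (2 * q)^-1 by rewrite invr_ge0 mulr_ge0// ltW.
      rewrite [leRHS]mulrAC; apply: (ler_wpM2r q20).
      by apply: le_trans D2; rewrite expr2; apply: ler_piMl.
    by lra.
rewrite RintegralD//; [|exact: (integrable_scaler (q / 2) iW2)|exact: (integrable_scaler (t / (2 * q)) idf)].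
rewrite !RintegralZl//.
have b1 : q / 2 * C <= eps / 2.
  have C10 : 0 < C + 1 by rewrite ltr_wpDl.
  have -> : q / 2 * C = eps / 2 * (C / (C + 1)) by rewrite /q; field; rewrite gt_eqF.
  apply: ler_piMr; first exact: (ltW (divr_gt0 eps0 ltr0Sn2)).
  by rewrite ler_pdivrMr// mul1r lerDl.
have b2 : t / (2 * q) * \int[P]_w `|f_ n w - f w| <= eps / 2.
  have h' : \int[P]_w `|f_ n w - f w| <= eps / 2 * (2 * q / (t + 1)).
    exact: le_trans (ler_norm _) h.
  have tq0 : 0 <= t / (2 * q) by rewrite divr_ge0// mulr_ge0// ltW.
  apply: le_trans (ler_wpM2l tq0 h') _.
  rewrite mulrCA; apply: ler_piMr; first exact: (ltW (divr_gt0 eps0 ltr0Sn2)).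
  have -> : t / (2 * q) * (2 * q / (t + 1)) = t / (t + 1).
    by field; rewrite !gt_eqF.
  by rewrite ler_pdivrMr// mul1r lerDl.
by rewrite -/C; lra.
Qed.

End laplace_limit.

Section chaos_limit.
Context {R : realType} {d : nat}.
Variable T : R.
Hypothesis T0 : 0 < T.
Context {dO : measure_display} {Omega : measurableType dO}.
Variable P : probability Omega R.
Variable Z : signed_measure R d -> {RV P >-> R}.
Hypothesis hZ : log_field T Z.
Variable theta : probability (Rd R d) R.
Hypothesis htheta : mollifier theta.
Variable Y : R -> Rd R d * Omega -> R.
Hypothesis hY : regularization Z theta Y.
Variable gamma : R.
Variable M : R.-ker Omega ~> Rd R d.
Hypothesis hL : forall A : set (Rd R d), measurable A -> A `<=` eball 1 ->
  (\int[P]_w `|chaos_approx P gamma Y e A w - M w A| @[e --> 0^'+] --> 0)%E.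
Local Notation leb := (lebesgue_measureT R d).
Local Notation mass := (chaos_mass P Y gamma).
Implicit Types (A : set (Rd R d)) (e t : R).

Lemma measurable_chaos_approx e A : 0 < e -> measurable A ->
  measurable_fun setT (chaos_approx P gamma Y e A).
Proof.
move=> e0 mA; rewrite (funext (fun w => chaos_approxE P Y gamma e w mA)).
apply: (measurable_fun_fubini_tonelli_G (m1 := leb) (fun z : Rd R d * Omega =>
    (chaos_weight P Y gamma e A z.1 * expR (gamma * reg_value Y (e, z.1) z.2))%:E)).
- by apply/measurable_EFinP; exact: (measurable_chaos_integrand hY gamma e0 mA).
- by move=> z; rewrite lee_fin mulr_ge0 ?chaos_weight_ge0 ?expR_ge0.
Qed.

Lemma measurable_gmc_fine A : measurable A -> measurable_fun setT (fun w => fine (M w A)).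
Proof.
move=> mA; apply: measurableT_comp; first exact: fine_measurable.
exact: measurable_kernel.
Qed.

(** The chaos is an L^1 limit of almost surely finite masses, so its own
    mass is finite almost surely. *)
Lemma gmc_fin_ae A : measurable A -> A `<=` eball 1 ->
  {ae P, forall w, M w A = (fine (M w A))%:E}.
Proof.
move=> mA AB.
have mM := measurable_kernel M A mA.
have /fine_cvgP[fin _] := hL mA AB.
have [e [e0 fe]] := @filter_ex _ _ (at_right_proper_filter 0) _ (filterI (nbhs_right_gt 0) fin).
have mc := measurable_chaos_approx e0 mA.
have : P.-integrable setT (fun w => (chaos_approx P gamma Y e A w - M w A)%E).
  apply/integrableP; split; first exact: emeasurable_funB.
  by rewrite -ge0_fin_numE//; apply: integral_ge0.
move=> /(integrable_ae measurableT).
apply: filterS2 (chaos_approx_fin_ae T0 hZ htheta hY gamma e0 mA AB) => w ->.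
move=> /(_ I); case: (M w A) (measure_ge0 (M w) A) => //.
Qed.

Lemma chaos_mass_L1 e A : 0 < e -> measurable A -> A `<=` eball 1 ->
  (\int[P]_w `|mass e A w - fine (M w A)|%:E =
   \int[P]_w `|chaos_approx P gamma Y e A w - M w A|)%E.
Proof.
move=> e0 mA AB; apply: ae_eq_integral => //.
- apply/measurable_EFinP; apply: measurableT_comp => //; apply: measurable_funB.
    exact: (measurable_chaos_mass hY).
  exact: measurable_gmc_fine.
- apply: measurableT_comp => //; apply: emeasurable_funB.
    exact: measurable_chaos_approx.
  exact: measurable_kernel.
- apply: filterS2 (chaos_approx_fin_ae T0 hZ htheta hY gamma e0 mA AB) (gmc_fin_ae mA AB).
  by move=> w -> ->.
Qed.

Lemma chaos_mass_cvg (e_ : nat -> R) A : (forall n, 0 < e_ n) -> e_ @ \oo --> 0 ->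
  measurable A -> A `<=` eball 1 ->
  (\int[P]_w `|mass (e_ n) A w - fine (M w A)|%:E @[n --> \oo] --> 0)%E.
Proof.
move=> e_0 ce mA AB; under eq_cvg do rewrite chaos_mass_L1//.
exact: (cvg_comp _ _ (cvg_at_right_seq e_0 ce) (hL mA AB)).
Qed.

(** The weight will be a tilting density at another, fixed scale. *)
Lemma gmc_weighted_cvg (W : Omega -> R) (e_ : nat -> R) A t :
  measurable_fun setT W -> P.-integrable setT (EFin \o (fun w => W w ^+ 2)) ->
  P.-integrable setT (EFin \o W) ->
  (forall n, 0 < e_ n) -> e_ @ \oo --> 0 -> measurable A -> A `<=` eball 1 -> 0 <= t ->
  \int[P]_w (W w * expR (- (t * mass (e_ n) A w))) @[n --> \oo] -->
    \int[P]_w (W w * expR (- (t * fine (M w A)))).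
Proof.
move=> mW iW2 iW e_0 ce mA AB t0; apply: weighted_laplace_cvg => //.
- by move=> n; exact: (measurable_chaos_mass hY).
- exact: measurable_gmc_fine.
- by move=> n w; exact: chaos_mass_ge0.
- exact: chaos_mass_cvg.
Qed.

Lemma gmc_laplace_cvg (e_ : nat -> R) A t :
  (forall n, 0 < e_ n) -> e_ @ \oo --> 0 -> measurable A -> A `<=` eball 1 -> 0 <= t ->
  \int[P]_w expR (- (t * mass (e_ n) A w)) @[n --> \oo] -->
    \int[P]_w expR (- (t * fine (M w A))).
Proof.
move=> e_0 ce mA AB t0.
have i1 : P.-integrable setT (EFin \o (fun=> 1 : R)) by exact: finite_measure_integrable_cst.
have one (f : Omega -> R) : \int[P]_w f w = \int[P]_w (1 * f w).
  by apply: eq_Rintegral => w _; rewrite mul1r.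
under eq_cvg do rewrite one.
rewrite (one (fun w => expR (- (t * fine (M w A))))); apply: (gmc_weighted_cvg (W := fun=> 1)) => //.
by under [X in EFin \o X]eq_fun do rewrite expr1n.
Qed.

(** The scaling relation at scale [e] needs the radius to be at most [1 -
    e]; the full ball is reached through an increasing sequence of balls. *)
Lemma gmc_laplace_ball (rho_ : nat -> R) rho t : 0 < rho -> rho <= 1 ->
  {homo rho_ : m n / (m <= n)%N >-> m <= n} -> (forall n, rho_ n < rho) ->
  rho_ @ \oo --> rho -> 0 <= t ->
  \int[P]_w expR (- (t * ball_mass M (rho_ n) w)) @[n --> \oo] -->
    \int[P]_w expR (- (t * ball_mass M rho w)).
Proof.
move=> rho0 rho1 ndr ltr cr t0.
have mexp s : measurable_fun setT (fun w => expR (- (t * ball_mass M s w))).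
  apply: measurableT_comp => //; apply: measurableT_comp => //; apply: measurable_funM => //.
  by apply: measurable_gmc_fine; exact: measurable_eball.
apply: (@Rintegral_dominated_cvg _ _ _ P _ _ (fun=> 1)) => //.
- have BB : (eball rho : set (Rd R d)) `<=` eball 1.
    by move=> x; rewrite /eball/= => /lt_le_trans; apply.
  apply: filterS (gmc_fin_ae (measurable_eball rho) BB) => w fin.
  apply: continuous_cvg; first exact: continuous_expR.
  apply: cvgN; apply: cvgMl_tmp; apply: fine_cvg; rewrite -fin.
  have -> : eball rho = \bigcup_n eball (rho_ n) :> set (Rd R d).
    apply/seteqP; split=> x.
      rewrite /eball/= => xr.
      have [n _ hn] : \forall n \near \oo, edist x origin < rho_ n.
        exact: (cvgr_gt _ cr _ xr).
      by exists n => //; exact: (hn n (leqnn n)).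
    by move=> [n _]; rewrite /eball/= => /lt_trans; apply.
  apply: (@nondecreasing_cvg_mu _ _ _ (M w) (fun n => eball (rho_ n))) => //.
  + by move=> n; exact: measurable_eball.
  + by apply: bigcup_measurable => n _; exact: measurable_eball.
  + move=> m n mn; apply/subsetPset => x; rewrite /eball/= => /lt_le_trans; apply.
    exact: ndr.
- exact: finite_measure_integrable_cst.
- move=> n w; rewrite ger0_norm ?expR_ge0//.
  by case/andP: (expRN_le1 (mulr_ge0 t0 (fine_ge0 (measure_ge0 (M w) (eball (rho_ n)))))).
Qed.

End chaos_limit.

(** * Self-similarity of the chaos *)

Section laplace_mixture.
Context d (Omega : measurableType d) (R : realType) (P : probability Omega R).
Context d' (U : measurableType d') (nu : probability U R).
Implicit Types X : Omega -> R.

(** The bound by one is what makes all limits under a further integral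
    dominated. *)
Lemma laplace_bounds X : measurable_fun setT X -> (forall w, 0 <= X w) ->
  0 <= \int[P]_w expR (- X w) <= 1.
Proof.
move=> mX X0; apply/andP; split; first by apply: Rintegral_ge0 => w _; exact: expR_ge0.
have i1 : P.-integrable setT (EFin \o (fun=> 1 : R)) by exact: finite_measure_integrable_cst.
have ie : P.-integrable setT (EFin \o (fun w => expR (- X w))).
  apply: (@integrable_bounded _ _ _ P _ 1).
    by apply: measurableT_comp => //; exact: measurableT_comp.
  by move=> w; case/andP: (expRN_le1 (X0 w)) => h0 h1; rewrite ger0_norm.
have := le_Rintegral measurableT ie i1 (fun w _ => (andP (expRN_le1 (X0 w))).2).
by rewrite Rintegral_cst// mul1r [X in fine X]probability_setT.
Qed.

Lemma measurable_laplace_mixture (k : U -> R) X :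
  measurable_fun setT k -> (forall u, 0 <= k u) -> measurable_fun setT X ->
  (forall w, 0 <= X w) ->
  measurable_fun setT (fun u => \int[P]_w expR (- (k u * X w))).
Proof.
move=> mk k0 mX X0.
apply: (@measurable_Rintegral_fubini _ _ _ _ _ nu P
  (fun z => expR (- (k z.1 * X z.2))) (fun=> 1) (fun=> 1)).
- apply: measurableT_comp => //; apply: measurableT_comp => //; apply: measurable_funM.
    exact: (measurableT_comp mk measurable_fst).
  exact: (measurableT_comp mX measurable_snd).
- move=> u w /=; rewrite mulr1 ger0_norm ?expR_ge0//.
  by case/andP: (expRN_le1 (mulr_ge0 (k0 u) (X0 w))).
- exact: finite_measure_integrable_cst.
- exact: finite_measure_integrable_cst.
Qed.

(** The random factor [k] is independent of the mass, so the convergence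
    of Laplace transforms is used at each of its values. *)
Lemma laplace_mixture_cvg (k : U -> R) (X_ : nat -> Omega -> R) X :
  measurable_fun setT k -> (forall u, 0 <= k u) ->
  (forall n, measurable_fun setT (X_ n)) -> (forall n w, 0 <= X_ n w) ->
  measurable_fun setT X -> (forall w, 0 <= X w) ->
  (forall t, 0 <= t -> \int[P]_w expR (- (t * X_ n w)) @[n --> \oo] -->
     \int[P]_w expR (- (t * X w))) ->
  \int[nu]_u \int[P]_w expR (- (k u * X_ n w)) @[n --> \oo] -->
  \int[nu]_u \int[P]_w expR (- (k u * X w)).
Proof.
move=> mk k0 mX_ X_0 mX X0 cX.
apply: (@Rintegral_dominated_cvg _ _ _ nu _ _ (fun=> 1)).
- by move=> n; exact: measurable_laplace_mixture.
- exact: measurable_laplace_mixture.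
- by apply: aeW => u; exact: cX.
- exact: finite_measure_integrable_cst.
- move=> n u; have mkX : measurable_fun setT (fun w => k u * X_ n w) by exact: measurable_funM.
  have /andP[h0 h1] := laplace_bounds mkX (fun w => mulr_ge0 (k0 u) (X_0 n w)).
  by rewrite ger0_norm.
Qed.

End laplace_mixture.

Section chaos_self_similarity.
Context {R : realType} {d : nat}.
Variable T : R.
Hypothesis T0 : 0 < T.
Context {dO : measure_display} {Omega : measurableType dO}.
Variable P : probability Omega R.
Variable Z : signed_measure R d -> {RV P >-> R}.
Hypothesis hZ : log_field T Z.
Variable theta : probability (Rd R d) R.
Hypothesis htheta : mollifier theta.
Variable Y : R -> Rd R d * Omega -> R.
Hypothesis hY : regularization Z theta Y.
Variable gamma : R.
Variable M : R.-ker Omega ~> Rd R d.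
Hypothesis hL : forall A : set (Rd R d), measurable A -> A `<=` eball 1 ->
  (\int[P]_w `|chaos_approx P gamma Y e A w - M w A| @[e --> 0^'+] --> 0)%E.
Variable r : R.
Hypothesis r01 : 0 < r < 1.
Let l := ln r^-1.
Let nu := normal_prob 0 (Num.sqrt l).
Let r0 : 0 < r. Proof. by case/andP: r01. Qed.
Let factor (t : R) (u : measurableTypeR R) : R :=
  t * (r ^+ d * expR (gamma * u - gamma ^+ 2 / 2 * l)).

Let factor_ge0 t : 0 <= t -> forall u, 0 <= factor t u.
Proof. by move=> t0 u; rewrite !mulr_ge0 ?expR_ge0// exprn_ge0// ltW. Qed.

Let measurable_factor t : measurable_fun setT (factor t).
Proof.
apply: measurable_funM => //; apply: measurable_funM => //.
apply: measurableT_comp => //; apply: measurable_funB => //.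
Qed.

Let measurable_mass s : measurable_fun setT (ball_mass M s).
Proof. by apply: measurable_gmc_fine; exact: measurable_eball. Qed.

Let mass_ge0 s w : 0 <= ball_mass M s w.
Proof. exact: fine_ge0. Qed.

Lemma gmc_scaling_subball rho t : 0 < rho < 1 -> 0 <= t ->
  \int[P]_w expR (- (t * ball_mass M (r * rho) w)) =
  \int[nu]_u \int[P]_w expR (- (factor t u * ball_mass M rho w)).
Proof.
move=> /andP[rho0 rho1] t0.
pose e_ n : R := (1 - rho) * harmonic n.
(* this scale keeps the mollified measures on the smaller ball untruncated *)
have e_0 n : 0 < e_ n by rewrite mulr_gt0 ?subr_gt0// harmonic_gt0.
have ce : e_ @ \oo --> 0.
  by rewrite -(mulr0 (1 - rho)); apply: cvgMl_tmp; exact: cvg_harmonic.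
have er n : rho <= 1 - e_ n.
  rewrite lerBrDr -lerBrDl /e_; apply: ler_piMr; first by rewrite subr_ge0 ltW.
  by rewrite /harmonic/= invf_le1// ler1n.
have re_0 n : 0 < r * e_ n by rewrite mulr_gt0.
have cre : (fun n => r * e_ n) @ \oo --> 0.
  by rewrite -(mulr0 r); exact: cvgMl_tmp.
have rhoB : (eball rho : set (Rd R d)) `<=` eball 1.
  by move=> x; rewrite /eball/= => /lt_trans; apply.
have rrhoB : (eball (r * rho) : set (Rd R d)) `<=` eball 1.
  move=> x; rewrite /eball/= => /lt_le_trans; apply.
  by rewrite mulr_ile1 ?ltW//; case/andP: r01.
have c1 := gmc_laplace_cvg T0 hZ htheta hY hL re_0 cre (measurable_eball (r * rho)) rrhoB t0.
have c2 : \int[nu]_u \int[P]_w expR (- (factor t u * chaos_mass P Y gamma (e_ n) (eball rho) w))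
    @[n --> \oo] --> \int[nu]_u \int[P]_w expR (- (factor t u * ball_mass M rho w)).
  apply: (@laplace_mixture_cvg _ Omega R P _ (measurableTypeR R) nu (factor t)
    (fun n => chaos_mass P Y gamma (e_ n) (eball rho)) (ball_mass M rho)
    (measurable_factor t) (factor_ge0 t0) _ _ (measurable_mass rho) (mass_ge0 rho)).
  - by move=> n; apply: (measurable_chaos_mass hY) => //; exact: measurable_eball.
  - by move=> n w; exact: chaos_mass_ge0.
  - move=> t' t'0.
    exact: (gmc_laplace_cvg T0 hZ htheta hY hL e_0 ce (measurable_eball rho) rhoB t'0).
have E : (fun n => \int[nu]_u \int[P]_w
      expR (- (factor t u * chaos_mass P Y gamma (e_ n) (eball rho) w))) =
    (fun n => \int[P]_w expR (- (t * chaos_mass P Y gamma (r * e_ n) (eball (r * rho)) w))).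
  apply/funext => n.
  apply: (etrans _ (esym (chaos_scaling_laplace T0 hZ htheta hY gamma r01 rho0 (e_0 n) (er n) t0))).
  by apply: eq_Rintegral => u _; apply: eq_Rintegral => w _; rewrite /factor !mulrA.
by move: c2; rewrite E => c2; exact: (cvg_unique _ c1 c2).
Qed.

(** The regularized identity passes to the limit in the scale on a smaller
    ball, and then the radius of that ball tends to one. *)
Lemma gmc_scaling t : 0 <= t ->
  \int[P]_w expR (- (t * ball_mass M r w)) =
  \int[nu]_u \int[P]_w
    expR (- (t * (r ^+ d * expR (gamma * u - gamma ^+ 2 / 2 * l)) * ball_mass M 1 w)).
Proof.
move=> t0.
pose rho_ n : R := 1 - 2^-1 * harmonic n.
have h0 n : 0 < (harmonic n : R) <= 1.
  by rewrite harmonic_gt0 /harmonic/= invf_le1// ler1n.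
have rho01 n : 0 < rho_ n < 1.
  by have /andP[] := h0 n; rewrite /rho_ => *; apply/andP; split; lra.
have rho1 n : rho_ n < 1 by case/andP: (rho01 n).
have crho : rho_ @ \oo --> (1 : R).
  rewrite -(subr0 (1 : R)); apply: cvgB; first exact: cvg_cst.
  by rewrite -(mulr0 2^-1); apply: cvgMl_tmp; exact: cvg_harmonic.
have ndrho : {homo rho_ : m n / (m <= n)%N >-> m <= n}.
  by move=> m n mn; rewrite lerB// ler_wpM2l// /harmonic/= lef_pV2 ?posrE// ler_nat.
have c1 : \int[P]_w expR (- (t * ball_mass M (r * rho_ n) w)) @[n --> \oo] -->
    \int[P]_w expR (- (t * ball_mass M r w)).
  apply: (gmc_laplace_ball T0 hZ htheta hY hL (rho_ := fun n => r * rho_ n)) => //.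
  - by case/andP: r01 => _ /ltW.
  - by move=> m n mn; apply: (ler_wpM2l (ltW r0)); exact: ndrho.
  - by move=> n; rewrite -[ltRHS]mulr1 ltr_pM2l.
  - have h : (fun n => r * rho_ n) @ \oo --> r * 1 by exact: cvgMl_tmp.
    by move: h; rewrite (mulr1 r).
have c2 : \int[nu]_u \int[P]_w expR (- (factor t u * ball_mass M (rho_ n) w))
    @[n --> \oo] --> \int[nu]_u \int[P]_w expR (- (factor t u * ball_mass M 1 w)).
  apply: (@laplace_mixture_cvg _ Omega R P _ (measurableTypeR R) nu (factor t)
    (fun n => ball_mass M (rho_ n)) (ball_mass M 1) (measurable_factor t) (factor_ge0 t0)
    (fun n => measurable_mass (rho_ n)) (fun n => mass_ge0 (rho_ n))
    (measurable_mass 1) (mass_ge0 1)).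
  by move=> t' t'0; exact: (gmc_laplace_ball T0 hZ htheta hY hL).
have E : (fun n => \int[nu]_u \int[P]_w expR (- (factor t u * ball_mass M (rho_ n) w))) =
    (fun n => \int[P]_w expR (- (t * ball_mass M (r * rho_ n) w))).
  by apply/funext => n; exact: (esym (gmc_scaling_subball (rho01 n) t0)).
by move: c2; rewrite E => c2; exact: (cvg_unique _ c1 c2).
Qed.

End chaos_self_similarity.

(** * The chaos charges the ball almost surely *)

Lemma laplace_le_ae d (Omega : measurableType d) (R : realType) (P : probability Omega R)
    (X X' : Omega -> R) : measurable_fun setT X -> measurable_fun setT X' ->
  (forall w, 0 <= X w) -> (forall w, 0 <= X' w) ->
  {ae P, forall w, X w <= X' w} ->
  \int[P]_w expR (- X' w) <= \int[P]_w expR (- X w).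
Proof.
move=> mX mX' X0 X'0 XX'.
have mexp (f : Omega -> R) : measurable_fun setT f -> measurable_fun setT (fun w => expR (- f w)).
  by move=> mf; apply: measurableT_comp => //; exact: measurableT_comp.
have iexp (f : Omega -> R) : measurable_fun setT f -> (forall w, 0 <= f w) ->
    P.-integrable setT (EFin \o (fun w => expR (- f w))).
  move=> mf f0; apply: (@integrable_bounded _ _ _ P _ 1); first exact: mexp.
  by move=> w; case/andP: (expRN_le1 (f0 w)) => h0 h1; rewrite ger0_norm.
rewrite /Rintegral; apply: fine_le.
- exact: (integrable_fin_num measurableT (iexp _ mX' X'0)).
- exact: (integrable_fin_num measurableT (iexp _ mX X0)).
apply: ae_ge0_le_integral => //.
- by apply/measurable_EFinP; exact: mexp.
- by apply/measurable_EFinP; exact: mexp.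
by apply: filterS XX' => w h _; rewrite lee_fin ler_expR lerN2.
Qed.

Section chaos_tilting.
Context {R : realType} {d : nat}.
Variable T : R.
Hypothesis T0 : 0 < T.
Context {dO : measure_display} {Omega : measurableType dO}.
Variable P : probability Omega R.
Variable Z : signed_measure R d -> {RV P >-> R}.
Hypothesis hZ : log_field T Z.
Variable theta : probability (Rd R d) R.
Hypothesis htheta : mollifier theta.
Variable Y : R -> Rd R d * Omega -> R.
Hypothesis hY : regularization Z theta Y.
Variable gamma : R.
Local Notation leb := (lebesgue_measureT R d).
Local Notation cov := (reg_cov T theta).
Local Notation val := (reg_value Y).
Local Notation mass := (chaos_mass P Y gamma).

Variables (e e' : R) (x : Rd R d).
Hypotheses (e0 : 0 < e) (e'0 : 0 < e') (x1 : eball 1 x).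
Implicit Types y : Rd R d.

(** The covariance of two values of the field, by polarization: in this
    form it is measurable in [y]. *)
Definition reg_cross y : R :=
  (fine (\int[P]_w ((Y e (x, w) + Y e' (y, w)) ^+ 2)%:E)%E
   - reg_variance P Y e x - reg_variance P Y e' y) / 2.

Let mval : measurable_fun setT (val (e, x)).
Proof. exact: (measurable_reg_value hY (i := (e, x))). Qed.

Let gval : centered_gaussian P (val (e, x)) (cov (e, x) (e, x)).
Proof. exact: (reg_gaussian T0 hZ htheta hY (i := (e, x)) (conj e0 x1)). Qed.

Lemma reg_crossE y : eball 1 y ->
  reg_cross y = (cov (e, x) (e', y) + cov (e', y) (e, x)) / 2.
Proof.
move=> y1; pose s := [:: (1 : R, (e, x)); (1, (e', y))].
have sD : List.Forall (fun p => reg_dom p.2) s.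
  by apply: List.Forall_cons => //; apply: List.Forall_cons => //; exact: List.Forall_nil.
have sE w : lincomb val s w = Y e (x, w) + Y e' (y, w).
  by rewrite /lincomb big_cons big_seq1 !mul1r.
have := gaussian_variance (measurable_reg_lincomb hY sD)
  (reg_lincomb_gaussian T0 hZ htheta hY sD).
under eq_integral do rewrite sE.
have rvE : reg_var T theta s = cov (e, x) (e, x) + cov (e, x) (e', y) +
    (cov (e', y) (e, x) + cov (e', y) (e', y)).
  rewrite /reg_var; move: (reg_cov T theta) => k.
  by rewrite !big_cons !big_nil !mul1r !addr0.
rewrite rvE => /(congr1 fine) h.
have -> : reg_cross y = (cov (e, x) (e, x) + cov (e, x) (e', y) +
    (cov (e', y) (e, x) + cov (e', y) (e', y)) - cov (e, x) (e, x) - cov (e', y) (e', y)) / 2.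
  congr ((_ - _ - _) / 2); first exact: h.
    exact: (reg_varianceE T0 hZ htheta hY).
  exact: (reg_varianceE T0 hZ htheta hY).
by congr (_ / _); move: (reg_cov T theta) => k; ring.
Qed.

Lemma measurable_reg_cross : measurable_fun setT reg_cross.
Proof.
have [mY _] := hY e'0.
apply: measurable_funM => //; apply: measurable_funB; last exact: (measurable_reg_variance hY).
apply: measurable_funB => //.
apply: measurableT_comp; first exact: fine_measurable.
apply: (measurable_fun_fubini_tonelli_F (m2 := P)
  (fun z : Rd R d * Omega => ((Y e (x, z.2) + Y e' z) ^+ 2)%:E)).
  apply/measurable_EFinP; apply: measurable_funX; apply: measurable_funD => //.
  exact: (measurableT_comp mval measurable_snd).
by move=> z; rewrite lee_fin sqr_ge0.
Qed.

Definition tilt_weight (w : Omega) : R :=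
  expR (gamma * Y e (x, w) - gamma ^+ 2 / 2 * reg_variance P Y e x).

Let tiltE w : tilt_weight w =
  expR (- (gamma ^+ 2 / 2 * cov (e, x) (e, x))) * expR (gamma * val (e, x) w).
Proof.
by rewrite /tilt_weight addrC expRD (reg_varianceE T0 hZ htheta hY).
Qed.

Lemma measurable_tilt_weight : measurable_fun setT tilt_weight.
Proof.
apply: measurableT_comp => //; apply: measurable_funB => //.
exact: measurable_funM.
Qed.

Lemma integrable_tilt_weight : P.-integrable setT (EFin \o tilt_weight).
Proof.
rewrite (funext tiltE).
exact: (integrable_scaler _ (gaussian_integrable_expR mval gval gamma)).
Qed.

Lemma integrable_tilt_weight2 : P.-integrable setT (EFin \o (fun w => tilt_weight w ^+ 2)).
Proof.
have E w : tilt_weight w ^+ 2 =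
    expR (- (gamma ^+ 2 / 2 * cov (e, x) (e, x))) ^+ 2 * expR (2 * gamma * val (e, x) w).
  rewrite tiltE exprMn; congr (_ * _).
  by rewrite -mulrA expRM_natl.
rewrite (funext E).
exact: (integrable_scaler _ (gaussian_integrable_expR mval gval (2 * gamma))).
Qed.

Let X1 y w := val (e', y) w.
Let X2 y w := val (e', y) w + gamma * reg_cross y.

(** Tilting by [gamma] times the value of the field at [x] adds to the
    field at [y] the covariance of the two, multiplied by [gamma]. *)
Lemma chaos_tilt_char q c0 : List.Forall (fun p => eball 1 p.2) q ->
  \int[P]_w (tilt_weight w * cos (lincomb X1 q w + c0)) =
  \int[P]_w (1 * cos (lincomb X2 q w + c0)).
Proof.
move=> qB; pose q' := [seq (p.1, (e', p.2)) | p <- q].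
have q'D : List.Forall (fun p => reg_dom p.2) q'.
  by rewrite /q'; elim: qB => [|p q'' pB _ IH]; constructor.
have X1E w : lincomb X1 q w = lincomb val q' w by rewrite /lincomb big_map.
pose c := \sum_(p <- q) p.1 * reg_cross p.2.
have X2E w : lincomb X2 q w = lincomb val q' w + gamma * c.
  rewrite /lincomb big_map /c mulr_sumr -big_split/=.
  by apply: eq_bigr => p _; rewrite /X2; ring.
have mL : measurable_fun setT (lincomb val q') by exact: (measurable_reg_lincomb hY).
under [in RHS]eq_Rintegral do rewrite mul1r X2E -addrA.
rewrite (reg_char T0 hZ htheta hY)//.
under eq_Rintegral do rewrite tiltE X1E -mulrA.
have iGL : P.-integrable setT (EFin \o (fun w =>
    expR (gamma * val (e, x) w) * cos (lincomb val q' w + c0))).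
  apply: (@integrable_le _ _ _ P _ (fun w => expR (gamma * val (e, x) w))).
  - apply: measurable_funM; first by apply: measurableT_comp => //; exact: measurable_funM.
    by apply: (measurableT_comp measurable_cosR); exact: measurable_funD.
  - move=> w; rewrite normrM (ger0_norm (expR_ge0 _)) ler_piMr ?expR_ge0//.
    by rewrite ler_norml cos_geN1 cos_le1.
  - exact: (gaussian_integrable_expR mval gval gamma).
rewrite RintegralZl//.
rewrite (@tilt_char _ _ _ P (fun w => gamma * val (e, x) w) (lincomb val q')
  (gamma ^+ 2 * cov (e, x) (e, x)) (reg_var T theta q') (gamma * c))//.
- rewrite mulrA -expRD [RHS]mulrC (addrC c0); congr (expR _ * cos _).
  by move: (reg_cov T theta _ _) (reg_var _ _ _) => k1 k2; field.
- exact: measurable_funM.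
- by rewrite mulr_ge0 ?sqr_ge0//; case: gval.
- move=> t c1.
  have s'D : List.Forall (fun p => reg_dom p.2) ((t * gamma, (e, x)) :: q').
    exact: List.Forall_cons.
  transitivity (\int[P]_w cos (lincomb val ((t * gamma, (e, x)) :: q') w + c1)).
    apply: eq_Rintegral => w _; rewrite /lincomb big_cons; congr (cos (_ + _)).
    by rewrite addrC mulrA.
  rewrite (reg_char T0 hZ htheta hY)//; congr (_ * expR (- (_ / 2))).
  have cE : 2 * t * (gamma * c) =
      \sum_(j <- q') t * gamma * j.1 * cov (e, x) j.2 +
      \sum_(i <- q') i.1 * (t * gamma) * cov i.2 (e, x).
    rewrite /c !mulr_sumr !big_map -big_split/=.
    elim: qB => [|p q'' pB _ IH]; first by rewrite !big_nil.
    rewrite !big_cons IH reg_crossE//=; congr (_ + _).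
    by move: (reg_cov T theta) => k; field.
  rewrite cE /reg_var; move: (reg_cov T theta) => k; move: {cE s'D q'D X1E X2E iGL mL} q' => q1.
  rewrite big_cons big_cons /=.
  under [X in _ + X = _]eq_bigr do rewrite big_cons.
  rewrite big_split/=; move: (\sum_(_ <- _) _) (\sum_(_ <- _) _) (\sum_(_ <- _) _) => s1 s2 s3.
  by ring.
- exact: (gaussian_integrable_expR mval gval gamma).
Qed.

Variables (A : set (Rd R d)) (C : R).
Hypotheses (mA : measurable A) (A1 : A `<=` eball 1).
Hypothesis AC : forall y, A y -> reg_cross y <= C.

Let b := chaos_weight P Y gamma e' A.

Let b0 y : 0 <= b y. Proof. exact: chaos_weight_ge0. Qed.

Let X2_le y w : b y * expR (gamma * X2 y w) <=
  expR (gamma ^+ 2 * C) * (b y * expR (gamma * X1 y w)).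
Proof.
rewrite /b /chaos_weight indicE; case: (boolP (y \in A)) => [/set_mem yA|_]; last first.
  by rewrite !mul0r mulr0.
rewrite mulrCA; apply: ler_wpM2l; first by rewrite mul1r expR_ge0.
rewrite -expRD ler_expR /X2 mulrDr addrC lerD2r mulrA -expr2.
by apply: ler_wpM2l; [exact: sqr_ge0|exact: AC].
Qed.

Let mX1 : measurable_fun setT (fun z : Rd R d * Omega => X1 z.1 z.2).
Proof.
have [mY _] := hY e'0.
by rewrite (_ : (fun z => _) = Y e')//; apply/funext => -[].
Qed.

Let mX2 : measurable_fun setT (fun z : Rd R d * Omega => X2 z.1 z.2).
Proof.
apply: measurable_funD; first exact: mX1.
apply: measurable_funM => //.
exact: (measurableT_comp measurable_reg_cross measurable_fst).
Qed.

Let mb : measurable_fun setT b.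
Proof. exact: (measurable_chaos_weight hY). Qed.

Let int1 := chaos_integrable_ae T0 hZ htheta hY gamma e'0 mA A1.

Let int2 : {ae P, forall w, leb.-integrable setT
  (EFin \o (fun y => b y * expR (gamma * X2 y w)))}.
Proof.
apply: filterS int1 => w iw.
apply: (@integrable_le _ _ _ leb _ (fun y => expR (gamma ^+ 2 * C) * (b y * expR (gamma * X1 y w)))).
- apply: measurable_funM => //; apply: measurableT_comp => //; apply: measurable_funM => //.
  exact: (measurableT_comp mX2 (pair2_measurable w)).
- by move=> y; rewrite ger0_norm ?X2_le// mulr_ge0 ?b0 ?expR_ge0.
- exact: (integrable_scaler _ iw).
Qed.

(** Under the tilted probability the chaos is multiplied by the density
    [exp (gamma ^ 2 cov (x, y))], which is bounded when [y] stays away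
    from [x]. *)
Lemma chaos_tilt_ge t : 0 <= t ->
  \int[P]_w expR (- (t * (expR (gamma ^+ 2 * C) * mass e' A w))) <=
  \int[P]_w (tilt_weight w * expR (- (t * mass e' A w))).
Proof.
move=> t0.
have i1 : P.-integrable setT (EFin \o (fun=> 1 : R)) by exact: finite_measure_integrable_cst.
have charA s c0 : List.Forall (fun p : R * Rd R d => A p.2) s ->
    \int[P]_w (tilt_weight w * cos (lincomb X1 s w + c0)) =
    \int[P]_w (1 * cos (lincomb X2 s w + c0)).
  move=> sA; apply: chaos_tilt_char.
  by elim: sA => [|p s' pA _ IH]; constructor => //; exact: A1.
have bA y : ~ A y -> b y = 0 by move=> nA; rewrite /b /chaos_weight indicE memNset// mul0r.
have E := @eq_char_eq_laplace R _ _ leb _ _ Omega Omega P P tilt_weight (fun=> 1) X1 X2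
  A gamma b t integrable_tilt_weight i1 mX1 mX2 charA b0
  (integrable_chaos_weight hY gamma e'0 mA A1) bA int1 int2 t0.
have {}E : \int[P]_w (tilt_weight w * expR (- (t * mass e' A w))) =
    \int[P]_w (1 * expR (- (t * exp_mass leb gamma b X2 w))) by exact: E.
rewrite E.
have mm1 : measurable_fun setT (exp_mass leb gamma b X1) by exact: (@measurable_exp_mass _ _ _ leb gamma b b0 mb _ _ X1 mX1).
have mm2 : measurable_fun setT (exp_mass leb gamma b X2) by exact: (@measurable_exp_mass _ _ _ leb gamma b b0 mb _ _ X2 mX2).
have em0 (X : Rd R d -> Omega -> R) w : 0 <= exp_mass leb gamma b X w by exact: (exp_mass_ge0 leb gamma b0).
rewrite (_ : \int[P]_w (1 * _) = \int[P]_w expR (- (t * exp_mass leb gamma b X2 w))); last first.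
  by apply: eq_Rintegral => w _; rewrite mul1r.
have mm : measurable_fun setT (fun w => expR (gamma ^+ 2 * C) * mass e' A w).
  exact: (measurable_funM (measurable_cst _) mm1).
apply: (laplace_le_ae (X := fun w => t * exp_mass leb gamma b X2 w)
    (X' := fun w => t * (expR (gamma ^+ 2 * C) * mass e' A w))).
- exact: (measurable_funM (measurable_cst _) mm2).
- exact: (measurable_funM (measurable_cst _) mm).
- by move=> w; apply: (mulr_ge0 t0); exact: em0.
- by move=> w; apply: (mulr_ge0 t0); apply: mulr_ge0; [exact: expR_ge0|exact: em0].
apply: filterS2 int1 int2 => w i1w i2w.
apply: (ler_wpM2l t0).
rewrite /mass /chaos_mass /exp_mass -RintegralZl; [|exact: measurableT|exact: i1w].
apply: (le_Rintegral measurableT i2w (integrable_scaler _ i1w)) => y _; exact: X2_le.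
Qed.

End chaos_tilting.

(** As the parameter of a Laplace transform grows, only the event where
    the variable vanishes remains. *)
Lemma laplace_at_infty d (Omega : measurableType d) (R : realType) (P : probability Omega R)
    (W X : Omega -> R) (k : R) :
  P.-integrable setT (EFin \o W) -> measurable_fun setT X -> (forall w, 0 <= X w) -> 0 < k ->
  \int[P]_w (W w * expR (- (n%:R * k * X w))) @[n --> \oo] -->
    \int[P]_w (W w * \1_(X @^-1` [set 0]) w).
Proof.
move=> iW mX X0 k0; have mW := integrable_measurable iW.
apply: (@Rintegral_dominated_cvg _ _ _ P _ _ (fun w => `|W w|)).
- move=> n; apply: measurable_funM => //; apply: measurableT_comp => //.
  by apply: measurableT_comp => //; exact: measurable_funM.
- apply: measurable_funM => //; apply: measurable_indic.
  by rewrite -[X in measurable X]setTI; exact: mX.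
- apply: aeW => w; apply: cvgMl_tmp; rewrite indicE.
  have [Xw|Xw] := eqVneq (X w) 0.
    rewrite mem_set//; under eq_cvg do rewrite Xw mulr0 oppr0 expR0.
    exact: cvg_cst.
  rewrite memNset; last by move=> /= /eqP; rewrite (negbTE Xw).
  have kX : 0 < k * X w by rewrite mulr_gt0// lt_def Xw X0.
  under eq_cvg do rewrite -mulrA -mulrN expRM_natl.
  apply: cvg_expr; rewrite ger0_norm ?expR_ge0//.
  by rewrite -expR0 ltr_expR oppr_lt0.
- exact: (integrable_norm iW).
- move=> n w; rewrite normrM ler_piMr// ger0_norm ?expR_ge0//.
  have h : 0 <= n%:R * k * X w by rewrite mulr_ge0// mulr_ge0 ?ler0n// ltW.
  by case/andP: (expRN_le1 h).
Qed.

(** The annulus contains a box with one side in [[1 / 2, 3 / 4]] and all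
    others in [[0, 1 / (4 d)]]. *)
Lemma lebesgueT_annulus_gt0 (R : realType) (d : nat) : (0 < d)%N ->
  (0 < lebesgue_measureT R d (eball (15 / 16) `\` eball 2^-1))%E.
Proof.
case: d => // d _; set n := d.+1.
pose q : R := (4 * n%:R)^-1.
have n0 : 0 < (n%:R : R) by rewrite ltr0n.
have q0 : 0 < q by rewrite invr_gt0 mulr_gt0.
pose I (i : 'I_n) : set (measurableTypeR R) :=
  if i == ord0 then `[2^-1, 3 / 4]%classic else `[0, q]%classic.
have mI i : measurable (I i) by rewrite /I; case: ifP => _; exact: measurable_itv.
have mA : measurable (eball (15 / 16) `\` eball 2^-1 : set (Rd R n)).
  by apply: measurableD; exact: measurable_eball.
have sub : [set x : Rd R n | forall i, I i (tnth x i)] `<=` eball (15 / 16) `\` eball 2^-1.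
  move=> x xI; split; last first.
    rewrite /eball/=; apply/negP; rewrite -leNgt.
    have := xI ord0; rewrite /I eqxx/= in_itv/= => /andP[h _].
    apply: le_trans h _; apply: le_trans (coord_le_edist x ord0).
    exact: ler_norm.
  rewrite /eball/= /edist; set s := \sum_(_ < _) _.
  have s58 : s <= 9 / 16 + 1 / 16.
    apply: (@le_trans _ _ (\sum_(i < n) (9 / 16 * (i == ord0)%:R + q ^+ 2))).
      apply: ler_sum => i _; rewrite tnth_mktuple subr0.
      have := xI i; rewrite /I; case: eqP => [_|_]; rewrite /= in_itv/= => /andP[h1 h2].
        have : 0 <= q ^+ 2 by exact: sqr_ge0.
        have : (tnth x i : R) ^+ 2 <= (3 / 4) ^+ 2.
          by rewrite lerXn2r// nnegrE//; apply: le_trans h1.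
        by move: (tnth x i : R) => y; lra.
      by rewrite mulr0 add0r lerXn2r// nnegrE// ltW.
    rewrite big_split/= -mulr_sumr sumr_const card_ord (bigD1 ord0)//= big1; last first.
      by move=> i /negbTE ->.
    rewrite addr0 mulr1 lerD2l -[_ *+ n]mulr_natr.
    have -> : q ^+ 2 * n%:R = 1 / 16 * n%:R^-1 by rewrite /q; field; rewrite gt_eqF.
    by apply: ler_piMr => //; rewrite invf_le1// ler1n.
  have -> : 15 / 16 = Num.sqrt ((15 / 16) ^+ 2 : R) by rewrite sqrtr_sqr ger0_norm.
  rewrite ltr_sqrt ?exprn_gt0 //.
  by apply: (le_lt_trans s58); lra.
apply: (lt_le_trans _ (le_measure _ _ _ sub)); rewrite ?inE//; last exact: measurable_box.
rewrite [X in (_ < X)%E](lebesgue_measureT_box mI).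
elim/big_ind : _ => [|x y x0 y0|i _]; [by rewrite lte01|exact: mule_gt0|].
rewrite /I; case: ifP => _; rewrite lebesgue_measure_itv/= lte_fin.
  by case: ifPn => [_|/negP[]]; [rewrite -EFinB lte_fin|]; lra.
by rewrite q0 -EFinB subr0 lte_fin.
Qed.

Section chaos_positivity.
Context {R : realType} {d : nat}.
Hypothesis d_gt0 : (0 < d)%N.
Variable T : R.
Hypothesis T0 : 0 < T.
Context {dO : measure_display} {Omega : measurableType dO}.
Variable P : probability Omega R.
Variable Z : signed_measure R d -> {RV P >-> R}.
Hypothesis hZ : log_field T Z.
Variable theta : probability (Rd R d) R.
Hypothesis htheta : mollifier theta.
Variable Y : R -> Rd R d * Omega -> R.
Hypothesis hY : regularization Z theta Y.
Variable gamma : R.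
Variable M : R.-ker Omega ~> Rd R d.
Hypothesis hL : forall A : set (Rd R d), measurable A -> A `<=` eball 1 ->
  (\int[P]_w `|chaos_approx P gamma Y e A w - M w A| @[e --> 0^'+] --> 0)%E.
Local Notation leb := (lebesgue_measureT R d).
Local Notation mass := (chaos_mass P Y gamma).
Implicit Types (r : R) (x y : Rd R d).

Definition null_mass r : set Omega := ball_mass M r @^-1` [set 0].

Let mN r : measurable_fun setT (ball_mass M r).
Proof. by apply: measurable_gmc_fine; exact: measurable_eball. Qed.

Let N0 r w : 0 <= ball_mass M r w.
Proof. exact: fine_ge0. Qed.

Lemma measurable_null_mass r : measurable (null_mass r).
Proof. by rewrite -[X in measurable X]setTI; exact: mN. Qed.

Let i1 : P.-integrable setT (EFin \o (fun=> 1 : R)).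
Proof. exact: finite_measure_integrable_cst. Qed.

Let laplace_null r k : 0 < k ->
  \int[P]_w expR (- (n%:R * k * ball_mass M r w)) @[n --> \oo] --> fine (P (null_mass r)).
Proof.
move=> k0; have := laplace_at_infty i1 (mN r) (N0 r) k0.
have -> : (fun n : nat => \int[P]_w (1 * expR (- (n%:R * k * ball_mass M r w)))) =
    (fun n : nat => \int[P]_w expR (- (n%:R * k * ball_mass M r w))).
  by apply/funext => n; apply: eq_Rintegral => w _; rewrite mul1r.
have -> // : \int[P]_w (1 * \1_(ball_mass M r @^-1` [set 0]) w) = fine (P (null_mass r)).
rewrite /Rintegral; under eq_integral do rewrite mul1r.
by rewrite integral_indic ?setIT//; exact: measurable_null_mass.
Qed.

(** In the self-similarity the random factor is positive, so it does not
    change the event that the mass vanishes. *)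
Lemma null_mass_scale r : 0 < r < 1 -> P (null_mass r) = P (null_mass 1).
Proof.
move=> r01; have r0 : 0 < r by case/andP: r01.
suff E : fine (P (null_mass r)) = fine (P (null_mass 1)).
  by rewrite -[LHS]fineK ?fin_num_measure ?E ?fineK ?fin_num_measure//; exact: measurable_null_mass.
set nu := normal_prob 0 (Num.sqrt (ln r^-1)).
pose k (u : measurableTypeR R) : R := r ^+ d * expR (gamma * u - gamma ^+ 2 / 2 * ln r^-1).
have k0 u : 0 < k u by rewrite mulr_gt0 ?expR_gt0 ?exprn_gt0.
have mk : measurable_fun setT k.
  apply: measurable_funM => //; apply: measurableT_comp => //.
  by apply: measurable_funB => //; exact: measurable_funM.
have nk0 (n : nat) u : 0 <= n%:R * k u by rewrite mulr_ge0// ltW.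
have c1 := @laplace_null r 1 ltr01.
have c2 : \int[nu]_u \int[P]_w expR (- (n%:R * k u * ball_mass M 1 w)) @[n --> \oo] -->
    \int[nu]_u (fine (P (null_mass 1))).
  apply: (@Rintegral_dominated_cvg _ (measurableTypeR R) R nu _ _ (fun=> 1)).
  - move=> n; apply: (@measurable_laplace_mixture _ Omega R P _ (measurableTypeR R) nu
      (fun u => n%:R * k u) (ball_mass M 1) _ (nk0 n) (mN 1) (N0 1)).
    exact: measurable_funM.
  - exact: measurable_cst.
  - by apply: aeW => u; exact: laplace_null.
  - exact: finite_measure_integrable_cst.
  - move=> n u; have mkX : measurable_fun setT (fun w => n%:R * k u * ball_mass M 1 w).
      exact: measurable_funM.
    have /andP[h0 h1] := laplace_bounds P mkX (fun w => mulr_ge0 (nk0 n u) (N0 1 w)).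
    by rewrite ger0_norm.
have E : (fun n : nat => \int[nu]_u \int[P]_w expR (- (n%:R * k u * ball_mass M 1 w))) =
    (fun n : nat => \int[P]_w expR (- (n%:R * 1 * ball_mass M r w))).
  apply/funext => n; under [in RHS]eq_Rintegral do rewrite mulr1.
  exact: (esym (gmc_scaling T0 hZ htheta hY hL r01 (ler0n R n))).
rewrite E in c2; rewrite (cvg_unique _ c1 c2)// Rintegral_cst//.
by rewrite [X in _ * fine X]probability_setT mulr1.
Qed.

(** The two events are nested up to a null set and have the same
    probability. *)
Lemma null_mass_ae r : 0 < r < 1 ->
  {ae P, forall w, null_mass r w -> M w (eball 1) = 0%E}.
Proof.
move=> r01; have [mr m1] := (measurable_null_mass r, measurable_null_mass 1).
have fin := gmc_fin_ae T0 hZ htheta hY hL (measurable_eball 1) (@subset_refl _ _).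
have sub : {ae P, forall w, null_mass 1 w -> null_mass r w}.
  apply: filterS fin => w E N1; move: N1; rewrite /null_mass /preimage/= /ball_mass.
  move=> f0; move: E; rewrite f0 => M0.
  suff -> : M w (eball r) = 0%E by [].
  apply/eqP; rewrite eq_le measure_ge0 andbT -[leRHS]M0.
  apply: le_measure; rewrite ?inE; [exact: measurable_eball|exact: measurable_eball|].
  by move=> x; rewrite /eball/= => /lt_trans; apply; case/andP: r01.
have P10 : P (null_mass 1 `\` null_mass r) = 0%E.
  apply/eqP; rewrite eq_le measure_ge0 andbT; case: sub => [S [mS S0 hS]].
  rewrite -S0; apply: le_measure; rewrite ?inE//; first exact: measurableD.
  by move=> w [n1 nr]; apply: hS => /(_ n1).
have PI : P (null_mass 1 `&` null_mass r) = P (null_mass 1).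
  have h : P (null_mass 1) = (P (null_mass 1 `\` null_mass r) +
      P (null_mass 1 `&` null_mass r))%E by exact: (measureDI P m1 mr).
  by rewrite [RHS]h P10 add0e.
have Pr1 : P (null_mass r `\` null_mass 1) = 0%E.
  have lty : (P (null_mass r) < +oo)%E.
    by apply: le_lt_trans (probability_le1 P mr) _; rewrite ltry.
  have -> : P (null_mass r `\` null_mass 1) = (P (null_mass r) -
      P (null_mass r `&` null_mass 1))%E by exact: (measureD mr m1 lty).
  rewrite setIC PI (null_mass_scale r01) subee//.
  by rewrite fin_num_measure.
have : {ae P, forall w, null_mass r w -> null_mass 1 w}.
  exists (null_mass r `\` null_mass 1); split => //; first exact: measurableD.
  by move=> w /not_implyP.
apply: filterS2 fin => w E h /h; rewrite /null_mass /preimage/= /ball_mass => f0.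
by rewrite E f0.
Qed.

Let far_energy_le e e' x y : 0 < e <= 16^-1 -> 0 < e' <= 16^-1 ->
  eball (15 / 16) x -> 2^-1 <= edist x origin -> eball 4^-1 y ->
  energy T (theta_eps theta e x) (theta_eps theta e' y) <= Num.max 0 (ln (T / 8^-1)) /\
  energy T (theta_eps theta e' y) (theta_eps theta e x) <= Num.max 0 (ln (T / 8^-1)).
Proof.
move=> /andP[e0 e1] /andP[e'0 e'1] xB x2 yB.
have xe : eball (1 - e) x by move: xB; rewrite /eball/= => h; lra.
have ye : eball (1 - e') y by move: yB; rewrite /eball/= => h; lra.
have C0 : 0 <= Num.max 0 (ln (T / 8^-1)) by rewrite le_max lexx.
have far u v : edist u origin <= 1 -> edist v origin <= 1 ->
    8^-1 <= edist (reflect_scale e x u) (reflect_scale e' y v).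
  move=> u1 v1.
  have d1 : edist (reflect_scale e x u) x <= 16^-1.
    rewrite edist_reflect ?(ltW e0)//; apply: le_trans e1.
    by rewrite ler_piMr// ltW.
  have d2 : edist (reflect_scale e' y v) y <= 16^-1.
    rewrite edist_reflect ?(ltW e'0)//; apply: le_trans e'1.
    by rewrite ler_piMr// ltW.
  have t1 := edist_triangle y x origin.
  have t2 := edist_triangle (reflect_scale e x u) x y.
  have t3 := edist_triangle (reflect_scale e' y v) (reflect_scale e x u) y.
  rewrite (edist_sym x (reflect_scale e x u)) in t2.
  by move: yB; rewrite /eball/= => yB; lra.
split; apply: (energy_theta_eps_le htheta) => // u v u1 v1.
- apply: le_trans (log_kernel_le T0 _ (far u v u1 v1)) _ => //.
  by rewrite lee_fin le_max lexx orbT.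
- apply: le_trans (log_kernel_le T0 _ (_ : 8^-1 <= _)) _ => //.
    by rewrite edist_sym; exact: far.
  by rewrite lee_fin le_max lexx orbT.
Qed.

(** The event that the small ball has no mass is not changed by a bounded
    density, hence the tilted probability of it is at least the original
    one. *)
Lemma tilted_null_mass e x : 0 < e <= 16^-1 -> eball (15 / 16) x -> 2^-1 <= edist x origin ->
  fine (P (null_mass 4^-1)) <=
  \int[P]_w (tilt_weight P Y gamma e x w * \1_(null_mass 4^-1) w).
Proof.
move=> e01 xB x2; have /andP[e0 e1] := e01.
have x1 : eball 1 x by move: xB; rewrite /eball/= => h; lra.
pose C := Num.max 0 (ln (T / 8^-1)).
pose A : set (Rd R d) := eball 4^-1.
have mA : measurable A by exact: measurable_eball.
have A1 : A `<=` eball 1 by move=> y; rewrite /A /eball/= => h; lra.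
pose e_ (n : nat) : R := 16^-1 * harmonic n.
have h01 n : 0 < (harmonic n : R) <= 1 by rewrite harmonic_gt0 /harmonic/= invf_le1// ler1n.
have e_01 n : 0 < e_ n <= 16^-1.
  by have /andP[h0 h1] := h01 n; rewrite /e_; apply/andP; split; lra.
have e_0 n : 0 < e_ n by case/andP: (e_01 n).
have ce : e_ @ \oo --> 0.
  by rewrite -(mulr0 16^-1); apply: cvgMl_tmp; exact: cvg_harmonic.
have cross n y : A y -> reg_cross P Y e (e_ n) x y <= C.
  move=> yA; rewrite (reg_crossE T0 hZ htheta hY e0 (e_0 n) x1 (A1 _ yA)).
  have [h1 h2] := far_energy_le e01 (e_01 n) xB x2 yA.
  rewrite ler_pdivrMr// mulr_natr mulr2n; exact: lerD.
have step t : 0 <= t ->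
    \int[P]_w expR (- (t * expR (gamma ^+ 2 * C) * ball_mass M 4^-1 w)) <=
    \int[P]_w (tilt_weight P Y gamma e x w * expR (- (t * ball_mass M 4^-1 w))).
  move=> t0.
  have c1 := gmc_laplace_cvg T0 hZ htheta hY hL e_0 ce mA A1
    (mulr_ge0 t0 (expR_ge0 (gamma ^+ 2 * C))).
  have c2 := gmc_weighted_cvg T0 hZ htheta hY hL
    (measurable_tilt_weight hY gamma x e0) (integrable_tilt_weight2 T0 hZ htheta hY gamma e0 x1)
    (integrable_tilt_weight T0 hZ htheta hY gamma e0 x1) e_0 ce mA A1 t0.
  apply: (ler_cvg_to c1 c2); apply: nearW => n.
  have := chaos_tilt_ge T0 hZ htheta hY gamma e0 (e_0 n) x1 mA A1 (cross n) t0.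
  apply: le_trans; rewrite le_eqVlt; apply/orP; left; apply/eqP.
  by apply: eq_Rintegral => w _; rewrite mulrA.
have c1 := @laplace_null 4^-1 _ (expR_gt0 (gamma ^+ 2 * C)).
have c2 := laplace_at_infty (integrable_tilt_weight T0 hZ htheta hY gamma e0 x1)
  (mN 4^-1) (N0 4^-1) ltr01.
apply: (ler_cvg_to c1 c2); apply: nearW => n.
apply: le_trans (step _ (ler0n R n)) _; rewrite le_eqVlt; apply/orP; left; apply/eqP.
by apply: eq_Rintegral => w _; rewrite mulr1.
Qed.

Let A : set (Rd R d) := eball (15 / 16) `\` eball 2^-1.

Let mA : measurable A.
Proof. by apply: measurableD; exact: measurable_eball. Qed.

Let A1 : A `<=` eball 1.
Proof. by move=> y []; rewrite /eball/= => h _; lra. Qed.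

Let mI : measurable_fun setT (\1_(null_mass 4^-1) : Omega -> R).
Proof. by apply: measurable_indic; exact: measurable_null_mass. Qed.

(** [tilted_null_mass] is integrated over the annulus. On the event, the
    chaos of the unit ball vanishes, so that only the distance between the
    regularized chaos and its limit remains. *)
Lemma null_mass_le_error e : 0 < e <= 16^-1 ->
  (leb A * P (null_mass 4^-1) <= \int[P]_w `|chaos_approx P gamma Y e A w - M w A|)%E.
Proof.
move=> e01; have /andP[e0 e1] := e01.
pose p := fine (P (null_mass 4^-1)).
have pE : P (null_mass 4^-1) = p%:E.
  by rewrite fineK// fin_num_measure//; exact: measurable_null_mass.
pose f (z : Rd R d * Omega) :=
  chaos_weight P Y gamma e A z.1 * expR (gamma * reg_value Y (e, z.1) z.2) *
  \1_(null_mass 4^-1) z.2.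
have f0 z : 0 <= f z by rewrite mulr_ge0// mulr_ge0 ?expR_ge0 ?chaos_weight_ge0.
have mf : measurable_fun setT f.
  apply: measurable_funM; first exact: (measurable_chaos_integrand hY gamma e0 mA).
  exact: (measurableT_comp mI measurable_snd).
have lower x : ((\1_A x * p)%:E <= \int[P]_w (f (x, w))%:E)%E.
  rewrite indicE; case: (boolP (x \in A)) => [/set_mem xA|_]; last first.
    by rewrite mul0r; apply: integral_ge0 => w _; rewrite lee_fin.
  have [xB x2] := xA.
  have {}x2 : 2^-1 <= edist x origin by move: x2; rewrite /eball/= => /negP; rewrite -leNgt.
  have x1 : eball 1 x by exact: A1.
  rewrite mul1r.
  have -> : (\int[P]_w (f (x, w))%:E =
      (\int[P]_w (tilt_weight P Y gamma e x w * \1_(null_mass 4^-1) w))%:E)%E.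
    rewrite /Rintegral fineK.
      apply: eq_integral => w _; rewrite /f /= chaos_integrandE.
      by rewrite indicE mem_set// mul1r.
    apply: (integrable_fin_num measurableT).
    apply: (integrable_le _ _ (integrable_tilt_weight T0 hZ htheta hY gamma e0 x1)).
      by apply: measurable_funM => //; exact: (measurable_tilt_weight hY gamma x e0).
    move=> w; rewrite normrM ger0_norm ?expR_ge0// ler_piMr ?expR_ge0//.
    by rewrite indicE; case: (_ \in _); rewrite ?normr1 ?normr0.
  by rewrite lee_fin; exact: (tilted_null_mass e01 xB x2).
have lowerI : (leb A * P (null_mass 4^-1) <= \int[leb]_x \int[P]_w (f (x, w))%:E)%E.
  have -> : leb A = (\int[leb]_x (\1_A x)%:E)%E by rewrite integral_indic ?setIT.
  rewrite pE muleC -ge0_integralZl//.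
  - apply: ge0_le_integral => //.
    + by move=> x _; rewrite -EFinM lee_fin mulr_ge0// fine_ge0.
    + by apply/measurable_EFinP; apply: measurable_funM => //; exact: measurable_indic.
    + apply: (measurable_fun_fubini_tonelli_F (m2 := P) (fun z => (f z)%:E)) => //.
        exact/measurable_EFinP.
    + by move=> x _; rewrite -EFinM mulrC; exact: lower.
  - by apply/measurable_EFinP; exact: measurable_indic.
  - by rewrite lee_fin fine_ge0.
apply: le_trans lowerI _.
rewrite (fubini_tonelli (m1 := leb) (m2 := P) (fun z => (f z)%:E)); last 2 first.
- exact/measurable_EFinP.
- by move=> z; rewrite lee_fin.
have inner w : (\int[leb]_x (f (x, w))%:E =
    chaos_approx P gamma Y e A w * (\1_(null_mass 4^-1) w)%:E)%E.
  rewrite chaos_approxE// -ge0_integralZr//.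
  - apply/measurable_EFinP.
    exact: (measurableT_comp (measurable_chaos_integrand hY gamma e0 mA) (pair2_measurable w)).
  - by move=> x _; rewrite lee_fin mulr_ge0 ?expR_ge0 ?chaos_weight_ge0.
under eq_integral do rewrite inner.
have mc := measurable_chaos_approx hY gamma e0 mA.
apply: ae_ge0_le_integral => //.
- move=> w _; apply: mule_ge0; last by rewrite lee_fin.
  rewrite chaos_approxE//; apply: integral_ge0 => x _.
  by rewrite lee_fin mulr_ge0 ?expR_ge0 ?chaos_weight_ge0.
- by apply: emeasurable_funM => //; exact/measurable_EFinP.
- apply: measurableT_comp => //; apply: emeasurable_funB => //; exact: measurable_kernel.
have r01 : 0 < (4^-1 : R) < 1 by apply/andP; split; lra.
apply: filterS (null_mass_ae r01) => w Nw _.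
rewrite indicE; case: (boolP (w \in _)) => [/set_mem/Nw M0|_]; last by rewrite mule0 abse_ge0.
rewrite mule1 (_ : M w A = 0%E) ?sube0 ?lee_abs//.
apply/eqP; rewrite eq_le measure_ge0 andbT -[leRHS]M0.
by apply: le_measure; rewrite ?inE//; exact: measurable_eball.
Qed.

(** The lower bound of [null_mass_le_error] does not depend on the scale,
    while its right-hand side tends to zero. *)
Theorem ball_mass_gt0_ae : {ae P, forall w, 0 < ball_mass M 1 w}.
Proof.
have r01 : 0 < (4^-1 : R) < 1 by apply/andP; split; lra.
have Plty : P (null_mass 4^-1) \is a fin_num.
  by rewrite fin_num_measure//; exact: measurable_null_mass.
have A0 : (0 < leb A)%E by exact: lebesgueT_annulus_gt0.
have N00 : P (null_mass 4^-1) = 0%E.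
  apply/eqP; rewrite eq_le measure_ge0 andbT leNgt; apply/negP => p0.
  have ap0 : (0 < leb A * P (null_mass 4^-1))%E by exact: mule_gt0.
  have Alty : leb A \is a fin_num.
    rewrite ge0_fin_numE//; apply: le_lt_trans (@lebesgueT_eball_lty R d).
    by apply: le_measure; rewrite ?inE//; exact: measurable_eball.
  have /fine_cvgP[fin cvg0] := hL mA A1.
  have c0 : 0 < fine (leb A * P (null_mass 4^-1)).
    by apply: fine_gt0; rewrite ap0/= -ge0_fin_numE ?fin_numM// ltW.
  have s0 : 0 < 16^-1 :> R by lra.
  have /cvgrPdist_lt/(_ _ c0) small := cvg0.
  have [e [[e0 e1] [fe se]]] := @filter_ex _ _ (at_right_proper_filter 0) _
    (filterI (filterI (nbhs_right_gt 0) (nbhs_right_le s0)) (filterI fin small)).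
  have e01 : 0 < e <= 16^-1 by apply/andP; split.
  have := null_mass_le_error e01.
  rewrite -[leLHS]fineK ?fin_numM// -[leRHS]fineK// lee_fin leNgt => /negP; apply.
  by move: se; rewrite sub0r normrN; apply: le_lt_trans; exact: ler_norm.
have N10 : P (null_mass 1) = 0%E by rewrite -N00; exact: (esym (null_mass_scale r01)).
exists (null_mass 1); split => //; first exact: measurable_null_mass.
move=> w /= h; rewrite /null_mass/=; apply/eqP; apply/negP => /negP nz.
by apply: h; rewrite lt_def nz N0.
Qed.

End chaos_positivity.

(** * The function kappa as a Gaussian transform *)

Section exponential_substitution.
Context {R : realType}.
Local Notation leb := (@lebesgue_measure R).

Lemma derive1_mul_expR (m y : R) : (fun y => m * expR y)^`()%classic y = m * expR y.
Proof. by rewrite derive1Ml// derive1E derive_val. Qed.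

(** The change of variables is made on the bounded intervals [[- n, n]],
    on which the derivative has limits at both ends, and then [n] grows. *)
Lemma ge0_integral_expR_subst (m : R) (G : R -> R) : 0 < m ->
  measurable_fun setT G -> (forall t, 0 < t -> {for t, continuous G}) ->
  (forall t, 0 < t -> 0 <= G t) ->
  (\int[leb]_(t in `]0%R, +oo[) (G t)%:E = \int[leb]_y (G (m * expR y) * (m * expR y))%:E)%E.
Proof.
move=> m0 mG cG G0.
pose F y := m * expR y.
have F0 y : 0 < F y by rewrite mulr_gt0 ?expR_gt0.
have dF : F^`()%classic = F by apply/funext => y; exact: derive1_mul_expR.
have cF : continuous F.
  by move=> y; apply: cvgMl_tmp; exact: continuous_expR.
have dvF y : derivable F y 1 by apply: derivableM.
pose I (n : nat) : set R := `[F (- n%:R), F n%:R]%classic.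
pose J (n : nat) : set R := `[- n%:R, n%:R]%classic.
have finite (n : nat) : (\int[leb]_(t in I n) (G t)%:E =
    \int[leb]_(y in J n) (G (F y) * F y)%:E)%E.
  rewrite /I /J (@integration_by_substitution_increasing _ F G).
  - by rewrite dF.
  - by rewrite ge0_cp// lerNl oppr0 ler0n.
  - by move=> x y _ _ xy; rewrite ltr_pM2l// ltr_expR.
  - by move=> y _; rewrite dF; exact: cF.
  - by rewrite dF; apply/cvg_ex; exists (F (- n%:R)); apply: cvg_at_right_filter; exact: cF.
  - by rewrite dF; apply/cvg_ex; exists (F n%:R); apply: cvg_at_left_filter; exact: cF.
  - split.
    + by move=> y _; exact: dvF.
    + by apply: cvg_at_right_filter; exact: cF.
    + by apply: cvg_at_left_filter; exact: cF.
  - apply: continuous_in_subspaceT => t; rewrite inE/= in_itv/= => /andP[t0 _].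
    by apply: cG; apply: lt_le_trans t0.
have c1 : (\int[leb]_(t in I n) (G t)%:E @[n --> \oo] -->
    \int[leb]_(t in `]0%R, +oo[) (G t)%:E)%E.
  have -> : `]0%R, +oo[%classic = \bigcup_n I n.
    apply/seteqP; split => t /=.
      rewrite in_itv/= andbT => t0.
      pose u := ln (t / m).
      have tE : F u = t by rewrite /F /u lnK ?posrE ?divr_gt0// mulrCA divff ?mulr1// gt_eqF.
      have := archi_boundP (normr_ge0 u); set n := Num.bound _ => un.
      exists n => //; rewrite /I/= in_itv/= -tE !ler_pM2l// !ler_expR -ler_norml.
      exact: ltW.
    by move=> [n _]; rewrite /I/= !in_itv/= andbT => /andP[+ _]; apply: lt_le_trans.
  apply: ge0_nondecreasing_set_cvg_integral.
  - move=> i j ij; apply/subsetPset => t; rewrite /I /J/= !in_itv/= => /andP[h1 h2].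
    apply/andP; split.
      by apply: le_trans h1; rewrite ler_pM2l// ler_expR lerN2 ler_nat.
    by apply: le_trans h2 _; rewrite ler_pM2l// ler_expR ler_nat.
  - by move=> n; exact: measurable_itv.
  - by move=> n; apply: measurable_funTS; exact/measurable_EFinP.
  - move=> n t; rewrite /I/= in_itv/= => /andP[h _]; rewrite lee_fin G0//.
    exact: lt_le_trans h.
have c2 : (\int[leb]_(y in J n) (G (F y) * F y)%:E @[n --> \oo] -->
    \int[leb]_y (G (F y) * F y)%:E)%E.
  have <- : \bigcup_n J n = [set: R].
    apply/seteqP; split => // t _.
    have [n hn] : exists n : nat, `|t| < n%:R.
      by exists (Num.bound `|t|); exact: archi_boundP.
    by exists n => //; rewrite /J/= in_itv/= -ler_norml ltW.
  apply: ge0_nondecreasing_set_cvg_integral.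
  - move=> i j ij; apply/subsetPset => t; rewrite /I /J/= !in_itv/= => /andP[h1 h2].
    apply/andP; split.
      by apply: le_trans h1; rewrite lerN2 ler_nat.
    by apply: le_trans h2 _; rewrite ler_nat.
  - by move=> n; exact: measurable_itv.
  - move=> n; apply: measurable_funTS; apply/measurable_EFinP.
    have mF : measurable_fun setT F by exact: measurable_funM.
    by apply: measurable_funM => //; exact: measurableT_comp.
  - by move=> n t _; rewrite lee_fin mulr_ge0 ?G0// ltW.
by move: c1; rewrite (funext finite) => c1; exact: (cvg_unique _ c1 c2).
Qed.

End exponential_substitution.

Section independent_exponential.
Context {R : realType} {dO : measure_display} {Omega : measurableType dO}.
Variable P : probability Omega R.
Variable T1 : {RV P >-> R}.
Hypothesis hT1 : exponential_RV P 1 T1.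
Variable X : Omega -> R.
Hypothesis mX : measurable_fun setT X.
Hypothesis indep : independent_RV P T1 X.
Local Notation leb := (@lebesgue_measure R).

(** Independence is a statement on rectangles, which determine the joint
    law. *)
Lemma integral_independent_exponential (g : R * R -> \bar R) :
  measurable_fun setT (g : measurableTypeR R * measurableTypeR R -> \bar R) ->
  (forall z, 0 <= g z)%E ->
  (\int[P]_w g (T1 w, X w) =
   \int[P]_w \int[leb]_t (g (t, X w) * (exponential_pdf 1 t)%:E))%E.
Proof.
move=> mg g0.
pose Xm : {RV P >-> measurableTypeR R} :=
  HB.pack X (isMeasurableFun.Build _ _ _ (measurableTypeR R) X mX).
pose Tm : {RV P >-> measurableTypeR R} :=
  HB.pack (T1 : Omega -> R)
    (isMeasurableFun.Build _ _ _ (measurableTypeR R) (T1 : Omega -> R) (measurable_funPT T1)).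
have mpair : measurable_fun setT (fun w => (Tm w, Xm w)) by exact: measurable_fun_pair.
pose joint := measure_function_pushforward__canonical__measure_function_Measure P mpair.
transitivity (\int[joint]_z g z)%E.
  by rewrite ge0_integral_pushforward// => z _; exact: g0.
pose m1 := [the probability _ R of distribution P Tm].
pose m2 := [the probability _ R of distribution P Xm].
rewrite (eq_measure_integral (m1 \x m2)%E); last first.
  move=> A mA _; symmetry; exact: product_measure_unique.
rewrite fubini_tonelli2//.
rewrite ge0_integral_pushforward//; last 2 first.
- exact: (measurable_fun_fubini_tonelli_G (m1 := m1) g).
- by move=> x _; exact: integral_ge0.
apply: eq_integral => w _ /=.
rewrite /fubini_G /=.
apply: (@ge0_integral_density _ _ R leb m1 (exponential_pdf 1) (fun t => g (t, X w))) => //.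
- exact: measurable_exponential_pdf.
- by move=> t; exact: exponential_pdf_ge0.
- exact: (measurableT_comp mg (pair2_measurable (X w))).
Qed.

(** The substitution [t = m e ^ y], after which the logarithm of [t / m]
    is the integration variable. *)
Lemma integral_exponential_scale (m c s : R) : 0 < m ->
  (\int[leb]_t ((m^-1 * expR ((c - 1) * ln (t / m) - s * ln (t / m) ^+ 2))%:E *
     (exponential_pdf 1 t)%:E) =
   \int[leb]_y (expR (- (expR y * m)) * expR (c * y - s * y ^+ 2))%:E)%E.
Proof.
move=> m0.
pose G t := m^-1 * expR ((c - 1) * ln (t / m) - s * ln (t / m) ^+ 2) * expR (- t).
have mln : measurable_fun setT (fun t : R => ln (t / m)).
  by apply: measurableT_comp => //; exact: measurable_funM.
have mG : measurable_fun setT G.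
  apply: measurable_funM; last by apply: measurableT_comp => //.
  apply: measurable_funM => //; apply: measurableT_comp => //.
  apply: measurable_funB; apply: measurable_funM => //.
  exact: measurable_funX.
have mG0 t : 0 <= G t by rewrite !mulr_ge0 ?expR_ge0// invr_ge0 ltW.
transitivity (\int[leb]_(t in `]0%R, +oo[) (G t)%:E)%E.
  rewrite [RHS]integral_mkcond; apply: ae_eq_integral => //.
  - under eq_fun do rewrite -EFinM; apply/measurable_EFinP.
    apply: measurable_funM; last exact: measurable_exponential_pdf.
    apply: measurable_funM => //; apply: measurableT_comp => //.
    apply: measurable_funB; apply: measurable_funM => //.
    exact: measurable_funX.
  - by apply/(measurable_restrictT _ _).1 => //; apply: measurable_funTS; exact/measurable_EFinP.
  - exists [set 0]; split; [exact: measurable_set1|exact: lebesgue_measure_set1|].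
    move=> t /=; apply: contra_notP => t0 _; rewrite patchE.
    case: (ltrgtP t 0) t0 => [t0 _|t0 _|-> /(_ erefl) //].
      rewrite lt0_exponential_pdf// mule0 memNset//= in_itv/= andbT.
      by move=> /(lt_trans t0); rewrite ltxx.
    rewrite exponential_pdfE ?ltW// mem_set/= ?in_itv/= ?t0//.
    by rewrite /G -EFinM mulN1r mul1r.
rewrite (ge0_integral_expR_subst m0 mG)//; last first.
  move=> t t0.
  have cln : (fun t => ln (t / m)) @ t --> ln (t / m).
    apply: continuous_cvg; first by apply: continuous_ln; rewrite divr_gt0.
    by apply: cvgMr_tmp; exact: cvg_id.
  rewrite /prop_for /continuous_at /G; apply: cvgM; last first.
    by apply: continuous_cvg; [exact: continuous_expR|apply: cvgN; exact: cvg_id].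
  apply: cvgMl_tmp; apply: continuous_cvg; first exact: continuous_expR.
  apply: cvgB; first exact: cvgMl_tmp.
  by apply: cvgMl_tmp; rewrite expr2; under eq_cvg do rewrite expr2; exact: cvgM.
apply: eq_integral => y _; congr EFin; rewrite /G.
rewrite mulrAC (mulrC m (expR y)) mulfK ?gt_eqF// expRK.
have -> : expR (c * y - s * y ^+ 2) = expR ((c - 1) * y - s * y ^+ 2) * expR y.
  by rewrite -expRD; congr expR; ring.
by field; rewrite gt_eqF.
Qed.

(** The Laplace transform in a logarithmic parameter, in which dilations
    of the mass are translations. *)
Definition laplace_log (y : R) : R := \int[P]_w expR (- (expR y * X w)).

Hypothesis X_gt0 : {ae P, forall w, 0 < X w}.
Hypothesis X_ge0 : forall w, 0 <= X w.

Lemma measurable_laplace_integrand :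
  measurable_fun setT (fun z : measurableTypeR R * Omega => expR (- (expR z.1 * X z.2))).
Proof.
apply: measurableT_comp => //; apply: measurableT_comp => //; apply: measurable_funM.
  exact: (measurableT_comp (@measurable_expR R) measurable_fst).
exact: (measurableT_comp mX measurable_snd).
Qed.

Let laplace_logE y : (\int[P]_w (expR (- (expR y * X w)))%:E = (laplace_log y)%:E)%E.
Proof.
rewrite /laplace_log /Rintegral fineK//; apply: (integrable_fin_num measurableT).
apply: (@integrable_bounded _ _ _ P _ 1).
  exact: (measurableT_comp measurable_laplace_integrand (pair1_measurable y)).
move=> w; rewrite ger0_norm ?expR_ge0//.
by case/andP: (expRN_le1 (mulr_ge0 (expR_ge0 y) (X_ge0 w))).
Qed.

Lemma kappa_integral (b s x : R) :
  kappa P b T1 X s x =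
  (\int[leb]_y (laplace_log y * expR ((x / 2 - b) * y - s / 4 * y ^+ 2))%:E)%E.
Proof.
rewrite /kappa unlock.
pose c := x / 2 - b.
pose g (z : R * R) : \bar R :=
  (z.2^-1 * expR ((c - 1) * ln (z.1 / z.2) - s / 4 * ln (z.1 / z.2) ^+ 2))%:E.
pose h y w : R := expR (- (expR y * X w)) * expR (c * y - s / 4 * y ^+ 2).
have mh : measurable_fun setT (fun z : measurableTypeR R * Omega => (h z.1 z.2)%:E).
  apply/measurable_EFinP; apply: measurable_funM; first exact: measurable_laplace_integrand.
  apply: measurableT_comp => //; apply: measurable_funB; apply: measurable_funM => //.
  by apply: measurable_funX; exact: measurable_fst.
have h0 z : (0 <= (h z.1 z.2)%:E)%E by rewrite lee_fin mulr_ge0 ?expR_ge0.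
have mX' := mX.
have mV : measurable_fun setT (fun z : measurableTypeR R * measurableTypeR R => z.2^-1).
  exact: (measurableT_comp (@measurable_invr R) measurable_snd).
have mq : measurable_fun setT (fun z : measurableTypeR R * measurableTypeR R => ln (z.1 / z.2)).
  apply: measurableT_comp; first exact: measurable_ln.
  by apply: measurable_funM => //; exact: measurable_fst.
pose G t m : R := m^-1 * expR ((c - 1) * ln (t / m) - s / 4 * ln (t / m) ^+ 2).
have mG : measurable_fun setT (fun z : measurableTypeR R * measurableTypeR R => G z.1 z.2).
  apply: measurable_funM => //; apply: measurableT_comp => //.
  by apply: measurable_funB; apply: measurable_funM => //; exact: measurable_funX.
(* nonnegative everywhere, also off the range of the mass *)
pose Gp z := Num.max (G z.1 z.2) 0.
transitivity (\int[P]_w (Gp (T1 w, X w))%:E)%E.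
  apply: eq_integral => w _; rewrite /Gp /G /= max_l//.
  by rewrite mulr_ge0 ?expR_ge0// invr_ge0.
rewrite (integral_independent_exponential (g := fun z => (Gp z)%:E)); last 2 first.
- by apply/measurable_EFinP; exact: measurable_maxr.
- by move=> z; rewrite lee_fin le_max lexx orbT.
transitivity (\int[P]_w \int[leb]_y (h y w)%:E)%E.
  apply: ae_eq_integral => //.
  - apply: (measurable_fun_fubini_tonelli_G (m1 := leb)
      (fun z : measurableTypeR R * Omega => ((Gp (z.1, X z.2))%:E * (exponential_pdf 1 z.1)%:E)%E)).
      apply: emeasurable_funM; apply/measurable_EFinP.
        apply: measurable_maxr => //.
        apply: (measurableT_comp mG (g := fun z : measurableTypeR R * Omega => (z.1, X z.2))).
        apply: measurable_fun_pair; first exact: measurable_fst.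
        exact: (measurableT_comp mX measurable_snd).
      exact: (measurableT_comp (@measurable_exponential_pdf R 1) measurable_fst).
    move=> z; apply: mule_ge0; rewrite lee_fin ?exponential_pdf_ge0//.
    by rewrite le_max lexx orbT.
  - by apply: (measurable_fun_fubini_tonelli_G (m1 := leb)
      (fun z : measurableTypeR R * Omega => (h z.1 z.2)%:E)).
  - apply: filterS X_gt0 => w Xw _; rewrite -(integral_exponential_scale _ _ Xw).
    apply: eq_integral => t _; congr (_%:E * _)%E; rewrite /Gp /G /= max_l//.
    by rewrite mulr_ge0 ?expR_ge0// invr_ge0 ltW.
rewrite -(fubini_tonelli (m1 := leb) (m2 := P)
  (fun z : measurableTypeR R * Omega => (h z.1 z.2)%:E))//.
apply: eq_integral => y _; rewrite /fubini_F /= EFinM -laplace_logE -ge0_integralZr//.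
by apply/measurable_EFinP; exact: (measurableT_comp measurable_laplace_integrand (pair1_measurable y)).
Qed.

End independent_exponential.

(** A Gaussian average is a convolution with a Gaussian density, written
    so that the exponent can be expanded. *)
Lemma gaussian_affine_integral (R : realType) (Q : R -> R) (gamma s m : R) :
  measurable_fun setT Q -> (forall y, 0 <= Q y) -> 0 < gamma -> 0 < s ->
  (\int[normal_prob 0 s]_u (Q (gamma * u + m))%:E =
   ((Num.sqrt (2 * pi * (gamma ^+ 2 * s ^+ 2)))^-1)%:E *
   \int[lebesgue_measure]_y
     (Q y * expR (- ((y - m) ^+ 2 / (2 * (gamma ^+ 2 * s ^+ 2)))))%:E)%E.
Proof.
move=> mQ Q0 g0 s0.
have mQa : measurable_fun setT (fun u => Q (gamma * u + m)).
  by apply: measurableT_comp => //; apply: measurable_funD => //; exact: measurable_funM.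
rewrite (ge0_integral_normal_prob 0 s (f := fun u => (Q (gamma * u + m))%:E)); last 2 first.
- exact/measurable_EFinP.
- by move=> u; rewrite lee_fin.
have mG : measurable_fun setT (fun y => Q y * expR (- ((y - m) ^+ 2 / (2 * (gamma ^+ 2 * s ^+ 2))))).
  apply: measurable_funM => //; apply: measurableT_comp => //; apply: measurableT_comp => //.
  apply: measurable_funM => //; apply: measurable_funX; exact: measurable_funB.
rewrite (ge0_integral_affine m g0 (f := fun y =>
  (Q y * expR (- ((y - m) ^+ 2 / (2 * (gamma ^+ 2 * s ^+ 2)))))%:E)); last 2 first.
- exact/measurable_EFinP.
- by move=> y; rewrite lee_fin mulr_ge0 ?expR_ge0.
have mGa : measurable_fun setT (fun x => Q (gamma * x + m) *
    expR (- ((gamma * x + m - m) ^+ 2 / (2 * (gamma ^+ 2 * s ^+ 2))))).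
  by apply: (measurableT_comp mG); apply: measurable_funD => //; exact: measurable_funM.
rewrite -ge0_integralZl//; last 3 first.
- exact/measurable_EFinP.
- by move=> x _; rewrite lee_fin mulr_ge0 ?expR_ge0.
- by rewrite lee_fin ltW.
rewrite -ge0_integralZl//; last 2 first.
- by apply: measurable_funeM; exact/measurable_EFinP.
- by move=> x _; rewrite -EFinM lee_fin mulr_ge0 ?(ltW g0)// mulr_ge0 ?expR_ge0.
apply: eq_integral => u _; rewrite -!EFinM; congr EFin.
have g2 : Num.sqrt (gamma ^+ 2) = gamma by rewrite sqrtr_sqr ger0_norm// ltW.
have E : Num.sqrt (2 * pi * (gamma ^+ 2 * s ^+ 2)) = gamma * Num.sqrt (s ^+ 2 * pi *+ 2).
  rewrite -{2}g2 -sqrtrM ?sqr_ge0//; congr Num.sqrt.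
  by rewrite -[RHS]/(_ * (_ *+ 2)) -mulr_natr; ring.
rewrite normal_pdfE ?gt_eqF// /normal_peak /normal_fun subr0 addrK E invfM.
have -> : - u ^+ 2 / (s ^+ 2 *+ 2) = - ((gamma * u) ^+ 2 / (2 * (gamma ^+ 2 * s ^+ 2))).
  by rewrite -[s ^+ 2 *+ 2]mulr_natr; field; rewrite !gt_eqF.
move: (expR _) (Q _) => A B.
set S := Num.sqrt _.
by rewrite [RHS]mulrCA !mulrA mulfV ?gt_eqF// mul1r; ring.
Qed.

(** * Calculus of the Gaussian transform *)

Section gaussian_integrals.
Context {R : realType}.
Local Notation leb := (@lebesgue_measure R).

(** The integral of [exp (- q y ^ 2)], expressed by the normalization
    constant of the normal density. *)
Definition gauss_total (q : R) : R := (normal_peak (Num.sqrt (2 * q)^-1))^-1.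

Lemma gauss_total_gt0 q : 0 < q -> 0 < gauss_total q.
Proof.
move=> q0; rewrite invr_gt0 normal_peak_gt0// gt_eqF// sqrtr_gt0 invr_gt0.
by rewrite mulr_gt0.
Qed.

Let gaussE q m y : 0 < q -> expR (- (q * (y - m) ^+ 2)) =
  gauss_total q * normal_pdf m (Num.sqrt (2 * q)^-1) y.
Proof.
move=> q0; set s := Num.sqrt _.
have s0 : s != 0 by rewrite gt_eqF// sqrtr_gt0 invr_gt0 mulr_gt0.
rewrite normal_pdfE// /gauss_total -/s mulKf ?gt_eqF ?normal_peak_gt0//.
rewrite /normal_fun sqr_sqrtr ?invr_ge0 ?mulr_ge0 ?ltW//; congr expR.
by rewrite -[_ *+ 2]mulr_natr; field; rewrite gt_eqF.
Qed.

Lemma integral_gauss q m : 0 < q ->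
  (\int[leb]_y (expR (- (q * (y - m) ^+ 2)))%:E = (gauss_total q)%:E)%E.
Proof.
move=> q0; under eq_integral do rewrite gaussE// EFinM.
rewrite ge0_integralZl//.
- by rewrite integral_normal_pdf mule1.
- by apply/measurable_EFinP; exact: measurable_normal_pdf.
- by move=> y _; rewrite lee_fin normal_pdf_ge0.
- by rewrite lee_fin ltW// gauss_total_gt0.
Qed.

Lemma integrable_gauss q m : 0 < q ->
  leb.-integrable setT (EFin \o (fun y => expR (- (q * (y - m) ^+ 2)))).
Proof.
move=> q0; under [X in EFin \o X]eq_fun do rewrite gaussE//.
exact: (integrable_scaler _ (integrable_normal_pdf _ _)).
Qed.

Lemma integrable_expR_quadratic A q : 0 < q ->
  leb.-integrable setT (EFin \o (fun y => expR (A * y - q * y ^+ 2))).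
Proof.
move=> q0.
have E y : expR (A * y - q * y ^+ 2) =
    expR (A ^+ 2 / (4 * q)) * expR (- (q * (y - A / (2 * q)) ^+ 2)).
  by rewrite -expRD; congr expR; field; rewrite gt_eqF.
under [X in EFin \o X]eq_fun do rewrite E.
exact: (integrable_scaler _ (integrable_gauss _ q0)).
Qed.

Lemma is_derive_expR_affine (C p q x : R) :
  is_derive x 1 (fun x => C * expR (p * x + q)) (p * (C * expR (p * x + q))).
Proof.
pose g (x : R) : R := p * x + q.
have h : is_derive x 1 g p.
  by apply: is_derive_eq; rewrite addr0 /GRing.scale/= mulr1.
have h2 : is_derive x 1 (expR \o g) (expR (g x) *: p).
  exact: is_derive1_comp (is_derive_expR (g x)) h.
have h3 := is_deriveZ C h2.
rewrite (_ : p * _ = C *: (expR (g x) *: p)); first exact: h3.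
by rewrite /GRing.scale/= /g; ring.
Qed.

(** Differentiation under the integral sign for a mixture of exponentials
    of affine functions; it covers both the variable [z] and the variable
    [s]. *)
Lemma derive_exponential_family (C p q G : R -> R) (u v a : R) : u < a < v ->
  (forall x, u < x < v -> leb.-integrable setT (EFin \o (fun y => C y * expR (p y * x + q y)))) ->
  (forall y, 0 <= G y) -> leb.-integrable setT (EFin \o G) ->
  (forall x y, u < x < v -> `|p y * (C y * expR (p y * x + q y))| <= G y) ->
  let F x := \int[leb]_y (C y * expR (p y * x + q y)) in
  derivable F a 1 /\ derive1 F a = \int[leb]_y (p y * (C y * expR (p y * a + q y))).
Proof.
move=> uav iC G0 iG CG F.
pose f x y := C y * expR (p y * x + q y).
have Ia : `]u, v[%classic a by rewrite /= in_itv.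
have df x y : derivable (f^~ y) x 1 by have [] := is_derive_expR_affine (C y) (p y) (q y) x.
have pE x y : partial1of2 f x y = p y * (C y * expR (p y * x + q y)).
  rewrite /partial1of2 derive1E.
  by have h := is_derive_expR_affine (C y) (p y) (q y) x; rewrite derive_val.
have i' x : `]u, v[%classic x -> leb.-integrable setT (EFin \o f x).
  by rewrite /= in_itv/= => xuv; exact: iC.
have b' x y : `]u, v[%classic x -> setT y -> `|partial1of2 f x y| <= G y.
  by rewrite /= in_itv/= => xuv _; rewrite pE; exact: CG.
split.
  exact: (derivable_under_integral measurableT Ia i' (fun x y _ _ => df x y) G0 iG b').
rewrite (differentiation_under_integral measurableT Ia i' (fun x y _ _ => df x y) G0 iG b').
by apply: eq_Rintegral => y _; rewrite pE.
Qed.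

End gaussian_integrals.

Section gaussian_transform.
Context {R : realType}.
Local Notation leb := (@lebesgue_measure R).
Variable Q : R -> R.
Hypothesis mQ : measurable_fun setT Q.
Hypothesis Q_gt0 : forall y, 0 < Q y.
Hypothesis Q_le1 : forall y, Q y <= 1.
Variable b : R.
Implicit Types (s z y : R) (k : nat).

Definition gauss_kernel s z y : R := expR ((z / 2 - b) * y - s / 4 * y ^+ 2).

Definition gauss_transform s z : \bar R :=
  (\int[leb]_y (Q y * gauss_kernel s z y)%:E)%E.

(** Each derivative in [z] or [s] only changes the power of [y]. *)
Definition gauss_moment k s z : R := \int[leb]_y (Q y * y ^+ k * gauss_kernel s z y).

Lemma measurable_gauss_kernel s z : measurable_fun setT (gauss_kernel s z).
Proof.
apply: measurableT_comp => //; apply: measurable_funB; apply: measurable_funM => //.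
Qed.

Lemma measurable_transform_integrand s z :
  measurable_fun setT (fun y => Q y * gauss_kernel s z y).
Proof. by apply: measurable_funM => //; exact: measurable_gauss_kernel. Qed.

Lemma transform_integrand_ge0 s z y : 0 <= Q y * gauss_kernel s z y.
Proof. by rewrite mulr_ge0 ?expR_ge0// ltW. Qed.

Lemma gauss_transformE s z : fine (gauss_transform s z) = gauss_moment 0 s z.
Proof.
rewrite /gauss_transform /gauss_moment /Rintegral; congr fine.
by apply: eq_integral => y _; rewrite expr0 mulr1.
Qed.

Lemma integrable_gauss_kernel s z : 0 < s -> leb.-integrable setT (EFin \o gauss_kernel s z).
Proof. by move=> s0; apply: integrable_expR_quadratic; rewrite divr_gt0. Qed.

(** Growth of the kernel in [y] is absorbed by moving [z] in both
    directions. *)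
Lemma gauss_kernel_shift s z c y : expR (c * `|y|) * gauss_kernel s z y <=
  gauss_kernel s (z + 2 * c) y + gauss_kernel s (z - 2 * c) y.
Proof.
have E e : gauss_kernel s (z + 2 * e) y = expR (e * y) * gauss_kernel s z y.
  by rewrite /gauss_kernel -expRD; congr expR; field.
have -> : z - 2 * c = z + 2 * (- c) by ring.
by rewrite !E -mulrDl ler_wpM2r ?expR_ge0// expR_normr_le.
Qed.

Lemma moment_integrand_le k s z y : `|Q y * y ^+ k * gauss_kernel s z y| <=
  k%:R ^+ k * (gauss_kernel s (z + 2) y + gauss_kernel s (z - 2) y).
Proof.
rewrite !normrM (ger0_norm (ltW (Q_gt0 y))) (ger0_norm (expR_ge0 _)) normrX.
apply: (@le_trans _ _ (k%:R ^+ k * (expR (1 * `|y|) * gauss_kernel s z y))).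
  rewrite mulrA ler_wpM2r ?expR_ge0// mul1r.
  apply: le_trans (expR_ge_powr k (normr_ge0 y)).
  by rewrite ler_piMl// exprn_ge0.
rewrite ler_wpM2l ?exprn_ge0//; have := gauss_kernel_shift s z 1 y.
by rewrite !mulr1.
Qed.

Lemma integrable_moment k s z : 0 < s ->
  leb.-integrable setT (EFin \o (fun y => Q y * y ^+ k * gauss_kernel s z y)).
Proof.
move=> s0; apply: (@integrable_le _ _ _ leb _
  (fun y => k%:R ^+ k * (gauss_kernel s (z + 2) y + gauss_kernel s (z - 2) y))).
- apply: measurable_funM; last exact: measurable_gauss_kernel.
  by apply: measurable_funM => //; exact: measurable_funX.
- by move=> y; exact: moment_integrand_le.
- by apply/integrable_scaler/integrable_addr; exact: integrable_gauss_kernel.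
Qed.

Lemma gauss_transform_fin s z : 0 < s -> gauss_transform s z \is a fin_num.
Proof.
move=> s0; have := integrable_fin_num measurableT (integrable_moment 0 z s0).
by rewrite /gauss_transform; congr (_ \is a fin_num); apply: eq_integral => y _ /=;
  rewrite expr0 mulr1.
Qed.

Lemma gauss_moment_derive_z k s z : 0 < s ->
  derivable (gauss_moment k s) z 1 /\
  derive1 (gauss_moment k s) z = gauss_moment k.+1 s z / 2.
Proof.
move=> s0.
pose C y := Q y * y ^+ k; pose p y := y / 2; pose q y := - b * y - s / 4 * y ^+ 2.
have fE x y : C y * expR (p y * x + q y) = Q y * y ^+ k * gauss_kernel s x y.
  by rewrite /gauss_kernel /C /p /q; congr (_ * expR _); field.
(* [z + 3] and [z - 3]: a shift by one for [z] in the interval and by two for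
   the power of [y] *)
pose G y := k.+1%:R ^+ k.+1 * (gauss_kernel s (z + 3) y + gauss_kernel s (z - 3) y).
have G0 y : 0 <= G y by rewrite mulr_ge0 ?exprn_ge0// addr_ge0 ?expR_ge0.
have iG : leb.-integrable setT (EFin \o G).
  by apply/integrable_scaler/integrable_addr; exact: integrable_gauss_kernel.
have zz : z - 1 < z < z + 1 by apply/andP; split; lra.
have iC x : z - 1 < x < z + 1 ->
    leb.-integrable setT (EFin \o (fun y => C y * expR (p y * x + q y))).
  by move=> _; under [X in EFin \o X]eq_fun do rewrite fE; exact: integrable_moment.
have CG x y : z - 1 < x < z + 1 -> `|p y * (C y * expR (p y * x + q y))| <= G y.
  move=> /andP[xl xr]; rewrite fE.
  have -> : p y * (Q y * y ^+ k * gauss_kernel s x y) =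
      2^-1 * (Q y * y ^+ k.+1 * gauss_kernel s x y) by rewrite /p exprS; ring.
  rewrite normrM ger0_norm//.
  apply: (@le_trans _ _ `|Q y * y ^+ k.+1 * gauss_kernel s x y|).
    by rewrite ler_piMl// invf_le1// ler1n.
  rewrite !normrM (ger0_norm (ltW (Q_gt0 y))) (ger0_norm (expR_ge0 _)) normrX.
  have kx : gauss_kernel s x y <= expR (2^-1 * `|y|) * gauss_kernel s z y.
    rewrite /gauss_kernel -expRD ler_expR.
    have -> : (x / 2 - b) * y = (x - z) * y / 2 + (z / 2 - b) * y by field.
    rewrite -addrA lerD2r.
    have : (x - z) * y <= `|y|.
      apply: le_trans (ler_norm _) _; rewrite normrM ler_piMl//.
      by rewrite ler_norml; apply/andP; split; lra.
    by lra.
  have ky : Q y * `|y| ^+ k.+1 <= k.+1%:R ^+ k.+1 * expR `|y|.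
    apply: le_trans (expR_ge_powr k.+1 (normr_ge0 y)).
    by rewrite ler_piMl// exprn_ge0.
  apply: (@le_trans _ _ (k.+1%:R ^+ k.+1 * expR `|y| * (expR (2^-1 * `|y|) * gauss_kernel s z y))).
    by apply: ler_pM => //; rewrite ?expR_ge0// mulr_ge0 ?exprn_ge0// ltW.
  rewrite -mulrA ler_wpM2l ?exprn_ge0// mulrA -expRD.
  have := gauss_kernel_shift s z (3 / 2) y.
  have -> : 3 / 2 * `|y| = `|y| + 2^-1 * `|y| by field.
  by have -> : 2 * (3 / 2) = 3 :> R by field.
have [d1 d2] := derive_exponential_family zz iC G0 iG CG.
have FE : (fun x => \int[leb]_y (C y * expR (p y * x + q y))) = gauss_moment k s.
  by apply/funext => x; apply: eq_Rintegral => y _; rewrite fE.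
rewrite FE in d1 d2; split; first exact: d1.
rewrite d2 mulrC /gauss_moment -RintegralZl; last exact: integrable_moment.
  by apply: eq_Rintegral => y _; rewrite fE /p exprS; ring.
exact: measurableT.
Qed.

Lemma gauss_moment_derive_s k s z : 0 < s ->
  derivable (gauss_moment k ^~ z) s 1 /\
  derive1 (gauss_moment k ^~ z) s = - (gauss_moment k.+2 s z / 4).
Proof.
move=> s0.
pose C y := Q y * y ^+ k; pose p y := - (y ^+ 2 / 4); pose q y := (z / 2 - b) * y.
have fE x y : C y * expR (p y * x + q y) = Q y * y ^+ k * gauss_kernel x z y.
  by rewrite /gauss_kernel /C /p /q; congr (_ * expR _); field.
pose G y := k.+2%:R ^+ k.+2 * (gauss_kernel (s / 2) (z + 2) y + gauss_kernel (s / 2) (z - 2) y).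
have s20 : 0 < s / 2 by rewrite divr_gt0.
have G0 y : 0 <= G y by rewrite mulr_ge0 ?exprn_ge0// addr_ge0 ?expR_ge0.
have iG : leb.-integrable setT (EFin \o G).
  by apply/integrable_scaler/integrable_addr; exact: integrable_gauss_kernel.
have zz : s / 2 < s < s + 1 by apply/andP; split; lra.
have iC x : s / 2 < x < s + 1 ->
    leb.-integrable setT (EFin \o (fun y => C y * expR (p y * x + q y))).
  move=> /andP[xl _]; under [X in EFin \o X]eq_fun do rewrite fE.
  by apply: integrable_moment; exact: lt_trans xl.
have CG x y : s / 2 < x < s + 1 -> `|p y * (C y * expR (p y * x + q y))| <= G y.
  move=> /andP[xl xr]; rewrite fE.
  have -> : p y * (Q y * y ^+ k * gauss_kernel x z y) =
      - (4^-1 * (Q y * y ^+ k.+2 * gauss_kernel x z y)) by rewrite /p !exprS; field.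
  apply: le_trans (moment_integrand_le k.+2 (s / 2) z y).
  move: (Q y * y ^+ k.+2) => A.
  rewrite normrN !normrM (ger0_norm (expR_ge0 _)) (ger0_norm (expR_ge0 _)) ger0_norm//.
  apply: (@le_trans _ _ (`|A| * gauss_kernel x z y)).
    by rewrite ler_piMl ?mulr_ge0 ?expR_ge0// invf_le1// ler1n.
  apply: ler_wpM2l => //; rewrite ler_expR lerD2l lerN2.
  apply: ler_wpM2r; first exact: sqr_ge0.
  by lra.
have [d1 d2] := derive_exponential_family zz iC G0 iG CG.
have FE : (fun x => \int[leb]_y (C y * expR (p y * x + q y))) = gauss_moment k ^~ z.
  by apply/funext => x; apply: eq_Rintegral => y _; rewrite fE.
rewrite FE in d1 d2; split; first exact: d1.
rewrite d2 mulrC -mulNr /gauss_moment -RintegralZl; last exact: integrable_moment.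
  by apply: eq_Rintegral => y _; rewrite fE /p !exprS; field.
exact: measurableT.
Qed.

End gaussian_transform.

(** From the tangent line of the exponential at the convex combination. *)
Lemma expR_convex (R : realType) (t A B : R) : 0 <= t <= 1 ->
  expR (t * A + (1 - t) * B) <= t * expR A + (1 - t) * expR B.
Proof.
move=> /andP[t0 t1]; set M := t * A + (1 - t) * B.
have tangent x : expR M * (1 + (x - M)) <= expR x.
  have -> : expR x = expR M * expR (x - M) by rewrite -expRD; congr expR; ring.
  apply: ler_wpM2l; first exact: expR_ge0.
  exact: expR_ge1Dx.
have hA := ler_wpM2l t0 (tangent A).
have hB : (1 - t) * (expR M * (1 + (B - M))) <= (1 - t) * expR B.
  by apply: ler_wpM2l (tangent B); rewrite subr_ge0.
apply: le_trans (lerD hA hB).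
rewrite le_eqVlt; apply/orP; left; apply/eqP.
transitivity (expR M * (1 + (t * A + (1 - t) * B - M))); last by ring.
by rewrite -/M subrr addr0 mulr1.
Qed.

(** Positivity on [[1, +oo[] is enough, and holds for all the integrands
    below, some of which vanish at zero or on the negative half-line. *)
Lemma integral_gt0 (R : realType) (f : R -> R) : measurable_fun setT f ->
  (forall y, 0 <= f y) -> (forall y, 1 <= y -> 0 < f y) ->
  (0 < \int[@lebesgue_measure R]_y (f y)%:E)%E.
Proof.
move=> mf f0 fp.
rewrite lt_neqAle integral_ge0 ?andbT; last by move=> y _; rewrite lee_fin.
apply/eqP => E.
have : (\int[@lebesgue_measure R]_y `|(f y)%:E| = 0)%E.
  by rewrite E; apply: eq_integral => y _; rewrite gee0_abs// lee_fin.
have mef : measurable_fun setT (EFin \o f) by exact/measurable_EFinP.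
have [h _] := ae_eq_integral_abs (@lebesgue_measure R) measurableT mef.
move=> /h [N [mN N0 hN]].
have sub : `[1, 2]%classic `<=` N.
  move=> y /=; rewrite in_itv/= => /andP[y1 _]; apply: hN => /= /(_ I) [fy].
  by have := fp y y1; rewrite fy ltxx.
have mI : measurable (`[1, 2]%classic : set R) by exact: measurable_itv.
have : (lebesgue_measure (`[1%R, 2%R]%classic : set R) <= lebesgue_measure N)%E.
  by apply: le_measure; rewrite ?inE.
rewrite [X in (_ <= X)%E]N0 lebesgue_measure_itv/= lte_fin ltr1n -EFinB lee_fin.
by lra.
Qed.

Section gaussian_transform_shape.
Context {R : realType}.
Local Notation leb := (@lebesgue_measure R).
Variable Q : R -> R.
Hypothesis mQ : measurable_fun setT Q.
Hypothesis Q_gt0 : forall y, 0 < Q y.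
Hypothesis Q_le1 : forall y, Q y <= 1.
Variable b : R.
Implicit Types (s z y t : R).
Local Notation ker := (gauss_kernel b).
Local Notation K := (gauss_transform Q b).

Let mK s z : measurable_fun setT (fun y => (Q y * ker s z y)%:E).
Proof. by apply/measurable_EFinP; exact: measurable_transform_integrand. Qed.

Let K0 s z y : 0 <= Q y * ker s z y.
Proof. exact: transform_integrand_ge0. Qed.

Lemma gauss_transform_ge0 s z : (0 <= K s z)%E.
Proof. by apply: integral_ge0 => y _; rewrite lee_fin K0. Qed.

Let convex_combination s1 z1 s2 z2 s z t : 0 <= t <= 1 ->
  (forall y, ker s z y <= t * ker s1 z1 y + (1 - t) * ker s2 z2 y) ->
  (K s z <= t%:E * K s1 z1 + (1 - t)%:E * K s2 z2)%E.
Proof.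
move=> /andP[t0 t1] h; have t1' : 0 <= 1 - t by rewrite subr_ge0.
have scale_in (k s' z' : R) : 0 <= k ->
    (k%:E * K s' z' = \int[leb]_y (k%:E * (Q y * ker s' z' y)%:E))%E.
  move=> k0; rewrite ge0_integralZl//; first exact: mK.
  by move=> y _; rewrite lee_fin K0.
have scaled_ge0 (k s' z' y : R) : 0 <= k -> (0 <= k%:E * (Q y * ker s' z' y)%:E)%E.
  by move=> k0; rewrite -EFinM lee_fin mulr_ge0.
have mscaled (k s' z' : R) : measurable_fun setT (fun y => (k%:E * (Q y * ker s' z' y)%:E)%E).
  by apply: measurable_funeM; exact: mK.
rewrite !scale_in// -ge0_integralD//; last 4 first.
- by move=> y _; exact: scaled_ge0.
- exact: mscaled.
- by move=> y _; exact: scaled_ge0.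
- exact: mscaled.
apply: ge0_le_integral => //.
- by move=> y _; rewrite lee_fin K0.
- exact: mK.
- by apply: emeasurable_funD; exact: mscaled.
- move=> y _; rewrite -!EFinM -EFinD lee_fin.
  apply: le_trans (ler_wpM2l (ltW (Q_gt0 y)) (h y)) _.
  by rewrite le_eqVlt; apply/orP; left; apply/eqP; ring.
Qed.

Lemma gauss_transform_convex_s z : econvex_on [set s | 0 <= s] (K^~ z).
Proof.
move=> s1 s2 t _ _ t01; apply: convex_combination => // y.
apply: le_trans (expR_convex _ _ t01); rewrite ler_expR.
by rewrite le_eqVlt; apply/orP; left; apply/eqP; field.
Qed.

Lemma gauss_transform_convex_z s : econvex_on [set z | 2 * b < z] (K s).
Proof.
move=> z1 z2 t _ _ t01; apply: convex_combination => // y.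
apply: le_trans (expR_convex _ _ t01); rewrite ler_expR.
by rewrite le_eqVlt; apply/orP; left; apply/eqP; field.
Qed.

Let ker_le s1 s2 z y : s1 <= s2 -> ker s2 z y <= ker s1 z y.
Proof.
move=> s12; rewrite ler_expR lerD2l lerN2.
by apply: ler_wpM2r; [exact: sqr_ge0|lra].
Qed.

(** The left value may be infinite when [s1 = 0], so the difference of the
    kernels is added to the right value instead of being subtracted. *)
Lemma gauss_transform_decreasing z s1 s2 : 0 <= s1 -> s1 < s2 -> (K s2 z < K s1 z)%E.
Proof.
move=> s10 s12; have s20 : 0 < s2 by exact: le_lt_trans s12.
have f2 := gauss_transform_fin mQ Q_gt0 Q_le1 b z s20.
pose D y := Q y * (ker s1 z y - ker s2 z y).
have D0 y : 0 <= D y by rewrite mulr_ge0 ?(ltW (Q_gt0 y))// subr_ge0 ker_le// ltW.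
have mD : measurable_fun setT D.
  apply: measurable_funM => //; apply: measurable_funB; exact: measurable_gauss_kernel.
have -> : K s1 z = (\int[leb]_y (D y)%:E + K s2 z)%E.
  rewrite /gauss_transform -ge0_integralD//.
  - by apply: eq_integral => y _; rewrite -EFinD; congr EFin; rewrite /D; ring.
  - by move=> y _; rewrite lee_fin.
  - exact/measurable_EFinP.
  - by move=> y _; rewrite lee_fin K0.
  - exact: mK.
rewrite -[ltLHS]add0e lteD2rE//.
apply: integral_gt0 => // y y1; rewrite mulr_gt0// subr_gt0 ltr_expR ltrD2l ltrN2.
have y0 : y != 0 by rewrite gt_eqF// (lt_le_trans _ y1).
by rewrite ltr_pM2r ?exprn_even_gt0//; lra.
Qed.

(** Dominated convergence along the integers, and monotonicity in between. *)
Lemma gauss_transform_cvg0 z : (K s z @[s --> +oo%R] --> 0)%E.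
Proof.
have seqlim : (fun n : nat => \int[leb]_y (Q y * ker n.+1%:R z y)) @ \oo --> 0.
  rewrite -[X in _ --> X](_ : \int[leb]_y (Q y * 0) = 0); last first.
    by under eq_Rintegral do rewrite mulr0; rewrite Rintegral_cst// mul0r.
  apply: (@Rintegral_dominated_cvg _ _ _ leb _ _ (ker 1 z)).
  - by move=> n; exact: measurable_transform_integrand.
  - exact: measurable_funM.
  - exists [set 0]; split; [exact: measurable_set1|exact: lebesgue_measure_set1|].
    move=> y /=; apply: contra_notP => y0; apply: cvgMl_tmp.
    pose c := y ^+ 2 / 4.
    have c0 : 0 < c by rewrite divr_gt0// exprn_even_gt0//; exact/eqP.
    have E n : ker n.+1%:R z y = expR ((z / 2 - b) * y) * expR (- c) * expR (- c) ^+ n.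
      rewrite /gauss_kernel -[in RHS]expRM_natl -!expRD; congr expR.
      by rewrite /c -natr1; field.
    have h : (fun n => expR (- c) ^+ n) @ \oo --> 0.
      by apply: cvg_expr; rewrite ger0_norm ?expR_ge0// -expR0 ltr_expR oppr_lt0.
    have h2 : (fun n => expR ((z / 2 - b) * y) * expR (- c) * expR (- c) ^+ n) @ \oo -->
        expR ((z / 2 - b) * y) * expR (- c) * 0 by exact: cvgMl_tmp.
    by move: h2; rewrite (mulr0 (_ * _)) -(funext E).
  - exact: integrable_gauss_kernel.
  - move=> n y; rewrite ger0_norm ?K0//.
    apply: le_trans (ker_le _ _ (_ : 1 <= n.+1%:R)); last by rewrite ler1n.
    by rewrite ler_piMl ?expR_ge0.
have bound n s : n.+1%:R <= s -> (K s z <= (\int[leb]_y (Q y * ker n.+1%:R z y))%:E)%E.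
  move=> ns; have n0 : 0 < n.+1%:R :> R by rewrite ltr0n.
  rewrite /Rintegral fineK; last exact: (gauss_transform_fin mQ Q_gt0 Q_le1 b z n0).
  apply: ge0_le_integral => //.
  - by move=> y _; rewrite lee_fin K0.
  - exact: mK.
  - exact: mK.
  - by move=> y _; rewrite lee_fin; apply: ler_wpM2l; [exact: ltW|exact: ker_le].
apply/fine_cvgP; split.
  exists 0; split; first exact: num_real.
  by move=> s s0; exact: (gauss_transform_fin mQ Q_gt0 Q_le1 b z s0).
apply/cvgrPdist_le => e e0.
have /cvgrPdist_le/(_ _ e0)[n _ hn] := seqlim.
exists n.+1%:R; split; first exact: num_real.
move=> s /ltW ns; rewrite sub0r normrN ger0_norm ?fine_ge0 ?gauss_transform_ge0//.
have s0 : 0 < s by apply: lt_le_trans ns; rewrite ltr0n.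
rewrite -lee_fin (fineK (gauss_transform_fin mQ Q_gt0 Q_le1 b z s0)).
apply: le_trans (bound n s ns) _; rewrite lee_fin.
have := hn n (leqnn n); rewrite sub0r normrN; apply: le_trans; exact: ler_norm.
Qed.

(** The combination is minus a quarter of the integral of [(y - 1) ^ 2]
    against a positive density. *)
Lemma gauss_moment_square_ge0 s z : 0 < s ->
  - (gauss_moment Q b 2 s z / 4) + gauss_moment Q b 1 s z / 2 <= 4^-1 * gauss_moment Q b 0 s z.
Proof.
move=> s0; have im k := integrable_moment mQ Q_gt0 Q_le1 b k z s0.
have : 0 <= \int[leb]_y ((Q y * y ^+ 2 * ker s z y - 2 * (Q y * y ^+ 1 * ker s z y))
    + Q y * y ^+ 0 * ker s z y).
  apply: Rintegral_ge0 => y _.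
  have -> : (Q y * y ^+ 2 * ker s z y - 2 * (Q y * y ^+ 1 * ker s z y))
    + Q y * y ^+ 0 * ker s z y = (Q y * ker s z y) * (y - 1) ^+ 2 by ring.
  by apply: mulr_ge0; [exact: K0|exact: sqr_ge0].
rewrite RintegralD//; last exact: (integrable_subr (im 2%N) (integrable_scaler 2 (im 1%N))).
rewrite RintegralB//; last exact: (integrable_scaler 2 (im 1%N)).
rewrite RintegralZl// -!/(gauss_moment _ _ _ _ _).
by lra.
Qed.

End gaussian_transform_shape.

Section gaussian_transform_growth.
Context {R : realType}.
Local Notation leb := (@lebesgue_measure R).
Variable Q : R -> R.
Hypothesis mQ : measurable_fun setT Q.
Hypothesis Q_gt0 : forall y, 0 < Q y.
Hypothesis Q_le1 : forall y, Q y <= 1.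
Variable b : R.
Hypothesis b0 : 0 <= b.
Implicit Types (s x y t : R).
Local Notation ker := (gauss_kernel b).
Local Notation K := (gauss_transform Q b).

Let gumbel (m y : R) : R := expR (- (m * expR y)) * (m * expR y).

Let measurable_gumbel m : measurable_fun setT (gumbel m).
Proof.
have h : measurable_fun setT (fun y : R => m * expR y) by exact: measurable_funM.
by apply: measurable_funM => //; apply: measurableT_comp => //; exact: measurableT_comp.
Qed.

Let gumbel_ge0 m y : 0 < m -> 0 <= gumbel m y.
Proof. by move=> m0; rewrite mulr_ge0 ?expR_ge0// mulr_ge0 ?expR_ge0// ltW. Qed.

Let integral_gumbel m : 0 < m -> (\int[leb]_y (gumbel m y)%:E <= 1)%E.
Proof.
move=> m0.
rewrite -(ge0_integral_expR_subst m0 (G := fun t => expR (- t))); last 3 first.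
- exact: measurableT_comp.
- move=> t _; apply: continuous_cvg; first exact: continuous_expR.
  by apply: cvgN; exact: cvg_id.
- by move=> t _; exact: expR_ge0.
rewrite -(integral_exponential_pdf (ltr01 : (0 : R) < 1)).
have mpdf : measurable_fun setT (fun t : measurableTypeR R => (exponential_pdf 1 t)%:E).
  by apply/measurable_EFinP; exact: measurable_exponential_pdf.
apply: (@le_trans _ _ (\int[leb]_(t in `]0%R, +oo[) (exponential_pdf 1 t)%:E)%E).
  rewrite le_eqVlt; apply/orP; left; apply/eqP; apply: eq_integral => t.
  rewrite inE/= in_itv/= andbT => t0.
  by rewrite exponential_pdfE ?ltW// mul1r mulN1r.
apply: ge0_subset_integral => //.
by move=> t _; rewrite lee_fin exponential_pdf_ge0.
Qed.

Section tail.
Variables c0 C0 t0 : R.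
Hypotheses (c00 : 0 < c0) (C00 : 0 < C0) (t00 : 0 < t0).
Hypothesis tail : forall y, t0 <= y -> Q y <= C0 * expR (- (c0 * y ^+ 2)).

Let pointwise s x y : 0 <= s -> 2 * b + 2 <= x ->
  Q y * ker s x y <= expR (1 + x * (t0 / 2)) * gumbel (expR (- t0)) y +
    C0 * expR (x ^+ 2 / (4 * (s + 4 * c0))) * expR (- (c0 * (y - x / (s + 4 * c0)) ^+ 2)).
Proof.
move=> s0 xb.
have q0 : 0 < s + 4 * c0 by rewrite ltr_wpDl// mulr_gt0.
have [yt|/ltW ty] := leP y t0.
  apply: (@le_trans _ _ (expR (1 + x * (t0 / 2)) * gumbel (expR (- t0)) y)); last first.
    by rewrite lerDl mulr_ge0 ?expR_ge0// mulr_ge0 ?expR_ge0// ltW.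
  apply: (@le_trans _ _ (1 * ker s x y)); first by rewrite ler_wpM2r ?expR_ge0.
  rewrite mul1r /gumbel -expRD -expRD -expRD.
  rewrite /gauss_kernel ler_expR.
  have e1 : expR (- t0 + y) <= 1 by rewrite -expR0 ler_expR addrC subr_le0.
  have sy : 0 <= s / 4 * y ^+ 2 by rewrite mulr_ge0 ?sqr_ge0// divr_ge0.
  have h1 : 0 <= (x / 2 - b - 1) * (t0 - y) by apply: mulr_ge0; lra.
  have h2 : 0 <= b * t0 by rewrite mulr_ge0// ltW.
  have -> : (x / 2 - b) * y = x * (t0 / 2) - b * t0 + (y - t0) - (x / 2 - b - 1) * (t0 - y).
    by field.
  by lra.
apply: (@le_trans _ _ (C0 * expR (x ^+ 2 / (4 * (s + 4 * c0))) *
    expR (- (c0 * (y - x / (s + 4 * c0)) ^+ 2)))); last first.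
  by rewrite lerDr mulr_ge0 ?expR_ge0// gumbel_ge0 ?expR_gt0.
apply: (@le_trans _ _ (C0 * expR (- (c0 * y ^+ 2)) * ker s x y)).
  by rewrite ler_wpM2r ?expR_ge0// tail.
rewrite -[leLHS]mulrA -[leRHS]mulrA; apply: ler_wpM2l; first exact: ltW.
rewrite /gauss_kernel -!expRD ler_expR.
have y0 : 0 <= b * y by rewrite mulr_ge0// (le_trans (ltW t00)).
have sy : 0 <= s / 4 * (y - x / (s + 4 * c0)) ^+ 2 by rewrite mulr_ge0 ?sqr_ge0// divr_ge0.
have -> : x ^+ 2 / (4 * (s + 4 * c0)) - c0 * (y - x / (s + 4 * c0)) ^+ 2 =
    - (c0 * y ^+ 2) + ((x / 2 - b) * y - s / 4 * y ^+ 2)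
    + b * y + s / 4 * (y - x / (s + 4 * c0)) ^+ 2.
  by field; rewrite gt_eqF.
by lra.
Qed.

(** Up to [t0] only [Q <= 1] is used and the integrand grows at least like
    [exp y], as [x / 2 - b >= 1]; beyond [t0] the square is completed, the
    Gaussian factor [exp (- s y ^ 2 / 4)] being kept in the exponent. *)
Lemma gauss_transform_tail_bound s x : 0 <= s -> 2 * b + 2 <= x ->
  (K s x <= (expR (1 + x * (t0 / 2)) +
     C0 * gauss_total c0 * expR (x ^+ 2 / (4 * (s + 4 * c0))))%:E)%E.
Proof.
move=> s0 xb; set E := expR (x ^+ 2 / _); set m := expR (- t0).
have m0 : 0 < m by exact: expR_gt0.
pose mid := x / (s + 4 * c0).
pose f1 y := expR (1 + x * (t0 / 2)) * gumbel m y.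
pose f2 y := C0 * E * expR (- (c0 * (y - mid) ^+ 2)).
have mgauss : measurable_fun setT (fun y => expR (- (c0 * (y - mid) ^+ 2))).
  exact: integrable_measurable (integrable_gauss mid c00).
have f10 y : 0 <= f1 y by rewrite mulr_ge0 ?expR_ge0 ?gumbel_ge0.
have CE0 : 0 <= C0 * E by rewrite mulr_ge0 ?expR_ge0// ltW.
have f20 y : 0 <= f2 y by rewrite mulr_ge0 ?expR_ge0.
have mf1 : measurable_fun setT f1 by exact: measurable_funM.
have mf2 : measurable_fun setT f2 by exact: measurable_funM.
apply: (@le_trans _ _ (\int[leb]_y ((f1 y)%:E + (f2 y)%:E))%E).
  apply: ge0_le_integral => //.
  - by move=> y _; rewrite lee_fin transform_integrand_ge0.
  - by apply/measurable_EFinP; exact: measurable_transform_integrand.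
  - by apply: emeasurable_funD; exact/measurable_EFinP.
  - by move=> y _; rewrite -EFinD lee_fin; exact: pointwise.
rewrite ge0_integralD//; last 4 first.
- by move=> y _; rewrite lee_fin.
- exact/measurable_EFinP.
- by move=> y _; rewrite lee_fin.
- exact/measurable_EFinP.
rewrite EFinD; apply: leeD.
  under eq_integral do rewrite EFinM.
  rewrite ge0_integralZl//; last 2 first.
  - by apply/measurable_EFinP; exact: measurable_gumbel.
  - by move=> y _; rewrite lee_fin gumbel_ge0.
  by rewrite -[leRHS]mule1; apply: lee_wpmul2l; rewrite ?lee_fin ?expR_ge0// integral_gumbel.
under eq_integral do rewrite EFinM.
rewrite ge0_integralZl//; last exact/measurable_EFinP.
by rewrite integral_gauss// -EFinM lee_fin mulrAC.
Qed.

(** A rate that absorbs the factor of each of the two parts of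
    [gauss_transform_tail_bound]; it depends neither on [p] nor on [s]. *)
Definition growth_rate : R := 2 + t0 / 2 + C0 * gauss_total c0.

Lemma growth_rate_gt0 : 0 < growth_rate.
Proof.
have := mulr_gt0 C00 (gauss_total_gt0 c00); have : 0 < t0 / 2 by rewrite divr_gt0.
by rewrite /growth_rate; lra.
Qed.

(** The exponent of [gauss_transform_tail_bound] corresponds to [p = 1],
    and it increases with [p]. *)
Lemma gauss_transform_bound p s x : 1 < p -> 0 <= s -> 2 * b + 2 <= x ->
  (K s x <= (expR (growth_rate * x) *
     expR (x ^+ 2 * p / (4 * (p * s + 4 * c0))))%:E)%E.
Proof.
move=> p1 s0 xb; apply: le_trans (gauss_transform_tail_bound s0 xb) _; rewrite lee_fin.
have p0 : 0 < p by exact: lt_trans p1.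
have q0 : 0 < s + 4 * c0 by rewrite ltr_wpDl// mulr_gt0.
have r0 : 0 < p * s + 4 * c0 by rewrite ltr_wpDl ?mulr_gt0// mulr_ge0// ltW.
have x1 : 1 <= x by have := b0; lra.
set E := x ^+ 2 / _; set E' := x ^+ 2 * p / _.
have EE : E <= E'.
  have -> : E = x ^+ 2 / 4 * (s + 4 * c0)^-1 by rewrite /E invfM mulrA.
  have -> : E' = x ^+ 2 / 4 * (p / (p * s + 4 * c0)) by rewrite /E'; field; rewrite gt_eqF.
  apply: ler_wpM2l; first by rewrite divr_ge0// sqr_ge0.
  rewrite ler_pdivlMr// mulrC ler_pdivrMr// mulrDr lerD2l mulrCA.
  by rewrite ler_pM2l// ler_peMl ?(ltW p1)// ltW.
have E0 : 0 <= E' by apply: le_trans EE; rewrite divr_ge0 ?sqr_ge0// mulr_ge0// ltW.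
set c := C0 * gauss_total c0.
have c_gt0 : 0 < c by exact: mulr_gt0 (gauss_total_gt0 c00).
apply: (@le_trans _ _ ((expR (1 + x * (t0 / 2)) + c) * expR E')).
  rewrite mulrDl; apply: lerD.
    by rewrite ler_peMr ?expR_ge0// -expR0 ler_expR.
  by rewrite ler_wpM2l ?(ltW c_gt0)// ler_expR.
rewrite ler_wpM2r ?expR_ge0//.
have h1 : 1 + x * (t0 / 2) <= x * (1 + t0 / 2) by rewrite mulrDr mulr1; lra.
have h2 : c <= expR (x * c).
  apply: (@le_trans _ _ (expR c)); last by rewrite ler_expR ler_peMl// ltW.
  by have := expR_ge1Dx c; lra.
have t0' := t00.
have xt : 0 <= x * (1 + t0 / 2) by apply: mulr_ge0; lra.
have xc : 0 <= x * c by apply: mulr_ge0; lra.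
have e2 : 2 <= expR x by have := expR_ge1Dx x; lra.
have -> : growth_rate * x = x + (x * (1 + t0 / 2) + x * c) by rewrite /growth_rate -/c; ring.
rewrite expRD.
apply: (@le_trans _ _ (2 * expR (x * (1 + t0 / 2) + x * c))); last first.
  by rewrite ler_wpM2r ?expR_ge0.
set X := expR (x * _ + x * c); have -> : 2 * X = X + X by ring.
apply: lerD.
  by rewrite ler_expR; lra.
by apply: le_trans h2 _; rewrite ler_expR; lra.
Qed.

End tail.

(** On the positive half-line the kernel increases with [x], so its value
    at [x = 0] bounds it from below. *)
Lemma gauss_transform_ge_const a : 0 < a ->
  exists c : R, 0 < c /\ forall x, 0 <= x -> (c%:E <= K a x)%E.
Proof.
move=> a0; pose f y := Q y * ker a 0 y * \1_(`[0, +oo[%classic) y.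
have mf : measurable_fun setT f.
  apply: measurable_funM; first exact: measurable_transform_integrand.
  by apply: measurable_indic; exact: measurable_itv.
have f0 y : 0 <= f y by rewrite mulr_ge0// transform_integrand_ge0.
have fK x y : 0 <= x -> f y <= Q y * ker a x y.
  move=> x0; rewrite /f indicE mem_setE in_itv/= andbT.
  case: (leP 0 y) => y0; last by rewrite mulr0 transform_integrand_ge0.
  rewrite mulr1; apply: ler_wpM2l; first exact: ltW.
  rewrite ler_expR lerD2r; apply: ler_wpM2r => //; lra.
have fKI x : 0 <= x -> (\int[leb]_y (f y)%:E <= K a x)%E.
  move=> x0; apply: ge0_le_integral => //.
  - by move=> y _; rewrite lee_fin.
  - exact/measurable_EFinP.
  - by apply/measurable_EFinP; exact: measurable_transform_integrand.
  - by move=> y _; rewrite lee_fin; exact: fK.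
have pos : (0 < \int[leb]_y (f y)%:E)%E.
  apply: integral_gt0 => // y y1.
  rewrite /f indicE mem_setE in_itv/= andbT (le_trans ler01 y1) mulr1.
  by rewrite mulr_gt0 ?expR_gt0.
have fin : (\int[leb]_y (f y)%:E)%E \is a fin_num.
  rewrite ge0_fin_numE ?ltW//; apply: le_lt_trans (fKI 0 (lexx 0)) _.
  rewrite -ge0_fin_numE; first exact: (gauss_transform_fin mQ Q_gt0 Q_le1 b 0 a0).
  exact: gauss_transform_ge0.
exists (fine (\int[leb]_y (f y)%:E)%E); split.
  by apply: fine_gt0; rewrite pos -ge0_fin_numE ?ltW.
by move=> x x0; rewrite fineK//; exact: fKI.
Qed.

End gaussian_transform_growth.

(** * The Laplace transform of the mass of a ball *)

Section ball_laplace.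
Context {R : realType} {d : nat}.
Context {dO : measure_display} {Omega : measurableType dO}.
Variable P : probability Omega R.
Variable M : R.-ker Omega ~> Rd R d.
Implicit Types r x : R.

Lemma laplaceE r x :
  laplace P M r x = \int[P]_w expR (- (expR x * ball_mass M r w)).
Proof. by rewrite /laplace unlock. Qed.

Let mN r : measurable_fun setT (ball_mass M r).
Proof. by apply: measurable_gmc_fine; exact: measurable_eball. Qed.

Let N0 r w : 0 <= ball_mass M r w.
Proof. exact: fine_ge0. Qed.

Let mexp r x : measurable_fun setT (fun w => expR x * ball_mass M r w).
Proof. exact: measurable_funM. Qed.

Let exp0 r x w : 0 <= expR x * ball_mass M r w.
Proof. by rewrite mulr_ge0 ?expR_ge0. Qed.

Lemma laplace_le1 r x : laplace P M r x <= 1.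
Proof. by rewrite laplaceE; case/andP: (laplace_bounds P (mexp r x) (exp0 r x)). Qed.

Lemma laplace_gt0 r x : 0 < laplace P M r x.
Proof.
rewrite laplaceE lt_neqAle.
have /andP[-> _] := laplace_bounds P (mexp r x) (exp0 r x); rewrite andbT.
apply/eqP => E.
pose f w : R := expR (- (expR x * ball_mass M r w)).
have mf : measurable_fun setT f by apply: measurableT_comp => //; exact: measurableT_comp.
have if_ : P.-integrable setT (EFin \o f).
  apply: (@integrable_bounded _ _ _ P _ 1) => // w.
  by case/andP: (expRN_le1 (exp0 r x w)) => h0 h1; rewrite ger0_norm.
have mef : measurable_fun setT (EFin \o f) by exact/measurable_EFinP.
have [h _] := ae_eq_integral_abs P measurableT mef.
have I0 : (\int[P]_w `|(EFin \o f) w| = 0)%E.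
  rewrite (eq_integral (EFin \o f)); last by move=> w _; rewrite gee0_abs// lee_fin expR_ge0.
  by rewrite -[LHS]fineK ?(integrable_fin_num measurableT if_)// -[fine _]E.
have [N [mN' N0' hN]] := h I0.
have : (P setT <= P N)%E.
  apply: le_measure; rewrite ?inE//; move=> w _; apply: hN => /= /(_ I) [] fw.
  by have := expR_gt0 (- (expR x * ball_mass M r w)); rewrite -/(f w) fw ltxx.
by rewrite N0' probability_setT lee_fin ler10.
Qed.

Lemma measurable_laplace r : measurable_fun setT (laplace P M r).
Proof.
rewrite (funext (laplaceE r)).
apply: (@measurable_laplace_mixture _ Omega R P _ (measurableTypeR R) (normal_prob 0 1)
  (@expR R) (ball_mass M r) (@measurable_expR R) (@expR_ge0 R) (mN r) (N0 r)).
Qed.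

End ball_laplace.

Section laplace_scaling.
Context {R : realType} {d : nat}.
Variable T : R.
Hypothesis T0 : 0 < T.
Context {dO : measure_display} {Omega : measurableType dO}.
Variable P : probability Omega R.
Variable Z : signed_measure R d -> {RV P >-> R}.
Hypothesis hZ : log_field T Z.
Variable theta : probability (Rd R d) R.
Hypothesis htheta : mollifier theta.
Variable Y : R -> Rd R d * Omega -> R.
Hypothesis hY : regularization Z theta Y.
Variable gamma : R.
Hypothesis gamma0 : 0 < gamma.
Variable M : R.-ker Omega ~> Rd R d.
Hypothesis hL : forall A : set (Rd R d), measurable A -> A `<=` eball 1 ->
  (\int[P]_w `|chaos_approx P gamma Y e A w - M w A| @[e --> 0^'+] --> 0)%E.
Variable r : R.
Hypothesis r01 : 0 < r < 1.
Let l := ln r^-1.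
Let r0 : 0 < r. Proof. by case/andP: r01. Qed.
Let l0 : 0 < l. Proof. by rewrite ln_gt0// invf_gt1//; case/andP: r01. Qed.
Let s := Num.sqrt l.
Let s2 : s ^+ 2 = l. Proof. by rewrite sqr_sqrtr// ltW. Qed.
Let s0 : 0 < s. Proof. by rewrite sqrtr_gt0. Qed.
Let rE : r = expR (- l). Proof. by rewrite /l lnV ?posrE// opprK lnK. Qed.
Let Q := laplace P M 1.
Let a := coef_a gamma r.
Let b := coef_b d gamma.

Let laplace_mixture x : laplace P M r x =
  \int[normal_prob 0 s]_u Q (gamma * u + (x - (gamma ^+ 2 / 2 + d%:R) * l)).
Proof.
rewrite laplaceE (gmc_scaling T0 hZ htheta hY hL r01 (expR_ge0 x)).
apply: eq_Rintegral => u _.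
have -> : expR x * (r ^+ d * expR (gamma * u - gamma ^+ 2 / 2 * ln r^-1)) =
    expR (gamma * u + (x - (gamma ^+ 2 / 2 + d%:R) * l)).
  have -> : r ^+ d = expR (- (d%:R * l)) by rewrite {1}rE -expRM_natl mulrN.
  by rewrite -!expRD -/l; congr expR; ring.
by rewrite /Q laplaceE.
Qed.

(** The mean and the variance of the Gaussian law in the self-similarity
    are such that completing the square produces exactly the coefficients
    [a], [b] and [C]. *)
Lemma laplace_scaling x : (laplace P M r x)%:E =
  ((coef_C d gamma r * expR (- (a * x ^+ 2) + b * x))%:E *
   gauss_transform Q b (4 * a) (4 * a * x))%E.
Proof.
set m := x - (gamma ^+ 2 / 2 + d%:R) * l.
have mQ : measurable_fun setT Q by exact: measurable_laplace.
have Q0 y : 0 <= Q y by rewrite ltW// laplace_gt0.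
have mQa : measurable_fun setT (fun u => Q (gamma * u + m)).
  by apply: measurableT_comp => //; apply: measurable_funD => //; exact: measurable_funM.
have -> : (laplace P M r x)%:E = (\int[normal_prob 0 s]_u (Q (gamma * u + m))%:E)%E.
  rewrite laplace_mixture /Rintegral fineK//.
  apply: (integrable_fin_num measurableT).
  apply: (@integrable_bounded _ _ _ (normal_prob 0 s) (fun u => Q (gamma * u + m)) 1 mQa).
  by move=> u; rewrite ger0_norm// laplace_le1.
rewrite (gaussian_affine_integral m mQ Q0 gamma0 s0) s2.
have l1 : l != 0 by rewrite gt_eqF.
have g1 : gamma != 0 by rewrite gt_eqF.
have kE y : Q y * expR (- ((y - m) ^+ 2 / (2 * (gamma ^+ 2 * l)))) =
    expR (- (a * m ^+ 2)) * (Q y * gauss_kernel b (4 * a) (4 * a * x) y).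
  rewrite [RHS]mulrCA; congr (_ * _); rewrite /gauss_kernel -expRD; congr expR.
  rewrite /m /a /b /coef_a /coef_b -/l; field; exact/andP.
under eq_integral do rewrite kE EFinM.
rewrite ge0_integralZl//; last 2 first.
- by apply/measurable_EFinP; exact: measurable_transform_integrand.
- by move=> y _; rewrite lee_fin mulr_ge0 ?expR_ge0.
rewrite muleA -EFinM; congr (_%:E * _)%E.
rewrite /coef_C [RHS]mulrAC -/l mulrC (_ : 2 * pi * (gamma ^+ 2 * l) = 2 * pi * gamma ^+ 2 * l); last first.
  by rewrite mulrA.
congr (_ / _); rewrite /powR gt_eqF// -expRD; congr expR.
have -> : ln r = - l by rewrite /l lnV ?posrE// opprK.
rewrite /m /a /b /coef_a /coef_b -/l.
by field; exact/andP.
Qed.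

End laplace_scaling.

Lemma fuglede_T_gt0 (R : realType) (d : nat) : 0 < fuglede_T R d.
Proof. by rewrite /fuglede_T; case: ifP => _; rewrite ?mulr_gt0 ?expR_gt0. Qed.

(** All factors other than the two exponentials of [x ^ 2] are at most
    exponential in [x], and [x >= 1] absorbs the constants. *)
Lemma ln_transform_bounds (R : realType) (C a b l c c0 p K x : R) :
  0 < C -> 0 < a -> 0 <= b -> 0 < l -> 0 < c -> 0 < c0 -> 1 < p -> 1 <= x ->
  c <= K -> K <= expR (l * (4 * a * x)) *
    expR ((4 * a * x) ^+ 2 * p / (4 * (p * (4 * a) + 4 * c0))) ->
  let C1 := `|ln C| + `|ln c| + b + 4 * a * l in
  (- (a * x ^+ 2) - C1 * x <= ln (C * expR (- (a * x ^+ 2) + b * x) * K)) /\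
  (ln (C * expR (- (a * x ^+ 2) + b * x) * K) <=
    - (a * c0 / (p * a + c0) * x ^+ 2) + C1 * x).
Proof.
move=> C0 a0 b0 l0 c_gt0 c00 p1 x1 cK Kle C1.
have K0 : 0 < K by exact: lt_le_trans cK.
have p0 : 0 < p by exact: lt_trans p1.
have x0 : 0 <= x by exact: le_trans x1.
rewrite !lnM ?posrE ?mulr_gt0 ?expR_gt0// expRK.
have lnC : `|ln C| <= `|ln C| * x by rewrite ler_peMr.
have lnc : `|ln c| <= `|ln c| * x by rewrite ler_peMr.
have lnC1 : - `|ln C| <= ln C by rewrite lerNl -normrN ler_norm.
have lnC2 := ler_norm (ln C).
have lnc1 : - `|ln c| <= ln c by rewrite lerNl -normrN ler_norm.
have lncK : ln c <= ln K by rewrite ler_ln ?posrE.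
have bx : 0 <= b * x by rewrite mulr_ge0.
have alx : 0 <= 4 * a * l * x by rewrite !mulr_ge0// ltW.
have lnK : ln K <= 4 * a * l * x + (a ^+ 2 * p / (p * a + c0)) * x ^+ 2.
  have := Kle; rewrite -expRD -ler_ln ?posrE ?expR_gt0// expRK => h; apply: le_trans h _.
  rewrite le_eqVlt; apply/orP; left; apply/eqP; field.
  by apply/andP; split; rewrite gt_eqF// addr_gt0// !mulr_gt0.
have E : - (a * x ^+ 2) + (a ^+ 2 * p / (p * a + c0)) * x ^+ 2 =
    - (a * c0 / (p * a + c0) * x ^+ 2).
  by field; rewrite gt_eqF// addr_gt0// mulr_gt0.
have -> : C1 * x = `|ln C| * x + `|ln c| * x + b * x + 4 * a * l * x by rewrite /C1; ring.
have nc : 0 <= `|ln c| * x by rewrite mulr_ge0.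
rewrite -E; move: lnC lnc lnC1 lnC2 lnc1 lncK bx alx lnK nc.
move: (ln C) `|ln C| `|ln c| (_ * x) => u1 u2 u3 u4.
split; lra.
Qed.

Theorem theorem2p5 (R : realType) (d : nat) (d_gt0 : (0 < d)%N)
    (T : R) (hT : fuglede_T R d <= T)
    (gamma : R) (hgamma : 0 < gamma < Num.sqrt (2 * d%:R))
    (dO : measure_display) (Omega : measurableType dO) (P : probability Omega R)
    (Z : signed_measure R d -> {RV P >-> R}) (hZ : log_field T Z)
    (theta : probability (Rd R d) R) (htheta : mollifier theta)
    (M : R.-ker Omega ~> Rd R d) (hM : is_gmc gamma Z theta M)
    (T1 : {RV P >-> R}) (hT1 : exponential_RV P 1 T1)
    (hindep : independent_RV P T1 (ball_mass M 1))
    (r : R) (hr : 0 < r < 1) :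
  let a := coef_a gamma r in
  let b := coef_b d gamma in
  let Q := laplace P M in
  let k : R -> R -> \bar R := kappa P b T1 (ball_mass M 1) in
  let kR : R -> R -> R := fun s z => fine (k s z) in
  [/\ forall x : R, b / (2 * a) < x ->
        (Q r x)%:E = ((coef_C d gamma r * expR (- (a * x ^+ 2) + b * x))%:E
                      * k (4 * a)%R (4 * a * x)%R)%E,
      forall s z : R, 0 < s -> 2 * b < z ->
        [/\ k s z \is a fin_num,
            derivable (kR^~ z) s 1,
            derivable (kR s) z 1,
            derivable (derive1 (kR s)) z 1 &
            derive1 (kR^~ z) s = - derive1 (derive1 (kR s)) z],
      [/\ forall s z : R, 0 <= s -> 2 * b < z -> (0 <= k s z)%E,
          forall z : R, 2 * b < z ->
            [/\ econvex_on [set s | 0 <= s] (k^~ z),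
                forall s1 s2 : R, 0 <= s1 -> s1 < s2 -> (k s2 z < k s1 z)%E &
                k s z @[s --> +oo] --> 0%E],
          forall s : R, 0 <= s -> econvex_on [set z | 2 * b < z] (k s),
          forall s z : R, 0 < s -> 2 * b < z ->
            derive1 (kR^~ z) s + derive1 (kR s) z <= 4^-1 * kR s z &
          forall c0 : R, gaussian_tail (Q 1) c0 ->
          forall p : R, 1 < p -> exists Lp : R, 1 < Lp /\
          forall s x : R, 0 <= s -> 2 * b + 2 <= x ->
            (k s x <= (Lp `^ x * expR (x ^+ 2 * p / (4 * (p * s + 4 * c0))))%:E)%E] &
      exists x0 : R, 0 < x0 /\
      forall p c0 : R, 1 < p -> gaussian_tail (Q 1) c0 ->
      exists C1 : R, 0 < C1 /\
      forall x : R, x0 < x ->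
        - (a * x ^+ 2) - C1 * x <= ln (Q r x)
        <= - (a * c0 / (p * a + c0) * x ^+ 2) + C1 * x].
Proof.
have T0 : 0 < T by exact: lt_le_trans (fuglede_T_gt0 R d) hT.
have gamma0 : 0 < gamma by case/andP: hgamma.
have [Y [hY hL]] := hM.
have r01 : 0 < r < 1 := hr.
have l0 : 0 < ln r^-1 by case/andP: hr => r0 r1; rewrite ln_gt0// invf_gt1.
move=> a b Q k kR.
have a0 : 0 < a by rewrite invr_gt0 !mulr_gt0// exprn_gt0.
have b0 : 0 <= b by rewrite addr_ge0// divr_ge0// exprn_ge0// ltW.
have mQ : measurable_fun setT (Q 1) by exact: measurable_laplace.
have Q_gt0 y : 0 < Q 1 y by exact: laplace_gt0.
have Q_le1 y : Q 1 y <= 1 by exact: laplace_le1.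
have mN : measurable_fun setT (ball_mass M 1).
  by apply: measurable_gmc_fine; exact: measurable_eball.
have N_ge0 w : 0 <= ball_mass M 1 w by exact: fine_ge0.
have N_gt0 := ball_mass_gt0_ae d_gt0 T0 hZ htheta hY hL.
have kE s x : k s x = gauss_transform (Q 1) b s x.
  rewrite /k (kappa_integral hT1 mN hindep N_gt0 N_ge0).
  by apply: eq_integral => y _; rewrite /Q laplaceE.
have {kE}kE : k = gauss_transform (Q 1) b by apply/funext => s; apply/funext => x; exact: kE.
have kRE s z : kR s z = gauss_moment (Q 1) b 0 s z.
  by rewrite /kR kE gauss_transformE.
have kR1 z : kR^~ z = (gauss_moment (Q 1) b 0)^~ z by apply/funext => s; exact: kRE.
have kR2 s : kR s = gauss_moment (Q 1) b 0 s by apply/funext => z; exact: kRE.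
have scaling x := laplace_scaling T0 hZ htheta hY gamma0 hL r01 x.
have dz n s z s0 := @gauss_moment_derive_z R (Q 1) mQ Q_gt0 Q_le1 b n s z s0.
have ds n s z s0 := @gauss_moment_derive_s R (Q 1) mQ Q_gt0 Q_le1 b n s z s0.
have kR2' s : 0 < s -> derive1 (kR s) = (fun z => 2^-1 * gauss_moment (Q 1) b 1 s z).
  by move=> s0; apply/funext => z; rewrite kR2 (dz 0%N s z s0).2 mulrC.
have a40 : 0 < 4 * a by rewrite mulr_gt0.
split.
- by move=> x _; rewrite kE; exact: scaling.
- move=> s z s0 _; have [d1 e1] := dz 1%N s z s0; split.
  + by rewrite kE; exact: gauss_transform_fin.
  + by rewrite kR1; exact: (ds 0%N s z s0).1.
  + by rewrite kR2; exact: (dz 0%N s z s0).1.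
  + by rewrite kR2'//; exact: (derivableM (derivable_cst _ _ _) d1).
  + rewrite kR1 (ds 0%N s z s0).2 kR2'// derive1Ml// e1.
    by field.
- split.
  + by move=> s z _ _; rewrite kE; exact: gauss_transform_ge0.
  + move=> z _; rewrite kE; split.
    * exact: gauss_transform_convex_s.
    * by move=> s1 s2 s10 s12; exact: gauss_transform_decreasing.
    * exact: gauss_transform_cvg0.
  + by move=> s _; rewrite kE; exact: gauss_transform_convex_z.
  + move=> s z s0 _; rewrite kR1 (ds 0%N s z s0).2 kR2'// kRE (mulrC 2^-1).
    exact: gauss_moment_square_ge0.
  + move=> c0 [c00 [C0 [t0 [C00 t00 tail]]]] p p1.
    have l_gt0 := growth_rate_gt0 c00 C00 t00.
    exists (expR (growth_rate c0 C0 t0)); split; first by rewrite -expR0 ltr_expR.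
    move=> s x s0 x2; rewrite kE /powR gt_eqF ?expR_gt0// expRK (mulrC x).
    exact: (gauss_transform_bound mQ Q_gt0 Q_le1 b0 c00 C00 t00 tail p1 s0 x2).
have x0_ge0 : 0 <= (2 * b + 2) / (4 * a).
  by apply: divr_ge0; [apply: addr_ge0 => //; exact: mulr_ge0|exact: ltW].
(* beyond this point [4 a x] is in the range of the growth bound, and [x >= 1] *)
exists ((2 * b + 2) / (4 * a) + 1); split; first exact: ltr_pwDr.
move=> p c0 p1 [c00 [C0 [t0 [C00 t00 tail]]]].
have l_gt0 := growth_rate_gt0 c00 C00 t00.
have [c [c_gt0 cK]] := gauss_transform_ge_const mQ Q_gt0 Q_le1 b a40.
have C_gt0 : 0 < coef_C d gamma r.
  have r0 : 0 < r by case/andP: hr.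
  by rewrite divr_gt0 ?powR_gt0// sqrtr_gt0 !mulr_gt0 ?pi_gt0// exprn_gt0.
exists (`|ln (coef_C d gamma r)| + `|ln c| + b + 4 * a * growth_rate c0 C0 t0); split.
  by rewrite ltr_wpDl ?mulr_gt0// addr_ge0// addr_ge0.
move=> x xx0.
have x1 : 1 <= x by apply: le_trans (ltW xx0); rewrite lerDr.
have x2 : 2 * b + 2 <= 4 * a * x.
  rewrite [leRHS]mulrC -ler_pdivrMr//; apply: le_trans (ltW xx0).
  by rewrite lerDl.
have fin := gauss_transform_fin mQ Q_gt0 Q_le1 b (4 * a * x) a40.
have Qr : Q r x = coef_C d gamma r * expR (- (a * x ^+ 2) + b * x) *
    fine (gauss_transform (Q 1) b (4 * a) (4 * a * x)).
  have := scaling x; rewrite -[X in _ = (_ * X)%E](fineK fin) -EFinM => h.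
  exact: (EFin_inj h).
rewrite Qr; apply/andP.
apply: (ln_transform_bounds C_gt0 a0 b0 l_gt0 c_gt0 c00 p1 x1).
  rewrite -lee_fin fineK//; apply: cK.
  by rewrite mulr_ge0 ?(ltW a40)// (le_trans ler01 x1).
rewrite -lee_fin fineK//.
exact: (gauss_transform_bound mQ Q_gt0 Q_le1 b0 c00 C00 t00 tail p1 (ltW a40) x2).
Qed.
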